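(* Suppose that $\phi$ is a $C^3$ scalar field in the plane, $W(t)$ is a Brownian motion in the plane, $W(0)=0$, and $y\in\mathbb{R}^2$. With $m=0,1,\dots$ and $h=2^{-m}$, apply the discrete Tanaka–Rosen–Yor formula (displayed in the context) to the imbedded random walks $S_n=B_m(n2^{-2m})$. Then, as $m\to\infty$, each term of the discrete formula almost surely tends to the corresponding term of the following continuous formula, uniformly on any bounded interval $t\in[0,K]$: $$\int_0^t\phi(W(t)-W(u)-y)\,du=t\,\phi(-y)+\int_0^t\int_0^v(\nabla\phi)(W(v)-W(u)-y)\,du\cdot dW(v)+\frac12\int_0^t\int_0^v(\Delta\phi)(W(v)-W(u)-y)\,du\,dv.$$ The last term can be written as an almost sure limit of sums involving self-intersection local times of imbedded random walks: $$L\phi(t,y):=\int_0^t\int_0^v(\Delta\phi)(W(v)-W(u)-y)\,du\,dv=\lim_{m\to\infty}\sum_{x\in2^{-m}\mathbb{Z}^2}\alpha_m(t,x)\,(\Delta\phi)(x-y)\,2^{-2m}.$$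
   Context: Superscripts denote coordinates; $D_j$ is the partial derivative with respect to $x^j$, $\nabla=(D_1,D_2)$, $\Delta=D_{11}+D_{22}$. Imbedded (Skorohod embedded) random walks: $W=(W^1,W^2)$ has independent one-dimensional Brownian components. For $j=1,2$ and $m\ge0$ let $s_m^j(0)=0$, $s_m^j(k+1)=\inf\{s>s_m^j(k):|W^j(s)-W^j(s_m^j(k))|=2^{-m}\}$, and $B_m^j(k2^{-2m})=W^j(s_m^j(k))$ $(k\ge0)$, $B_m=(B_m^1,B_m^2)$. Discrete path integral: a discrete path on the grid $h\mathbb{Z}^2$ is a formal sum $\gamma=\sum_r[x_r,x_r+\mu_rhe_{j_r}]$ of finitely many oriented edges between neighbouring grid points ($\mu_r=\pm1$, $e_1,e_2$ the coordinate unit vectors). For a vector field $f=(f^1,f^2)$, $T_\gamma(f(x),\gamma_0'(x))h:=\frac h2\sum_r\mu_r\left(f^{j_r}(x_r)+f^{j_r}(x_r+\mu_rhe_{j_r})\right)$, where $x$ is the dummy variable of the summation. Discrete Tanaka–Rosen–Yor formula: let $h>0$, $S_0=0$, $S_n=h(X_1+\cdots+X_n)$ with $X_r=(X_r^1,X_r^2)$, $X_r^j=\pm1$, the steps being performed in time units $h^2$; let $\gamma_r=[0,(S_r^1,0)]+[(S_r^1,0),S_r]$ (two straight pieces along the grid) and $n=\lfloor t/h^2\rfloor$. The formula, which the paper states for a parameter $y\in h\mathbb{Z}^2$, reads $$\sum_{j=0}^n\left\{T_{\gamma_n}(\nabla\phi(x-S_j-y),\gamma_0'(x))h\right\}h^2=\sum_{r=1}^n\left\{T_{\gamma_r}(\nabla\phi(x-S_r-y),\gamma_0'(x))h\right\}h^2$$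 $$+\sum_{r=1}^n\sum_{j=0}^{r-1}\left\{(D_1\phi)(S_{r-1}-S_j-y)hX_r^1+(D_2\phi)((S_r^1,S_{r-1}^2)-S_j-y)hX_r^2\right\}h^2$$ $$+\frac12\sum_{r=1}^n\sum_{j=0}^{r-1}(\Delta\phi)(S_{r-1}-S_j-y)\,h^4+O(h)+O(\epsilon(h)),$$ where $\epsilon(h)\to0$ as $h\to0$. Self-intersection local time of the imbedded walk: $\alpha_m(t,x):=2^{-2m}\,\#\{(i,j):0\le i\le j<t2^{2m},\ B_m(j2^{-2m})-B_m(i2^{-2m})=x\}$ for $x\in2^{-m}\mathbb{Z}^2$.
   Formalization: The discrete left side and first right-hand term are shown to tend to the corresponding continuous terms minus the common summand ∫_0^t φ(−W(u)−y)du, which cancels in the formula; without it the claim fails, e.g. for φ=1. *)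

(* Defs.v *)
From HB Require Import structures.
From mathcomp Require Import all_boot all_order all_algebra.
From mathcomp Require Import finmap.
From mathcomp Require Import all_classical all_reals all_analysis.

Set Implicit Arguments.
Unset Strict Implicit.
Unset Printing Implicit Defensive.

Import Order.TTheory GRing.Theory Num.Theory.
Import numFieldNormedType.Exports.

Local Open Scope classical_set_scope.
Local Open Scope ring_scope.

(* The plane is 'rV[R]_2. *)
Definition j1 : 'I_2 := ord0.
Definition j2 : 'I_2 := ord_max.

Definition vec (R : realType) (a b : R) : 'rV[R]_2 :=
  \row_(j < 2) (if j == j1 then a else b).

Definition unit_vec (R : realType) (j : 'I_2) : 'rV[R]_2 := delta_mx 0 j.

Definition partial (R : realType) (j : 'I_2) (f : 'rV[R]_2 -> R)
    (x : 'rV[R]_2) : R := 'D_(unit_vec R j) f x.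

Definition nabla (R : realType) (f : 'rV[R]_2 -> R) (x : 'rV[R]_2) : 'rV[R]_2 :=
  \row_(j < 2) partial j f x.

Definition laplacian (R : realType) (f : 'rV[R]_2 -> R) (x : 'rV[R]_2) : R :=
  partial j1 (partial j1 f) x + partial j2 (partial j2 f) x.

Fixpoint Ck (R : realType) (k : nat) (f : 'rV[R]_2 -> R) : Prop :=
  match k with
  | 0%N => continuous f
  | k'.+1 => continuous f /\
      forall j : 'I_2, (forall x, derivable f x (unit_vec R j)) /\
                       Ck k' (partial j f)
  end.

Definition sigma_of (d : measure_display) (T : measurableType d)
    (R : realType) (J : Type) (X : J -> T -> R) (D : set J) : set (set T) :=
  <<s [set E | exists j B, [/\ D j, measurable B & E = X j @^-1` B]] >>.

(* In [normal_prob m s] the parameter s is the standard deviation. *)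
Definition brownian (d : measure_display) (T : measurableType d)
    (R : realType) (P : probability T R) (B : R -> {RV P >-> R}) : Prop :=
  [/\ \forall w \ae P, B 0 w = 0,
      \forall w \ae P, {within `[0, +oo[, continuous (fun t => B t w)},
      (forall s t : R, 0 <= s -> s < t -> forall A : set R, measurable A ->
         P [set w | A (B t w - B s w)] = normal_prob 0 (Num.sqrt (t - s)) A)
    & (forall s t : R, 0 <= s -> s < t ->
         forall (E : set T) (A : set R),
         sigma_of (fun u => B u : T -> R) `[0, s] E -> measurable A ->
         P (E `&` [set w | A (B t w - B s w)]) =
         (P E * P [set w | A (B t w - B s w)%R])%E)].

Definition planar_brownian (d : measure_display) (T : measurableType d)
    (R : realType) (P : probability T R) (W : 'I_2 -> R -> {RV P >-> R}) : Prop :=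
  (forall j, brownian (W j)) /\
  (forall E F : set T,
     sigma_of (fun u => W j1 u : T -> R) `[0, +oo[ E ->
     sigma_of (fun u => W j2 u : T -> R) `[0, +oo[ F ->
     P (E `&` F) = (P E * P F)%E).

Definition planar_filtration (d : measure_display) (T : measurableType d)
    (R : realType) (P : probability T R) (W : 'I_2 -> R -> {RV P >-> R})
    (s : R) : set (set T) :=
  sigma_of (fun ju : 'I_2 * R => W ju.1 ju.2 : T -> R)
    [set ju | 0 <= ju.2 <= s].

(* Elementary integrands sum_(k < N) xi^j_k 1_]t_k, t_(k+1)], j = 1, 2, with
   xi^j_k bounded and F_(t_k)-measurable. *)
Record simple_process (T : Type) (R : realType) := SimpleProcess {
  sp_size : nat;
  sp_time : nat -> R;
  sp_value : 'I_2 -> nat -> T -> R }.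

Definition simple_wf (d : measure_display) (T : measurableType d)
    (R : realType) (P : probability T R) (W : 'I_2 -> R -> {RV P >-> R})
    (H : simple_process T R) : Prop :=
  [/\ 0 <= sp_time H 0,
      (forall k, sp_time H k <= sp_time H k.+1),
      (forall j k (B : set R), measurable B ->
         planar_filtration W (sp_time H k) (sp_value H j k @^-1` B))
    & (forall j k, exists C : R, forall w, `|sp_value H j k w| <= C)].

Definition simple_eval (T : Type) (R : realType) (H : simple_process T R)
    (j : 'I_2) (v : R) (w : T) : R :=
  \sum_(k < sp_size H)
    sp_value H j k w * \1_(`]sp_time H k, sp_time H k.+1]) v.

Definition simple_integral (d : measure_display) (T : measurableType d)
    (R : realType) (P : probability T R) (W : 'I_2 -> R -> {RV P >-> R})
    (H : simple_process T R) (t : R) (w : T) : R :=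
  \sum_(j < 2) \sum_(k < sp_size H)
    sp_value H j k w *
    (W j (Num.min (sp_time H k.+1) t) w - W j (Num.min (sp_time H k) t) w).

(* The A n need not be measurable: their outer probability tends to 0. *)
Definition vanishes_in_prob (d : measure_display) (T : measurableType d)
    (R : realType) (P : probability T R) (A : nat -> set T) : Prop :=
  exists E : nat -> set T,
    [/\ (forall n, measurable (E n)), (forall n, A n `<=` E n)
      & (fun n => P (E n)) @ \oo --> 0%E].

(* I_t = \int_0^t H dW = sum_j \int_0^t H^j dW^j: the Ito integral of a locally
   square integrable integrand, as the limit, locally uniformly in time and in
   probability, of integrals of simple processes H_n such that
   \int_0^K |H_n - H|^2 dv -> 0 in probability for every K.  This determines I
   up to indistinguishability.  The time integral is kept in \bar R so that a
   divergent one counts as +oo. *)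
Definition ito_integral (d : measure_display) (T : measurableType d)
    (R : realType) (P : probability T R) (W : 'I_2 -> R -> {RV P >-> R})
    (H : 'I_2 -> R -> T -> R) (I : R -> T -> R) : Prop :=
  (forall j, \forall w \ae P,
     measurable_fun (`[0, +oo[ : set R) (fun v : R => H j v w)) /\
  exists Hn : nat -> simple_process T R,
    [/\ (forall n, simple_wf W (Hn n)),
        (forall K e : R, 0 < K -> 0 < e -> vanishes_in_prob P (fun n =>
           [set w | (e%:E < \int[lebesgue_measure]_(v in `[0%R, K])
              (\sum_(j < 2) (simple_eval (Hn n) j v w - H j v w) ^+ 2)%R%:E)%E]))
      & (forall K e : R, 0 < K -> 0 < e -> vanishes_in_prob P (fun n =>
           [set w | exists t, 0 <= t <= K /\
              e < `|simple_integral W (Hn n) t w - I t w|]))].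

Definition planar_path (d : measure_display) (T : measurableType d)
    (R : realType) (P : probability T R) (W : 'I_2 -> R -> {RV P >-> R})
    (w : T) (t : R) : 'rV[R]_2 := \row_(j < 2) W j t w.

(* If the set of hitting times is empty (a null event for Brownian paths),
   [inf] returns 0. *)
Fixpoint skorohod_time (R : realType) (b : R -> R) (h : R) (k : nat) : R :=
  match k with
  | 0%N => 0
  | k'.+1 => let s0 := skorohod_time b h k' in
             inf [set s | s0 < s /\ `|b s - b s0| = h]
  end.

(* [imbedded_walk b m k] is B_m(k 2^(-2m)) for the path b. *)
Definition imbedded_walk (R : realType) (b : R -> 'rV[R]_2) (m k : nat)
    : 'rV[R]_2 :=
  \row_(j < 2) b (skorohod_time (fun s => b s 0 j) (2 ^- m) k) 0 j.

(* On a grid of mesh h, the oriented edge [x, x + mu h e_j], mu = +1 or -1. *)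
Record edge (R : realType) := Edge {
  edge_src : 'rV[R]_2;
  edge_dir : 'I_2;
  edge_neg : bool }.

Definition edge_sign (R : realType) (e : edge R) : R := (-1) ^+ edge_neg e.

Definition edge_tgt (R : realType) (h : R) (e : edge R) : 'rV[R]_2 :=
  edge_src e + (edge_sign e * h) *: unit_vec R (edge_dir e).

Definition discrete_integral (R : realType) (h : R) (gamma : seq (edge R))
    (f : 'rV[R]_2 -> 'rV[R]_2) : R :=
  h / 2 * \sum_(e <- gamma)
    edge_sign e * (f (edge_src e) 0 (edge_dir e) + f (edge_tgt h e) 0 (edge_dir e)).

(* The straight path from x to x + a e_j, for a an integer multiple of h. *)
Definition segment (R : realType) (h : R) (x : 'rV[R]_2) (j : 'I_2) (a : R)
    : seq (edge R) :=
  [seq Edge (x + ((-1) ^+ (a < 0)%R * i%:R * h) *: unit_vec R j) j (a < 0)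
     | i <- iota 0 (Num.truncn (`|a| / h))].

(* [0, (z^1, 0)] + [(z^1, 0), z] *)
Definition corner_path (R : realType) (h : R) (z : 'rV[R]_2) : seq (edge R) :=
  segment h 0 j1 (z 0 j1) ++ segment h (vec (z 0 j1) 0) j2 (z 0 j2).

Definition walk_step (R : realType) (h : R) (S : nat -> 'rV[R]_2) (r : nat)
    (j : 'I_2) : R := (S r 0 j - S r.-1 0 j) / h.

(* The terms of the discrete Tanaka-Rosen-Yor formula
     trm_lhs = trm_path + trm_mart + trm_lap + O(h) + O(epsilon(h)). *)
Definition trm_lhs (R : realType) (phi : 'rV[R]_2 -> R) (y : 'rV[R]_2) (h : R)
    (S : nat -> 'rV[R]_2) (n : nat) : R :=
  \sum_(0 <= j < n.+1)
    discrete_integral h (corner_path h (S n))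
      (fun x => nabla phi (x - S j - y)) * h ^+ 2.

Definition trm_path (R : realType) (phi : 'rV[R]_2 -> R) (y : 'rV[R]_2) (h : R)
    (S : nat -> 'rV[R]_2) (n : nat) : R :=
  \sum_(1 <= r < n.+1)
    discrete_integral h (corner_path h (S r))
      (fun x => nabla phi (x - S r - y)) * h ^+ 2.

Definition trm_mart (R : realType) (phi : 'rV[R]_2 -> R) (y : 'rV[R]_2) (h : R)
    (S : nat -> 'rV[R]_2) (n : nat) : R :=
  \sum_(1 <= r < n.+1) \sum_(0 <= j < r)
    (partial j1 phi (S r.-1 - S j - y) * (h * walk_step h S r j1)
     + partial j2 phi (vec (S r 0 j1) (S r.-1 0 j2) - S j - y)
       * (h * walk_step h S r j2)) * h ^+ 2.

Definition trm_lap (R : realType) (phi : 'rV[R]_2 -> R) (y : 'rV[R]_2) (h : R)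
    (S : nat -> 'rV[R]_2) (n : nat) : R :=
  2^-1 * \sum_(1 <= r < n.+1) \sum_(0 <= j < r)
    laplacian phi (S r.-1 - S j - y) * h ^+ 4.

(* A term of the discrete formula for S_n = B_m(n 2^(-2m)), h = 2^(-m) and
   n = floor(t / h^2), as a function of t. *)
Definition along_imbedded (R : realType) (b : R -> 'rV[R]_2)
    (trm : R -> (nat -> 'rV[R]_2) -> nat -> R) (m : nat) (t : R) : R :=
  let h := 2 ^- m in trm h (imbedded_walk b m) (Num.truncn (t / h ^+ 2)).

Definition grid (R : realType) (h : R) : set 'rV[R]_2 :=
  [set x | forall j, exists k : int, x 0 j = k%:~R * h].

Definition self_local_time (R : realType) (b : R -> 'rV[R]_2) (m : nat) (t : R)
    (x : 'rV[R]_2) : R :=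
  2 ^- (2 * m) *
  (#|` fset_set [set ij : nat * nat | [/\ (ij.1 <= ij.2)%N,
        ij.2%:R < t * 2 ^+ (2 * m)
      & imbedded_walk b m ij.2 - imbedded_walk b m ij.1 = x] ]|)%:R.

(* Main.v *)
Require Import Defs.
From HB Require Import structures.
From mathcomp Require Import all_boot all_order all_algebra.
From mathcomp Require Import finmap.
From mathcomp Require Import all_classical all_reals all_analysis.
From mathcomp Require Import measurable_realfun ring lra.

(** Almost every path b of a planar Brownian motion has the following properties
([good_path], [good_ae]): its coordinates start from 0 and are uniformly
continuous on bounded intervals; the squares of their increments over the grid
of mesh 2^-n add up to the elapsed time in the limit, and the products of the
increments of the two coordinates to 0; and, for each coordinate, 4^-m times the
number of Skorohod times of mesh 2^-m up to a dyadic time t tends to t.  The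
limits in the theorem are deterministic consequences of these properties.

The imbedded walk.  The last property says that the Skorohod clock keeps the
right time, so S_k = B_m(k 4^-m) is uniformly close to b(k 4^-m)
([imbedded_walk_cvg]).  Riemann sums of continuous functions of S_k - S_j - y
then converge to integrals along b; this is the limit of the Laplacian term, and
of the local time sum once the pairs (i, j) are grouped by the value of
S_j - S_i ([local_time_sum]).  The integral of a gradient along the corner path
telescopes up to the error of the trapezoid rule ([corner_integral]), so the
left-hand side and the path term reduce to sums of values of phi.  For the
martingale term, Taylor's formula in one coordinate at a time gives a discrete
Ito formula ([discrete_ito]), in which the squared increments of the walk are
equal to h^2.  It follows that the martingale term tends to
  I_t = int_0^t phi(b_t - b_u - y) du - t phi(-y) - L phi(t, y) / 2.
This expression is the definition of I ([martingale_part]): the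
Tanaka-Rosen-Yor formula holds by construction, and what has to be proved about
I is that it is the Ito integral.

The Ito integral.  The same discrete Ito formula, applied to the samples
b(k 2^-n), has weighted sums of squared and mixed increments instead of h^2.
Their weights vary slowly, so these sums converge as soon as the unweighted ones
do ([row_cvg_weighted]).  Hence the sums of G_k (b_(k+1) - b_k), with G_k the
Riemann sum for the integrand at time k 2^-n, converge to I locally uniformly
([dyadic_ito]).  Truncating G_k at height n makes it an elementary integrand,
whose value is eventually unchanged on [0, K].  Almost sure uniform convergence
gives convergence in outer probability, the measurable supersets being read off
from the Cauchy differences at rational times ([uniform_vanishes]).

The almost sure properties.  The errors in the quadratic variation and in the
covariation have second moments of order 2^-n, whence convergence by Chebyshev
and Borel-Cantelli ([L2_ae_cvg0]).  For the Skorohod clock with h = 2^-m, let N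
be the number of Skorohod times up to t and L_s the last level hit before s.
Then, by summation,
  2 int_0^t (b_s - L_s) db_s = N h^2 + (b_t - L_t)^2 - t,
where |b_s - L_s| <= h, so the left-hand side has second moment at most 4 h^2 t,
which is summable over m.  No stopping time is needed if L is replaced by the
[tracker], which is computed from samples of the path: the identity becomes a
limit along the grids ([tracker_cvg]) and the moment bound holds for each sum of
martingale increments ([tracker_moment]); together they give [crossings_ae].
The moments of the normal law come from the total masses of shifted and rescaled
Gaussian densities and from 1 + u <= exp u. *)

Set Implicit Arguments.
Unset Strict Implicit.
Unset Printing Implicit Defensive.

Import Order.TTheory GRing.Theory Num.Theory.
Import numFieldNormedType.Exports.

Local Open Scope classical_set_scope.
Local Open Scope ring_scope.

(** * Uniform continuity on bounded intervals *)

Section UniformContinuity.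
Variable R : realType.

(** The form in which continuity of a path on [0, +oo[ is used; it does not
mention the values of b at negative times, which are arbitrary. *)
Definition modulus_on (V : normedModType R) (b : R -> V) : Prop :=
  forall K e : R, 0 < e -> exists2 d : R, 0 < d &
    forall s t : R, 0 <= s <= K -> 0 <= t <= K -> `|s - t| < d -> `|b s - b t| < e.

Lemma continuous_unif_compact (V U : normedModType R) (f : V -> U) (A : set V) :
  continuous f -> compact A -> forall e : R, 0 < e ->
  exists2 d : R, 0 < d & forall x x', A x -> `|x - x'| < d -> `|f x - f x'| < e.
Proof.
move=> cf /compact_near_coveringP cA e e0.
pose P (d : R) (x : V) := forall x', `|x - x'| < d -> `|f x - f x'| < e.
have H : \forall d \near (0 : R)^'+, A `<=` P d.
  apply: cA => x Ax.
  have /cvgrPdist_lt/(_ (e / 2)) := cf x.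
  rewrite divr_gt0// => /(_ isT)/nbhs_normP[d /= d0 dP].
  exists (ball x (d / 2), [set d' | d' < d / 2]).
    split; first exact: nbhsx_ballx (divr_gt0 _ _).
    by apply: nbhs_right_lt; rewrite divr_gt0.
  move=> [x1 d'] /= [x1x d'd] x' x'x1.
  rewrite -ball_normE /= in x1x.
  have h1 : `|f x - f x1| < e / 2.
    by apply: dP => /=; rewrite (lt_trans x1x)// ltr_pdivrMr// ltr_pMr// ltr1n.
  have h2 : `|f x - f x'| < e / 2.
    apply: dP => /=; rewrite -(subrKA x1) (le_lt_trans (ler_normD _ _))//.
    by rewrite (splitr d) ltrD// (lt_trans x'x1).
  rewrite -(subrKA (f x)) (le_lt_trans (ler_normD _ _))//.
  by rewrite (splitr e) ltrD// distrC.
near (0 : R)^'+ => d.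
exists d; first by near: d; exact: nbhs_right_gt.
move=> x x' Ax xx'; apply: (_ : P d x) => //; move: x Ax {xx'}.
by near: d.
Unshelve. all: by end_near. Qed.

Lemma rV_ball_compact (M : R) : compact [set x : 'rV[R]_2 | `|x| <= M].
Proof.
apply: bounded_closed_compact.
  exists M; split; first exact: num_real.
  by move=> M' MM' x /= /le_trans; apply; rewrite ltW.
apply: (@preimage_closed _ _ (fun x : 'rV[R]_2 => `|x|) [set y | y <= M]).
  by move=> x _; exact: norm_continuous.
exact: closed_le.
Qed.

Lemma unif_on_ball (f : 'rV[R]_2 -> R) (M e : R) : continuous f -> 0 < e ->
  exists2 d : R, 0 < d & forall x x', `|x| <= M -> `|x - x'| < d -> `|f x - f x'| < e.
Proof.
move=> cf e0.
by have [d d0 H] := continuous_unif_compact cf (@rV_ball_compact M) e0; exists d.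
Qed.

Lemma bound_on_ball (f : 'rV[R]_2 -> R) (M : R) : continuous f ->
  exists2 C : R, 0 < C & forall x, `|x| <= M -> `|f x| <= C.
Proof.
move=> cf.
have [d d0 H] := unif_on_ball M cf ltr01.
have := @continuous_compact _ _ f _ _ (@rV_ball_compact M).
move=> /(_ (continuous_subspaceT cf))/compact_bounded[C [_ CP]].
exists (`|C| + 1); first by rewrite ltr_pwDr.
move=> x xM; apply: (CP (`|C| + 1)); last by exists x.
by rewrite (le_lt_trans (ler_norm _))// ltrDl.
Qed.

Lemma within_modulus (V : normedModType R) (b : R -> V) :
  {within `[0, +oo[, continuous b} -> modulus_on b.
Proof.
move=> /subspace_continuousP cb.
pose c t := b (Num.max t 0).
have cc : continuous c.
  move=> x; apply/cvgrPdist_lt => e e0.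
  have := cb (Num.max x 0); rewrite /= in_itv/= le_max lexx orbT andbT => /(_ isT).
  move=> /cvgrPdist_lt/(_ _ e0); rewrite /prop_near1 /within/= => /nbhs_normP[d /= d0 dP].
  apply/nbhs_normP; exists d => //= t tx; apply: dP => /=; last first.
    by rewrite in_itv/= le_max lexx orbT.
  move: tx; rewrite /=; apply: le_lt_trans.
  rewrite !maxEle; do 2 case: ifPn; rewrite -?ltNge ?subrr ?normr0 //; move=> h1 h2.
  - by rewrite sub0r normrN ger0_norm ?(ltW h1)// ler_normr; lra.
  - by rewrite subr0 ger0_norm ?(ltW h2)// ler_normr; lra.
move=> K e e0.
have [d d0 H] := continuous_unif_compact cc (@segment_compact _ 0 K) e0.
exists d => // s t /andP[s0 sK] /andP[t0 tK] st.
have := H s t; rewrite /c !max_l//; apply => //.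
by rewrite /= in_itv/= s0.
Qed.

Lemma modulus_within (V : normedModType R) (b : R -> V) (K : R) :
  modulus_on b -> {within `[0, K], continuous b}.
Proof.
move=> ub; apply/subspace_continuousP => x /=; rewrite in_itv/= => xK.
apply/cvgrPdist_lt => e e0.
have [d d0 H] := ub K e e0.
rewrite /prop_near1 /within/=; apply/nbhs_normP; exists d => //= t tx.
rewrite in_itv/= => tK; exact: H.
Qed.

Lemma modulus_bound (V : normedModType R) (b : R -> V) (K : R) :
  modulus_on b -> exists2 C : R, 0 < C & forall t : R, 0 <= t <= K -> `|b t| <= C.
Proof.
move=> ub.
have := @continuous_compact _ _ b _ (modulus_within ub) (@segment_compact _ 0 K).
move=> /compact_bounded[C [_ CP]].
exists (`|C| + 1); first by rewrite ltr_pwDr.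
move=> x xM; apply: (CP (`|C| + 1)); last by exists x => //=; rewrite in_itv.
by rewrite (le_lt_trans (ler_norm _))// ltrDl.
Qed.

End UniformContinuity.

(** * Taylor estimates along a line *)

Section Taylor.
Variables (R : realType) (V : normedModType R) (v : V).

Lemma is_derive_line (f : V -> R) (x : V) (t : R) :
  derivable f (x + t *: v) v ->
  is_derive t (1 : R) (fun t => f (x + t *: v)) ('D_v f (x + t *: v)).
Proof.
move=> df.
have E : (fun h : R => h^-1 *: (((fun t => f (x + t *: v)) \o shift t) (h *: (1 : R))
            - f (x + t *: v))) =
         (fun h => h^-1 *: ((f \o shift (x + t *: v)) (h *: v) - f (x + t *: v))).
  apply/funext => h /=; congr (_ *: (f _ - _)).
  by rewrite scaler1 scalerDl addrCA.
split; first by rewrite /derivable E.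
by rewrite /derive E.
Qed.

Lemma mvt_bound (g dg : R -> R) (a B : R) :
  (forall t, is_derive t (1 : R) g (dg t)) ->
  (forall t, `|t| <= `|a| -> `|dg t| <= B) -> `|g a - g 0| <= `|a| * B.
Proof.
move=> dgP dgB.
have cg u w : {within `[u, w], continuous g}.
  apply: derivable_within_continuous => t _; exact: (@ex_derive _ _ _ _ _ _ _ (dgP t)).
have [a0|a0] := leP 0 a.
  have [c] := @MVT_segment R g dg 0 a a0 (fun x _ => dgP x) (cg _ _).
  rewrite in_itv/= subr0 => /andP[c0 ca] ->.
  by rewrite normrM mulrC ler_wpM2l// dgB// !ger0_norm.
have [c] := @MVT_segment R g dg a 0 (ltW a0) (fun x _ => dgP x) (cg _ _).
rewrite in_itv/= sub0r => /andP[ca c0] E.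
rewrite distrC E normrM normrN mulrC ler_wpM2l// dgB// !ler0_norm ?(ltW a0)//.
by rewrite lerN2.
Qed.

Variables (f : V -> R) (x : V) (a e : R).
Local Notation Df := ('D_v f).
Hypothesis df : forall x, derivable f x v.

Lemma taylor1 : (forall c, `|c| <= `|a| -> `|Df (x + c *: v) - Df x| <= e) ->
  `|f (x + a *: v) - f x - a * Df x| <= `|a| * e.
Proof.
move=> H.
have := @mvt_bound (fun t => f (x + t *: v) - t * Df x)
  (fun t => Df (x + t *: v) - Df x) a e _ H.
rewrite scale0r addr0 mul0r subr0 addrAC; apply => t.
have h1 := @is_derive_line f x t (@df _).
have h2 : is_derive t (1 : R) (fun t => t * Df x) (Df x).
  by apply: is_derive_eq; rewrite scaler0 add0r scaler1.
exact: is_deriveB.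
Qed.

(** Only one derivative is available: this is the first order expansion, in which
replacing the derivative at x by the mean of its endpoint values costs at most
another |a| e / 2. *)
Lemma trapezoid : (forall c, `|c| <= `|a| -> `|Df (x + c *: v) - Df x| <= e) ->
  `|f (x + a *: v) - f x - a / 2 * (Df x + Df (x + a *: v))| <= 2 * `|a| * e.
Proof.
move=> H; have h1 := taylor1 H; have h2 := H a (lexx _).
have -> : f (x + a *: v) - f x - a / 2 * (Df x + Df (x + a *: v)) =
  (f (x + a *: v) - f x - a * Df x) - a / 2 * (Df (x + a *: v) - Df x) by field.
rewrite (le_trans (ler_normB _ _))// normrM normrM (ger0_norm (_ : 0 <= 2^-1)) ?invr_ge0//.
have : `|a| * `|Df (x + a *: v) - Df x| <= `|a| * e by rewrite ler_wpM2l.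
move: h1 (normr_ge0 a) (normr_ge0 (Df (x + a *: v) - Df x)).
have : 0 <= e by apply: le_trans h2.
move: (`|a|) (`|Df _ - _|) (`|_ - a * _|) => *; nra.
Qed.

Hypothesis ddf : forall x, derivable Df x v.

(** The mean value inequality for f (x + t v) - t Df - t^2/2 DDf as a function of t;
its derivative is bounded by the first order estimate for Df. *)
Lemma taylor2 :
  (forall c, `|c| <= `|a| -> `|'D_v Df (x + c *: v) - 'D_v Df x| <= e) ->
  `|f (x + a *: v) - f x - a * Df x - 2^-1 * a ^+ 2 * 'D_v Df x| <= a ^+ 2 * e.
Proof.
move=> H.
have := @mvt_bound (fun t => f (x + t *: v) - t * Df x - 2^-1 * t ^+ 2 * 'D_v Df x)
  (fun t => Df (x + t *: v) - Df x - t * 'D_v Df x) a (`|a| * e).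
rewrite scale0r addr0 mul0r subr0 expr0n/= mulr0 mul0r subr0.
rewrite mulrA -normrM -expr2 ger0_norm ?sqr_ge0//.
have -> : f (x + a *: v) - a * Df x - 2^-1 * a ^+ 2 * 'D_v Df x - f x =
  f (x + a *: v) - f x - a * Df x - 2^-1 * a ^+ 2 * 'D_v Df x by ring.
apply.
- move=> t.
  have h1 := @is_derive_line f x t (@df _).
  have h2 : is_derive t (1 : R) (fun t => t * Df x) (Df x).
    by apply: is_derive_eq; rewrite scaler0 add0r scaler1.
  have h3 : is_derive t (1 : R) (fun t => 2^-1 * t ^+ 2 * 'D_v Df x) (t * 'D_v Df x).
    apply: is_derive_eq.
    by rewrite /GRing.scale/=; field.
  exact: is_deriveB.
- move=> t ta.
  have := @mvt_bound (fun t => Df (x + t *: v) - t * 'D_v Df x)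
    (fun t => 'D_v Df (x + t *: v) - 'D_v Df x) t e.
  rewrite scale0r addr0 mul0r subr0 addrAC => h.
  apply: (le_trans (h _ _)).
  + move=> s.
    have h1 := @is_derive_line Df x s (@ddf _).
    have h2 : is_derive s (1 : R) (fun t => t * 'D_v Df x) ('D_v Df x).
      by apply: is_derive_eq; rewrite scaler0 add0r scaler1.
    exact: is_deriveB.
  + by move=> c ct; apply: H; exact: le_trans ta.
  + by rewrite ler_wpM2r//; apply: le_trans (H 0 _); rewrite ?normr0.
Qed.

End Taylor.

(** * Riemann sums and parametric integrals *)

Section Riemann.
Variable R : realType.
Notation mu := (@lebesgue_measure R).

Lemma modulus_integrable (A : R -> R) (a b : R) : modulus_on A -> 0 <= a ->
  mu.-integrable `[a, b] (EFin \o A).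
Proof.
move=> uA a0.
apply: (@integrableS _ _ _ mu `[0, b]%classic) => //.
  by apply: subset_itvr; rewrite bnd_simp.
apply: continuous_compact_integrable; first exact: segment_compact.
exact: modulus_within.
Qed.

Lemma Rintegral_near_cst (A : R -> R) (a b c e : R) : modulus_on A ->
  0 <= a <= b -> (forall u, a <= u <= b -> `|A u - c| <= e) ->
  `|\int[mu]_(u in `[a, b]) A u - c * (b - a)| <= e * (b - a).
Proof.
move=> uA /andP[a0 ab] H.
have iA := modulus_integrable b uA a0.
have ic (r : R) : mu.-integrable `[a, b] (EFin \o (fun=> r)).
  apply: continuous_compact_integrable; first exact: segment_compact.
  by apply: continuous_subspaceT => x; exact: cvg_cst.
have muab : fine (mu `[a, b]) = b - a.
  rewrite lebesgue_measure_itv/= lte_fin; case: ltP => // ba.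
  by rewrite (_ : b = a) ?subrr//; apply/le_anti; rewrite ba ab.
have E (r : R) : \int[mu]_(u in `[a, b]) r = r * (b - a).
  by rewrite Rintegral_cst// muab.
rewrite -!E -RintegralB//.
have iAc : mu.-integrable `[a, b] (EFin \o (fun u => A u - c)).
  by have := integrableB _ iA (ic c); apply.
rewrite (le_trans (le_normr_Rintegral _ _))//.
apply: le_Rintegral => //.
exact: (integrable_norm iAc).
Qed.

Lemma Rintegral_increment (A : R -> R) (a b c e : R) : modulus_on A ->
  0 <= a <= b -> (forall u, a <= u <= b -> `|A u - c| <= e) ->
  `|\int[mu]_(u in `[0, b]) A u - \int[mu]_(u in `[0, a]) A u - c * (b - a)|
    <= e * (b - a).
Proof.
move=> uA /andP[a0 ab] H.
rewrite Rintegral_itvB ?bnd_simp//; last exact: modulus_integrable.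
rewrite Rintegral_itv_obnd_cbnd.
  by apply: Rintegral_near_cst; rewrite ?a0.
apply: (@integrableS _ _ _ mu `[a, b]%classic) => //.
  by apply: subset_itvr; rewrite bnd_simp.
exact: modulus_integrable.
Qed.

(** The samples a j may differ from the values of A: only their distance to A on
the j-th cell matters, which lets them be values along a discrete walk. *)
Lemma Riemann_sum (A : R -> R) (d e : R) (k : nat) (a : nat -> R) :
  modulus_on A -> 0 < d ->
  (forall j u, (j < k)%N -> j%:R * d <= u <= j.+1%:R * d -> `|A u - a j| <= e) ->
  `|\sum_(j < k) a j * d - \int[mu]_(u in `[0, k%:R * d]) A u| <= e * (k%:R * d).
Proof.
move=> uA d0; elim: k => [|k IH] H.
  by rewrite big_ord0 mul0r set_itv1 Rintegral_set1 subrr normr0 mulr0.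
have kd : k%:R * d <= k.+1%:R * d by rewrite ler_wpM2r ?(ltW d0)// ler_nat.
have k0 : 0 <= k%:R * d by rewrite mulr_ge0// ltW.
have h1 := IH (fun j u jk => H j u (ltnW jk)).
have h2 := @Rintegral_increment A (k%:R * d) (k.+1%:R * d) (a k) e uA _ (fun u => H k u (ltnSn k)).
rewrite k0 kd -mulrBl -natrB// subSnn mul1r in h2; have {}h2 := h2 isT.
rewrite big_ord_recr/= -natr1 !mulrDl mul1r mulrDr.
rewrite -[k%:R * d + d](_ : k.+1%:R * d = _); last by rewrite -natr1 mulrDl mul1r.
move: h1 h2; rewrite !ler_norml => /andP[h1 h2] /andP[h3 h4]; apply/andP; split; lra.
Qed.

(** The bound on the square is part of the definition because the integral of
A t over [0, t] varies with its endpoint as well as with A. *)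
Definition modulus2_on (A : R -> R -> R) : Prop :=
  forall K : R, (exists2 C : R, 0 < C & forall s t : R, 0 <= s <= K -> 0 <= t <= K -> `|A s t| <= C) /\
  (forall e : R, 0 < e -> exists2 d : R, 0 < d &
    forall s s' t t' : R, 0 <= s <= K -> 0 <= s' <= K -> 0 <= t <= K -> 0 <= t' <= K ->
      `|s - s'| < d -> `|t - t'| < d -> `|A s t - A s' t'| < e).

Lemma modulus2_on_snd (A : R -> R) : modulus_on A -> modulus2_on (fun _ => A).
Proof.
move=> uA K; split; last first.
  move=> e e0; have [d d0 H] := uA K e e0; exists d => // *; exact: H.
have [C C0 H] := modulus_bound K uA; exists C => // s t _; exact: H.
Qed.

Lemma modulus2_slice (A : R -> R -> R) (t : R) : 0 <= t -> modulus2_on A ->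
  modulus_on (A t).
Proof.
move=> t0 uA K e e0; have [_ /(_ e e0)[d d0 H]] := uA (Num.max t K).
have widen s : 0 <= s <= K -> 0 <= s <= Num.max t K.
  by move=> /andP[s0 sK]; rewrite s0 le_max sK orbT.
exists d => // s s' /widen sK /widen s'K ss'.
by apply: H => //; rewrite ?t0 ?le_max ?lexx// subrr normr0.
Qed.

(** Moving t by dt changes the integrand by a small amount on [0, t] and adds a
piece of length dt, on which the integrand is bounded. *)
Lemma modulus_Rintegral (A : R -> R -> R) : modulus2_on A ->
  modulus_on (fun t => \int[mu]_(u in `[0, t]) A t u).
Proof.
move=> uA K e e0.
have [K0|K0] := ltP K 0.
  by exists 1 => // s t /andP[s0 sK]; have := le_trans s0 sK; rewrite leNgt K0.
have [[C C0 AC] uAK] := uA K.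
have K1 : 0 < K + 1 by rewrite ltr_wpDl.
have [d d0 H] := uAK (e / 2 / (K + 1)) (divr_gt0 (divr_gt0 e0 (ltr0Sn _ _)) K1).
have e2C : 0 < e / 2 / C / 2 by rewrite !divr_gt0.
suff S s t : 0 <= s -> s <= t -> t <= K -> `|s - t| < Num.min d (e / 2 / C / 2) ->
    `|\int[mu]_(u in `[0, t]) A t u - \int[mu]_(u in `[0, s]) A s u| < e.
  exists (Num.min d (e / 2 / C / 2)); first by rewrite lt_min d0.
  move=> s t /andP[s0 sK] /andP[t0 tK] st.
  by have [h|/ltW h] := leP s t; [rewrite distrC|]; apply: S => //; rewrite distrC.
move=> s0 st tK; rewrite lt_min => /andP[std ste].
have t0 := le_trans s0 st; have sK := le_trans st tK.
have uAt := modulus2_slice t0 uA; have uAs := modulus2_slice s0 uA.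
have h1 := @Rintegral_increment _ s t 0 C uAt.
rewrite s0 st mul0r subr0 in h1; have {}h1 := h1 isT.
have {}h1 := h1 (fun u => _).
have h2 : `|\int[mu]_(u in `[0, s]) A t u - \int[mu]_(u in `[0, s]) A s u| <= e / 2 / (K + 1) * s.
  rewrite -RintegralB//; last 2 first.
  - exact: modulus_integrable.
  - exact: modulus_integrable.
  have := @Rintegral_near_cst (fun u => A t u - A s u) 0 s 0 (e / 2 / (K + 1)).
  rewrite mul0r !subr0; apply.
  - move=> K' e' e0'.
    have e2 : 0 < e' / 2 by rewrite divr_gt0.
    have [d1 d10 H1] := uAt K' _ e2; have [d2 d20 H2] := uAs K' _ e2.
    exists (Num.min d1 d2); first by rewrite lt_min d10.
    move=> x x' xK x'K; rewrite lt_min => /andP[xx1 xx2].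
    have := H1 _ _ xK x'K xx1; have := H2 _ _ xK x'K xx2.
    rewrite !ltr_norml => /andP[? ?] /andP[? ?]; apply/andP; split; lra.
  - by rewrite lexx.
  - move=> u /andP[u0 us]; rewrite subr0.
    apply/ltW/H; rewrite ?subrr ?normr0// ?t0 ?s0 ?u0 ?tK//=; last by rewrite distrC.
    - by rewrite (le_trans us).
    - by rewrite (le_trans us).
have h3 : e / 2 / (K + 1) * s <= e / 2.
  by rewrite -(mulrA (e / 2)) ler_piMr ?divr_ge0 ?(ltW e0)// ler_pdivrMl// mulr1; lra.
have h4 : C * (t - s) < e / 2.
  have hC : 0 <= C * (t - s) by rewrite mulr_ge0 ?subr_ge0// ltW.
  have := ste; rewrite distrC ger0_norm ?subr_ge0// ltr_pdivlMr// ltr_pdivlMr//.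
  by move: hC; lra.
have {}h1 : `|\int[mu]_(u in `[0, t]) A t u - \int[mu]_(u in `[0, s]) A t u| <= C * (t - s).
  apply: h1 => u /andP[su ut]; rewrite subr0 AC// ?t0 ?tK//=.
  by rewrite (le_trans s0)// (le_trans ut).
move: h1 h2; rewrite !ler_norml ltr_norml => /andP[? ?] /andP[? ?]; apply/andP; split; lra.
Qed.

End Riemann.

(** * Locally uniform convergence of discrete paths *)

Section Arrays.
Variable R : realType.
Notation mu := (@lebesgue_measure R).

Lemma uniform_cvgP (A : set R) (u : nat -> R -> R) (f : R -> R) :
  (forall e : R, 0 < e -> \forall n \near \oo, forall t, A t -> `|f t - u n t| < e) ->
  {uniform A, u @ \oo --> f}.
Proof.
move=> H P /uniform_nbhs[E [entE EP]].
move: entE; rewrite -(@entourage_ballE R R^o) => -[e /= e0 eE].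
near=> n; apply: EP => /= t At; apply: eE => /=.
rewrite -ball_normE /=; move: t At.
by near: n; exact: H.
Unshelve. all: by end_near. Qed.

Variable d : nat -> R.
Hypothesis d_gt0 : forall n, 0 < d n.
Hypothesis d_cvg0 : d @ \oo --> 0.

Lemma mesh_lt (e : R) : 0 < e -> \forall n \near \oo, d n < e.
Proof.
move=> e0; move/cvgrPdist_lt : d_cvg0 => /(_ _ e0).
by apply: filterS => n; rewrite sub0r normrN; exact/le_lt_trans/ler_norm.
Qed.

(** Row n is a function on the grid of mesh d n; its distance to A is measured
uniformly over the grid points of each bounded interval. *)
Definition row_cvg (a : nat -> nat -> R) (A : R -> R) :=
  forall K e : R, 0 < e -> \forall n \near \oo,
    forall k, k%:R * d n <= K -> `|a n k - A (k%:R * d n)| <= e.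

(** The two-time analogue, needed only below the diagonal since the sums run over
the past. *)
Definition array_cvg (a : nat -> nat -> nat -> R) (A : R -> R -> R) :=
  forall K e : R, 0 < e -> \forall n \near \oo,
    forall k j, (j <= k)%N -> k%:R * d n <= K ->
      `|a n k j - A (k%:R * d n) (j%:R * d n)| <= e.

Lemma row_cvg_sum (a : nat -> nat -> nat -> R) (A : R -> R -> R) :
  modulus2_on A -> array_cvg a A ->
  row_cvg (fun n k => \sum_(j < k) a n k j * d n)
    (fun t => \int[mu]_(u in `[0, t]) A t u).
Proof.
move=> uA aA K e e0.
pose K1 := `|K| + 1.
have K10 : 0 < K1 by rewrite ltr_wpDl.
have e1 : 0 < e / 2 / K1 by rewrite !divr_gt0.
have [_ /(_ _ e1)[r r0 H]] := uA K.
near=> n => k kK.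
have dn := d_gt0 n.
have k0 : 0 <= k%:R * d n by rewrite mulr_ge0// ltW.
have := @Riemann_sum R (A (k%:R * d n)) (d n) (2 * (e / 2 / K1)) k (a n k).
move=> /(_ (modulus2_slice k0 uA) dn) => h.
apply: (le_trans (h _)); last first.
  have E : e = 2 * (e / 2 / K1) * K1 by field; rewrite gt_eqF.
  have E0 : 0 <= 2 * (e / 2 / K1) by rewrite mulr_ge0// ltW.
  rewrite [leRHS]E ler_wpM2l// (le_trans kK)// /K1.
  by rewrite (le_trans (ler_norm _))// lerDl.
move=> j u jk /andP[ju uj].
have j0 : 0 <= j%:R * d n by rewrite mulr_ge0// ltW.
have jkd : j.+1%:R * d n <= k%:R * d n by rewrite ler_wpM2r ?(ltW dn)// ler_nat.
have uk : u <= k%:R * d n by apply: le_trans uj jkd.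
rewrite -(subrKA (A (k%:R * d n) (j%:R * d n))).
rewrite (le_trans (ler_normD _ _))// mulr2n mulrDl !mul1r lerD//.
  apply/ltW/H.
  - by rewrite k0.
  - by rewrite k0.
  - by rewrite (le_trans j0)//= (le_trans uk).
  - by rewrite j0 (le_trans ju)// (le_trans uk).
  - by rewrite subrr normr0.
  - rewrite ger0_norm ?subr_ge0//.
    have : d n < r by near: n; exact: mesh_lt.
    by apply: le_lt_trans; move: uj; rewrite -natr1 mulrDl mul1r; lra.
rewrite distrC; move: kK; move: (ltnW jk); move: k j {h jkd uk k0 jk ju uj j0 u}.
by near: n; exact: aA.
Unshelve. all: by end_near. Qed.

Lemma row_cvg_array (a : nat -> nat -> R) (A : R -> R) :
  row_cvg a A -> array_cvg (fun n _ j => a n j) (fun _ => A).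
Proof.
move=> aA K e e0; have := aA K e e0; apply: filterS => n H k j jk kK.
by apply: H; apply: le_trans kK; rewrite ler_wpM2r ?(ltW (d_gt0 n))// ler_nat.
Qed.

Lemma eq_row_cvg (a a' : nat -> nat -> R) (A A' : R -> R) :
  (forall n k, a n k = a' n k) -> (forall t, 0 <= t -> A t = A' t) ->
  row_cvg a A -> row_cvg a' A'.
Proof.
move=> aa' AA' aA K e e0; have := aA K e e0; apply: filterS => n H k kK.
by rewrite -aa' -AA' ?mulr_ge0 ?(ltW (d_gt0 n))//; exact: H.
Qed.

Lemma row_cvgD (a a' : nat -> nat -> R) (A A' : R -> R) :
  row_cvg a A -> row_cvg a' A' ->
  row_cvg (fun n k => a n k + a' n k) (fun t => A t + A' t).
Proof.
move=> aA aA' K e e0; have e2 : 0 < e / 2 by rewrite divr_gt0.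
have := aA' K _ e2; have := aA K _ e2; apply: filterS2 => n H H' k kK.
rewrite opprD addrACA (le_trans (ler_normD _ _))// [leRHS]splitr lerD//.
  exact: H.
exact: H'.
Qed.

Lemma row_cvgZ (c : R) (a : nat -> nat -> R) (A : R -> R) :
  row_cvg a A -> row_cvg (fun n k => c * a n k) (fun t => c * A t).
Proof.
move=> aA K e e0; have e2 : 0 < e / (`|c| + 1) by rewrite divr_gt0// ltr_wpDl.
have := aA K _ e2; apply: filterS => n H k kK.
rewrite -mulrBr normrM (le_trans (ler_wpM2l _ (H k kK)))//.
by rewrite mulrCA ler_piMr ?(ltW e0)// ler_pdivrMr ?mul1r ?lerDl// ltr_wpDl.
Qed.

Lemma row_cvgB (a a' : nat -> nat -> R) (A A' : R -> R) :
  row_cvg a A -> row_cvg a' A' ->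
  row_cvg (fun n k => a n k - a' n k) (fun t => A t - A' t).
Proof.
move=> aA aA'; have := row_cvgD aA (row_cvgZ (-1) aA').
by apply: eq_row_cvg => *; rewrite mulN1r.
Qed.

Lemma row_cvg_time : row_cvg (fun n k => k%:R * d n) id.
Proof. by move=> K e e0; apply: nearW => n k _; rewrite subrr normr0 ltW. Qed.

(** Passing from grid points to all times costs the oscillation of A over one
mesh. *)
Lemma row_cvg_uniform (a : nat -> nat -> R) (A : R -> R) (K : R) :
  row_cvg a A -> modulus_on A ->
  {uniform `[0, K], (fun n t => a n (Num.truncn (t / d n))) @ \oo --> A}.
Proof.
move=> aA uA; apply: uniform_cvgP => e e0.
have e2 : 0 < e / 2 by rewrite divr_gt0.
have [r r0 H] := uA K _ e2.
near=> n => t /=; rewrite in_itv/= => /andP[t0 tK].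
have dn := d_gt0 n.
set k := Num.truncn _.
have td : 0 <= t / d n by rewrite divr_ge0// ltW.
have /andP[h1 h2] := truncn_itv td; rewrite -/k in h1 h2.
have {}h1 : k%:R * d n <= t by rewrite -ler_pdivlMr.
have {}h2 : t < k.+1%:R * d n by rewrite -ltr_pdivrMr.
rewrite -(subrKA (A (k%:R * d n))) (le_lt_trans (ler_normD _ _))// [ltRHS]splitr ltr_leD//.
  apply: H; first by rewrite t0.
    by rewrite mulr_ge0 ?(ltW dn)//= (le_trans h1).
  rewrite ger0_norm ?subr_ge0//.
  have : d n < r by near: n; exact: mesh_lt.
  by apply: le_lt_trans; move: h2; rewrite -natr1 mulrDl mul1r; lra.
rewrite distrC; move: (le_trans h1 tK); move: (k); near: n; exact: aA.
Unshelve. all: by end_near. Qed.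

End Arrays.

(** * Coordinates of the plane *)

Section Plane.
Variable R : realType.
Implicit Types (x y : 'rV[R]_2) (j : 'I_2).

Lemma ord2P j : j = j1 \/ j = j2.
Proof. by case: j => [[|[|//]] jP]; [left|right]; apply: val_inj. Qed.

Lemma rV2P x y : x 0 j1 = y 0 j1 -> x 0 j2 = y 0 j2 -> x = y.
Proof. by move=> h1 h2; apply/rowP => j; have [->|->] := ord2P j. Qed.

Lemma coord_le_norm x j : `|x 0 j| <= `|x|.
Proof.
rewrite [leRHS](_ : _ = mx_norm x)// mx_normrE.
exact: (@le_bigmax _ _ _ 0 (fun ij : 'I_1 * 'I_2 => `|x ij.1 ij.2|) (0, j)).
Qed.

Lemma norm_le_coord x (C : R) : (forall j, `|x 0 j| <= C) -> `|x| <= C.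
Proof.
move=> H; rewrite (_ : `|x| = mx_norm x)// mx_normrE.
apply: bigmax_le => [|[i j] _ /=]; first exact: le_trans (H j1).
by rewrite (ord1 i).
Qed.

Lemma norm_unit_vec j (c : R) : `|c *: unit_vec R j| <= `|c|.
Proof.
apply: norm_le_coord => k; rewrite !mxE normrM ler_piMr//.
by case: (_ && _); rewrite ?normr1 ?normr0.
Qed.

Lemma unit_vec11 : unit_vec R j1 0 j1 = 1. Proof. by rewrite mxE. Qed.
Lemma unit_vec12 : unit_vec R j1 0 j2 = 0. Proof. by rewrite mxE. Qed.
Lemma unit_vec21 : unit_vec R j2 0 j1 = 0. Proof. by rewrite mxE. Qed.
Lemma unit_vec22 : unit_vec R j2 0 j2 = 1. Proof. by rewrite mxE. Qed.
Definition unit_vecE := (unit_vec11, unit_vec12, unit_vec21, unit_vec22).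

Lemma vec1 (a c : R) : vec a c 0 j1 = a. Proof. by rewrite mxE. Qed.
Lemma vec2 (a c : R) : vec a c 0 j2 = c. Proof. by rewrite mxE. Qed.


Lemma coordD x y j : (x + y) 0 j = x 0 j + y 0 j. Proof. by rewrite mxE. Qed.
Lemma coordB x y j : (x - y) 0 j = x 0 j - y 0 j. Proof. by rewrite !mxE. Qed.
Lemma coordZ (c : R) x j : (c *: x) 0 j = c * x 0 j. Proof. by rewrite mxE. Qed.
Definition planeE := (coordB, coordD, coordZ, unit_vecE, vec1, vec2).

(** The step is made first along the first coordinate, then along the second, so
that only the pure second derivatives appear; the derivative of the second
move is taken at the corner.  The second estimate brings it back to x, at the
cost of a mixed second derivative. *)
Lemma ito_step (phi : 'rV[R]_2 -> R) (M e : R) : Ck 2 phi -> 0 < e ->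
  exists2 r : R, 0 < r & forall x (a c : R), `|x| <= M -> `|a| < r -> `|c| < r ->
   [/\ `|phi (x + a *: unit_vec R j1 + c *: unit_vec R j2) - phi x -
        (a * partial j1 phi x + c * partial j2 phi (x + a *: unit_vec R j1)
         + 2^-1 * a ^+ 2 * partial j1 (partial j1 phi) x
         + 2^-1 * c ^+ 2 * partial j2 (partial j2 phi) x)| <= e * (a ^+ 2 + c ^+ 2) &
      `|partial j2 phi (x + a *: unit_vec R j1) - partial j2 phi x
         - a * partial j1 (partial j2 phi) x| <= e * `|a| ].
Proof.
move=> [cphi Hphi] e0.
have [dphi1 [c1 H1]] := Hphi j1; have [dphi2 [c2 H2]] := Hphi j2.
have [dd11 c11] := H1 j1; have [dd22 c22] := H2 j2; have [dd12 c12] := H2 j1.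
have e2 : 0 < e / 2 by rewrite divr_gt0.
have [r1 r10 U1] := unif_on_ball (M + 1) c11 e2.
have [r2 r20 U2] := unif_on_ball (M + 1) c22 e2.
have [r3 r30 U3] := unif_on_ball (M + 1) c12 e2.
exists (Num.min (Num.min r1 1) (Num.min r2 r3)); first by rewrite !lt_min r10 r20 r30 ltr01.
move=> x a c xM; rewrite !lt_min => /andP[/andP[a1 a01] /andP[a2 a3]] /andP[/andP[d1 _] /andP[d2 d3]].
have xM1 : `|x| <= M + 1 by rewrite (le_trans xM)// lerDl.
have near_x (t : R) j (s : R) : `|t| < s -> `|x - (x + t *: unit_vec R j)| < s.
  by move=> ts; rewrite opprD addrA subrr sub0r normrN (le_lt_trans (norm_unit_vec _ _)).
split.
  have T1 := @taylor2 _ _ (unit_vec R j1) phi x a (e / 2) dphi1 dd11.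
  set x' := x + a *: unit_vec R j1.
  have T2 := @taylor2 _ _ (unit_vec R j2) phi x' c (e / 2) dphi2 dd22.
  have {}T1 : `|phi x' - phi x - a * partial j1 phi x - 2^-1 * a ^+ 2 * partial j1 (partial j1 phi) x|
     <= a ^+ 2 * (e / 2).
    apply: T1 => t ta; rewrite distrC; apply/ltW/U1 => //.
    by apply: near_x; exact: le_lt_trans a1.
  have {}T2 : `|phi (x' + c *: unit_vec R j2) - phi x' - c * partial j2 phi x' - 2^-1 * c ^+ 2 * partial j2 (partial j2 phi) x'|
     <= c ^+ 2 * (e / 2).
    apply: T2 => t tc; rewrite distrC; apply/ltW/U2 => //.
      rewrite (le_trans (ler_normD _ _))// lerD//.
      by rewrite (le_trans (norm_unit_vec _ _))// ltW.
    rewrite opprD addrA subrr sub0r normrN (le_lt_trans (norm_unit_vec _ _))//.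
    exact: le_lt_trans d2.
  have T3 : `|2^-1 * c ^+ 2 * (partial j2 (partial j2 phi) x' - partial j2 (partial j2 phi) x)| <= c ^+ 2 * (e / 2).
    have hc : 0 <= 2^-1 * c ^+ 2 by rewrite mulr_ge0 ?sqr_ge0.
    rewrite normrM (ger0_norm hc); apply: ler_pM => //.
    - by rewrite ler_piMl ?sqr_ge0// invf_le1// ler1n.
    - by rewrite distrC; apply/ltW/U2 => //; apply: near_x.
  rewrite -[X in X <= _](_ : `|(phi x' - phi x - a * partial j1 phi x - 2^-1 * a ^+ 2 * partial j1 (partial j1 phi) x)
    + (phi (x' + c *: unit_vec R j2) - phi x' - c * partial j2 phi x' - 2^-1 * c ^+ 2 * partial j2 (partial j2 phi) x')
    + 2^-1 * c ^+ 2 * (partial j2 (partial j2 phi) x' - partial j2 (partial j2 phi) x)| = _); last first.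
    congr `|_|; move: (phi _) (phi _) (phi x) (partial _ _ _) (partial _ _ _) (partial _ _ _) (partial _ _ _) (partial _ _ _).
    by move=> *; ring.
  rewrite (le_trans (ler_normD _ _))// (le_trans (lerD (ler_normD _ _) (lexx _)))//.
  rewrite (le_trans (lerD (lerD T1 T2) T3))//.
  have : 0 <= a ^+ 2 * e by rewrite mulr_ge0 ?sqr_ge0// ltW.
  by move: (a ^+ 2) (c ^+ 2) => s t; clear; lra.
have T := @taylor1 _ _ (unit_vec R j1) (partial j2 phi) x a (e / 2) dd12.
apply: (@le_trans _ _ (`|a| * (e / 2))).
  apply: T => t ta; rewrite distrC; apply/ltW/U3 => //.
  by apply: near_x; exact: le_lt_trans a3.
have : 0 <= e * `|a| by rewrite mulr_ge0// ltW.
by move: (`|a|) => s; clear; lra.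
Qed.

Lemma trapezoid_step (psi : 'rV[R]_2 -> R) j x (a e : R) :
  (forall x, derivable psi x (unit_vec R j)) ->
  (forall c, `|c| <= `|a| -> `|partial j psi (x + c *: unit_vec R j) - partial j psi x| <= e) ->
  `|psi (x + a *: unit_vec R j) - psi x - a / 2 * (partial j psi x + partial j psi (x + a *: unit_vec R j))|
     <= 2 * `|a| * e.
Proof. by move=> dpsi H; exact: trapezoid. Qed.

End Plane.

(** * The discrete Ito formula *)

(** The error of the discrete Ito formula, written as a double sum of the local
Taylor errors. *)
Lemma sum_regroup (R : realType) (k : nat) (c : R) (E m1 m2 p q : nat -> nat -> R)
    (u v : nat -> R) :
  \sum_(r < k) \sum_(j < r.+1) E r j * c
  - (\sum_(r < k) \sum_(j < r.+1) (m1 r j + m2 r j) * c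
     + 2^-1 * (\sum_(r < k) (\sum_(j < r.+1) p r j * c) * u r
             + \sum_(r < k) (\sum_(j < r.+1) q r j * c) * v r)) =
  \sum_(r < k) \sum_(j < r.+1)
    (E r j - (m1 r j + m2 r j + 2^-1 * u r * p r j + 2^-1 * v r * q r j)) * c.
Proof.
rewrite -big_split mulr_sumr -big_split -sumrB.
apply: eq_bigr => r _; rewrite /= !mulr_suml -big_split mulr_sumr -big_split -sumrB.
by apply: eq_bigr => j _ /=; ring.
Qed.

Section Walk.
Variable R : realType.
Notation mu := (@lebesgue_measure R).
Variables (d : nat -> R) (S : nat -> nat -> 'rV[R]_2) (b : R -> 'rV[R]_2).
Variables (phi : 'rV[R]_2 -> R) (y : 'rV[R]_2).
Hypothesis d_gt0 : forall n, 0 < d n.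
Hypothesis d_cvg0 : d @ \oo --> 0.
Hypothesis b_modulus : modulus_on b.
Hypothesis S_cvg : forall K e : R, 0 < e -> \forall n \near \oo,
  forall k, k%:R * d n <= K -> `|S n k - b (k%:R * d n)| <= e.

Lemma kd_ge0 n k : 0 <= k%:R * d n.
Proof. by rewrite mulr_ge0// ltW. Qed.

Lemma kd_le n (k j : nat) (K : R) : (j <= k)%N -> k%:R * d n <= K -> j%:R * d n <= K.
Proof.
by move=> jk; apply: le_trans; rewrite ler_wpM2r ?(ltW (d_gt0 n))// ler_nat.
Qed.

Lemma walk_bound (K : R) : exists2 C : R, 0 < C & \forall n \near \oo,
  forall k, k%:R * d n <= K -> `|S n k| <= C.
Proof.
have [C C0 bC] := modulus_bound K b_modulus.
exists (C + 1); first by rewrite addr_gt0.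
have := S_cvg K (@ltr01 R); apply: filterS => n H k kK.
rewrite -(subrK (b (k%:R * d n)) (S n k)) (le_trans (ler_normD _ _))//.
by rewrite addrC lerD ?H// bC// kd_ge0.
Qed.

Lemma field_modulus2 (g : 'rV[R]_2 -> R) : continuous g ->
  modulus2_on (fun t u => g (b t - b u - y)).
Proof.
move=> cg K; have [C C0 bC] := modulus_bound K b_modulus.
have hM s t : 0 <= s <= K -> 0 <= t <= K -> `|b s - b t - y| <= C + C + `|y|.
  move=> sK tK; rewrite (le_trans (ler_normB _ _))// lerD2r.
  by rewrite (le_trans (ler_normB _ _))// lerD// bC.
split.
  have [G G0 gG] := bound_on_ball (C + C + `|y|) cg.
  by exists G => // s t sK tK; rewrite gG// hM.
move=> e e0; have [r r0 gr] := unif_on_ball (C + C + `|y|) cg e0.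
have r2 : 0 < r / 2 by rewrite divr_gt0.
have [q q0 bq] := b_modulus K r2.
exists q => // s s' t t' sK s'K tK t'K ss' tt'; apply: gr; first exact: hM.
have -> : b s - b t - y - (b s' - b t' - y) = (b s - b s') - (b t - b t').
  by apply/rowP => i; rewrite !mxE; ring.
by rewrite (le_lt_trans (ler_normB _ _))// (splitr r) ltrD// bq.
Qed.

Lemma field_modulus (g : 'rV[R]_2 -> R) : continuous g ->
  modulus_on (fun u => g (- b u - y)).
Proof.
move=> cg K e e0; have [C C0 bC] := modulus_bound K b_modulus.
have [r r0 gr] := unif_on_ball (C + `|y|) cg e0.
have [q q0 bq] := b_modulus K r0.
exists q => // s t sK tK st; apply: gr.
  by rewrite (le_trans (ler_normB _ _))// normrN lerD2r bC.
have -> : - b s - y - (- b t - y) = - (b s - b t).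
  by apply/rowP => i; rewrite !mxE; ring.
by rewrite normrN bq.
Qed.

(** On bounded times the walk and the path stay in a ball, where g is uniformly
continuous. *)
Lemma field_array (g : 'rV[R]_2 -> R) : continuous g ->
  array_cvg d (fun n k j => g (S n k - S n j - y)) (fun t u => g (b t - b u - y)).
Proof.
move=> cg K e e0; have [C C0 bC] := modulus_bound K b_modulus.
have [r r0 gr] := unif_on_ball (C + C + `|y|) cg e0.
have r2 : 0 < r / 2 / 2 by rewrite !divr_gt0.
have := S_cvg K r2; apply: filterS => n H k j jk kK.
have jK := kd_le jk kK.
rewrite distrC; apply/ltW/gr.
  rewrite (le_trans (ler_normB _ _))// lerD2r.
  by rewrite (le_trans (ler_normB _ _))// lerD// bC ?kd_ge0.
have -> : b (k%:R * d n) - b (j%:R * d n) - y - (S n k - S n j - y) =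
  (S n j - b (j%:R * d n)) - (S n k - b (k%:R * d n)).
  by apply/rowP => i; rewrite !mxE; ring.
rewrite (le_lt_trans (ler_normB _ _))// (le_lt_trans (lerD (H _ jK) (H _ kK)))//.
by rewrite -splitr ltr_pdivrMr// ltr_pMr// ltr1n.
Qed.

Lemma field_row (g : 'rV[R]_2 -> R) : continuous g ->
  row_cvg d (fun n j => g (- S n j - y)) (fun u => g (- b u - y)).
Proof.
move=> cg K e e0; have [C C0 bC] := modulus_bound K b_modulus.
have [r r0 gr] := unif_on_ball (C + `|y|) cg e0.
have r2 : 0 < r / 2 by rewrite divr_gt0.
have := S_cvg K r2; apply: filterS => n H k kK.
rewrite distrC; apply/ltW/gr.
  by rewrite (le_trans (ler_normB _ _))// normrN lerD2r bC// kd_ge0.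
have -> : - b (k%:R * d n) - y - (- S n k - y) = S n k - b (k%:R * d n).
  by apply/rowP => i; rewrite !mxE; ring.
by rewrite (le_lt_trans (H _ kK))// ltr_pdivrMr// ltr_pMr// ltr1n.
Qed.

Lemma row_cvg_mesh (f : nat -> nat -> R) (F : R -> R) : modulus_on F ->
  row_cvg d f F -> row_cvg d (fun n k => f n k * d n) (fun=> 0).
Proof.
move=> uF fF K e e0; have [C C0 FC] := modulus_bound K uF.
have C1 : 0 < C + 1 by rewrite addr_gt0.
have := fF K _ ltr01; have := mesh_lt d_cvg0 (divr_gt0 e0 C1).
apply: filterS2 => n dn H k kK.
rewrite subr0 normrM (ger0_norm (ltW (d_gt0 n))).
have fC : `|f n k| <= C + 1.
  rewrite -(subrK (F (k%:R * d n)) (f n k)) (le_trans (ler_normD _ _))//.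
  by rewrite addrC lerD ?H// FC// kd_ge0.
rewrite (le_trans (ler_wpM2r (ltW (d_gt0 n)) fC))//.
by rewrite mulrC -ler_pdivlMr// ltW.
Qed.

Lemma array_cvg_diag (a : nat -> nat -> nat -> R) (A : R -> R -> R) :
  array_cvg d a A -> row_cvg d (fun n k => a n k k) (fun t => A t t).
Proof. by move=> aA K e e0; have := aA K e e0; apply: filterS => n H k; exact: H. Qed.

Lemma modulus2_diag (A : R -> R -> R) : modulus2_on A -> modulus_on (fun t => A t t).
Proof.
move=> uA K e e0; have [_ /(_ e e0)[r r0 H]] := uA K.
by exists r => // *; exact: H.
Qed.

(** The diagonal term of the sum costs only one mesh. *)
Lemma row_cvg_sumS (a : nat -> nat -> nat -> R) (A : R -> R -> R) :
  modulus2_on A -> array_cvg d a A ->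
  row_cvg d (fun n k => \sum_(j < k.+1) a n k j * d n)
    (fun t => \int[mu]_(u in `[0, t]) A t u).
Proof.
move=> uA aA.
have := row_cvgD (row_cvg_sum d_gt0 d_cvg0 uA aA)
  (row_cvg_mesh (modulus2_diag uA) (array_cvg_diag aA)).
by apply: eq_row_cvg => // [n k|t _]; rewrite ?big_ord_recr ?addr0.
Qed.

Hypothesis phiC2 : Ck 2 phi.

Local Notation D j := (partial j phi).
Local Notation dS n r j := (S n r.+1 0 j - S n r 0 j).
Local Notation mid n r := (vec (S n r.+1 0 j1) (S n r 0 j2)).

Definition tanaka_sum n k := \sum_(j < k.+1) (phi (S n k - S n j - y) - phi (- y)) * d n.

Definition mart_sum n k := \sum_(r < k) \sum_(j < r.+1)
  (D j1 (S n r - S n j - y) * dS n r j1 + D j2 (mid n r - S n j - y) * dS n r j2) * d n.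

Definition hess_sum i j n r := \sum_(l < r.+1) partial i (D j) (S n r - S n l - y) * d n.

(** Telescoping in the final time k; the term j = k of the left-hand side
vanishes because phi (S n k - S n k - y) = phi (- y). *)
Lemma tanaka_sumE n k : tanaka_sum n k = \sum_(r < k) \sum_(j < r.+1)
  (phi (S n r.+1 - S n j - y) - phi (S n r - S n j - y)) * d n.
Proof.
elim: k => [|k IH].
  by rewrite /tanaka_sum big_ord0 big_ord_recl big_ord0 subrr sub0r subrr mul0r addr0.
rewrite big_ord_recr/= -IH /tanaka_sum big_ord_recr/= subrr sub0r subrr mul0r addr0.
rewrite -big_split/=; apply: eq_bigr => j _; rewrite -mulrDl; congr (_ * _).
by rewrite [RHS]addrC subrKA.
Qed.

Lemma small_steps (K e : R) : 0 < e -> \forall n \near \oo,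
  forall r, r.+1%:R * d n <= K -> `|S n r.+1 - S n r| < e.
Proof.
move=> e0; have e3 : 0 < e / 3 by rewrite divr_gt0.
have [q q0 bq] := b_modulus K e3.
have := S_cvg K e3; have := mesh_lt d_cvg0 q0; apply: filterS2 => n dq H r rK.
have rK' := kd_le (leqnSn r) rK.
have -> : S n r.+1 - S n r = (S n r.+1 - b (r.+1%:R * d n))
   + (b (r.+1%:R * d n) - b (r%:R * d n)) - (S n r - b (r%:R * d n)).
  by apply/rowP => i; rewrite !mxE; ring.
have h1 := H _ rK; have h2 := H _ rK'.
have h3 : `|b (r.+1%:R * d n) - b (r%:R * d n)| < e / 3.
  apply: bq; rewrite ?kd_ge0//.
  by rewrite -mulrBl -natrB// subSnn mul1r ger0_norm// ltW.
rewrite (le_lt_trans (ler_normB _ _))// (le_lt_trans (lerD (ler_normD _ _) (lexx _)))//.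
move: h1 h2 h3; move: (`|_|) (`|_|) (`|_|) => u v w *; lra.
Qed.

Lemma step_decomposition n r j : mid n r - S n j - y = S n r - S n j - y + dS n r j1 *: unit_vec R j1.
Proof. by apply: rV2P; rewrite !planeE; ring. Qed.

Lemma step_decomposition2 n r j : S n r.+1 - S n j - y =
  S n r - S n j - y + dS n r j1 *: unit_vec R j1 + dS n r j2 *: unit_vec R j2.
Proof. by apply: rV2P; rewrite !planeE; ring. Qed.

(** The local Taylor errors are at most a small multiple of the squared increments;
the r-th step has r + 1 of them, each of weight d n, and r d n stays bounded. *)
Lemma discrete_ito (K e : R) : 0 < e -> \forall n \near \oo,
  forall k, k%:R * d n <= K ->
  `|tanaka_sum n k - (mart_sum n k
      + 2^-1 * (\sum_(r < k) hess_sum j1 j1 n r * dS n r j1 ^+ 2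
              + \sum_(r < k) hess_sum j2 j2 n r * dS n r j2 ^+ 2))|
   <= e * \sum_(r < k) (dS n r j1 ^+ 2 + dS n r j2 ^+ 2).
Proof.
move=> e0.
have [C C0 SC] := walk_bound K.
have K1 : 0 < `|K| + 1 by rewrite ltr_wpDl.
have [q q0 Hq] := ito_step (C + C + `|y|) phiC2 (divr_gt0 e0 K1).
move: SC (small_steps K q0); apply: filterS2 => n SC Hs k kK.
have -> : tanaka_sum n k - (mart_sum n k
      + 2^-1 * (\sum_(r < k) hess_sum j1 j1 n r * dS n r j1 ^+ 2
              + \sum_(r < k) hess_sum j2 j2 n r * dS n r j2 ^+ 2)) =
  \sum_(r < k) \sum_(j < r.+1)
   (phi (S n r.+1 - S n j - y) - phi (S n r - S n j - y)
    - (D j1 (S n r - S n j - y) * dS n r j1 + D j2 (mid n r - S n j - y) * dS n r j2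
       + 2^-1 * dS n r j1 ^+ 2 * partial j1 (D j1) (S n r - S n j - y)
       + 2^-1 * dS n r j2 ^+ 2 * partial j2 (D j2) (S n r - S n j - y))) * d n.
  rewrite tanaka_sumE; exact: (@sum_regroup R k (d n)
    (fun r j => phi (S n r.+1 - S n j - y) - phi (S n r - S n j - y))
    (fun r j => D j1 (S n r - S n j - y) * dS n r j1)
    (fun r j => D j2 (mid n r - S n j - y) * dS n r j2)
    (fun r j => partial j1 (D j1) (S n r - S n j - y))
    (fun r j => partial j2 (D j2) (S n r - S n j - y))
    (fun r => dS n r j1 ^+ 2) (fun r => dS n r j2 ^+ 2)).
rewrite mulr_sumr (le_trans (ler_norm_sum _ _ _))// ler_sum// => r _.
rewrite (le_trans (ler_norm_sum _ _ _))//.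
have rK : r.+1%:R * d n <= K by apply: kd_le kK; exact: ltn_ord.
have hd j : `|dS n r j| < q.
  have -> : dS n r j = (S n r.+1 - S n r) 0 j by rewrite !mxE.
  by rewrite (le_lt_trans (coord_le_norm _ _))// Hs.
set A := _ ^+ 2 + _ ^+ 2.
apply: (@le_trans _ _ (\sum_(j < r.+1) (e / (`|K| + 1) * A * d n))).
  apply: ler_sum => j _; rewrite normrM (ger0_norm (ltW (d_gt0 n))) ler_wpM2r ?(ltW (d_gt0 n))//.
  rewrite step_decomposition2 step_decomposition.
  have xM : `|S n r - S n j - y| <= C + C + `|y|.
    rewrite (le_trans (ler_normB _ _))// lerD2r (le_trans (ler_normB _ _))//.
    rewrite lerD// SC//; apply: kd_le kK; first by rewrite ltnW.
    exact: leq_trans (ltnW (ltn_ord j)) (ltn_ord r).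
  by have [] := Hq _ _ _ xM (hd j1) (hd j2); rewrite (mulrC (dS n r j1)) (mulrC (dS n r j2)).
have A0 : 0 <= A by rewrite addr_ge0 ?sqr_ge0.
rewrite sumr_const card_ord -mulr_natr -mulrA (mulrC (d n)) mulrAC.
rewrite -(mulrA e) (mulrC _^-1) mulrAC ler_piMr ?mulr_ge0// ?(ltW e0)//.
rewrite ler_pdivrMr// mul1r (le_trans rK)// (le_trans (ler_norm _))// lerDl//.
Qed.

End Walk.

(** * Gradient integrals along corner paths *)

Section CornerPath.
Variable R : realType.
Variables (phi : 'rV[R]_2 -> R) (h e M : R).
Hypothesis h_gt0 : 0 < h.
Hypothesis dphi : forall j x, derivable phi x (unit_vec R j).
Hypothesis phi_osc : forall j p c, `|p| <= M -> `|c| <= h ->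
  `|partial j phi (p + c *: unit_vec R j) - partial j phi p| <= e.

(** On each edge the discrete integral is the trapezoid rule for phi, so the sum
telescopes. *)
Lemma edge_chain_integral (x w : 'rV[R]_2) (j : 'I_2) (s : bool) (N : nat) :
  (forall i : nat, (i < N)%N ->
     `|x + ((-1) ^+ s * i%:R * h) *: unit_vec R j - w| <= M) ->
  `|discrete_integral h
      [seq Edge (x + ((-1) ^+ s * i%:R * h) *: unit_vec R j) j s | i <- iota 0 N]
      (fun x => nabla phi (x - w))
    - (phi (x + ((-1) ^+ s * N%:R * h) *: unit_vec R j - w) - phi (x - w))|
    <= 2 * (N%:R * h) * e.
Proof.
elim: N => [|N IH] HM.
  by rewrite /discrete_integral big_nil mulr0 !mulr0 !mul0r scale0r addr0 !subrr normr0 mulr0 mul0r.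
have {IH} := IH (fun i iN => HM i (ltnW iN)).
have := HM N (ltnSn N); set p := x + (_ * N%:R * h) *: _ => pM.
rewrite -[N.+1]addn1 iotaD map_cat /discrete_integral big_cat/= big_seq1 mulrDr add0n.
rewrite -/p /edge_tgt /edge_sign/=.
set I := h / 2 * _ => hI.
have a_h : `|(-1) ^+ s * h| = h.
  by rewrite normrM normrX normrN normr1 expr1n mul1r gtr0_norm.
have := @trapezoid_step R phi j (p - w) ((-1) ^+ s * h) e (@dphi j).
rewrite a_h => /(_ (fun c ch => phi_osc j pM ch)).
have -> : p - w + ((-1) ^+ s * h) *: unit_vec R j = p + ((-1) ^+ s * h) *: unit_vec R j - w.
  by rewrite addrAC.
have -> : x + ((-1) ^+ s * (N + 1)%:R * h) *: unit_vec R j - w = p + ((-1) ^+ s * h) *: unit_vec R j - w.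
  by rewrite natrD mulrDr mulrDl scalerDl addrA mulr1.
rewrite !mxE natrD.
move: (phi _) (phi _) (phi _) (partial _ _ _) (partial _ _ _) hI => f1 f2 f3 D1 D2.
rewrite !ler_norml; move: ((-1) ^+ s) => sg.
move=> /andP[? ?] /andP[? ?]; apply/andP; split; lra.
Qed.

Lemma segment_integral (x w : 'rV[R]_2) (j : 'I_2) (k : int) :
  (forall t : R, `|t| <= `|k%:~R * h| -> `|x + t *: unit_vec R j - w| <= M) ->
  `|discrete_integral h (segment h x j (k%:~R * h)) (fun x => nabla phi (x - w))
    - (phi (x + (k%:~R * h) *: unit_vec R j - w) - phi (x - w))|
    <= 2 * `|k%:~R * h| * e.
Proof.
move=> HM.
have Ek : `|k%:~R| = `|k|%N%:R :> R by rewrite -intr_norm -abszE.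
have Es : (-1) ^+ (k%:~R * h < 0)%R * `|k|%N%:R = k%:~R :> R.
  by rewrite pmulr_llt0// -Ek -numEsign.
rewrite -[in X in phi X](_ : (-1) ^+ (k%:~R * h < 0)%R * `|k|%N%:R * h = k%:~R * h); last by rewrite Es.
rewrite /segment normrM (gtr0_norm h_gt0) mulfK ?gt_eqF// Ek natrK.
apply: edge_chain_integral => i iN; apply: HM.
rewrite !normrM normrX normrN normr1 expr1n mul1r ler_wpM2r// Ek.
by rewrite (ger0_norm (ler0n _ _)) ler_nat ltnW.
Qed.

Lemma corner_integral (z w : 'rV[R]_2) (k1 k2 : int) :
  z 0 j1 = k1%:~R * h -> z 0 j2 = k2%:~R * h -> `|z| + `|w| <= M ->
  `|discrete_integral h (corner_path h z) (fun x => nabla phi (x - w))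
    - (phi (z - w) - phi (- w))| <= 4 * `|z| * e.
Proof.
move=> z1 z2 zM.
have zw x : `|x| <= `|z| -> `|x - w| <= M.
  by move=> xz; rewrite (le_trans (ler_normB _ _))// (le_trans _ zM)// lerD2r.
have e0 : 0 <= e.
  have M0 : 0 <= M by rewrite (le_trans _ zM)// addr_ge0.
  by apply: le_trans (phi_osc j1 (p := 0) (c := 0) _ _); rewrite ?normr0// ltW.
rewrite /corner_path /discrete_integral big_cat mulrDr z1 z2.
have := @segment_integral 0 w j1 k1.
have := @segment_integral (vec (z 0 j1) 0) w j2 k2.
rewrite /discrete_integral -z1 -z2.
have -> : vec (z 0 j1) 0 + z 0 j2 *: unit_vec R j2 = z.
  by apply: rV2P; rewrite !planeE ?mulr0 ?mulr1 ?addr0 ?add0r.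
have -> : 0 + z 0 j1 *: unit_vec R j1 = vec (z 0 j1) 0.
  by apply: rV2P; rewrite !planeE ?mxE ?mulr0 ?mulr1 ?addr0 ?add0r.
rewrite sub0r.
move=> h2 h1.
have zj j : `|z 0 j| <= `|z| by exact: coord_le_norm.
have {}h1 : `|h / 2 * \sum_(e <- segment h 0 j1 (z 0 j1))
     edge_sign e * (nabla phi (edge_src e - w) 0 (edge_dir e) +
                    nabla phi (edge_tgt h e - w) 0 (edge_dir e))
   - (phi (vec (z 0 j1) 0 - w) - phi (- w))| <= 2 * `|z 0 j1| * e.
  apply: h1 => t tz; apply: zw; rewrite add0r (le_trans (norm_unit_vec _ _))// (le_trans tz)//.
have {}h2 : `|h / 2 * \sum_(e <- segment h (vec (z 0 j1) 0) j2 (z 0 j2))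
     edge_sign e * (nabla phi (edge_src e - w) 0 (edge_dir e) +
                    nabla phi (edge_tgt h e - w) 0 (edge_dir e))
   - (phi (z - w) - phi (vec (z 0 j1) 0 - w))| <= 2 * `|z 0 j2| * e.
  apply: h2 => t tz; apply: zw; apply: norm_le_coord => j; have [->|->] := ord2P j; rewrite !planeE.
    by rewrite mulr0 addr0.
  by rewrite mulr1 add0r (le_trans tz).
have := ler_wpM2r e0 (zj j1); have := ler_wpM2r e0 (zj j2).
move: h1 h2; rewrite !ler_norml => /andP[? ?] /andP[? ?] ? ?; apply/andP; split; lra.
Qed.

End CornerPath.

(** * Limits of the terms of the discrete formula *)

Section IntegralAlgebra.
Variable R : realType.
Notation mu := (@lebesgue_measure R).

Lemma modulusB (f g : R -> R) :
  modulus_on f -> modulus_on g -> modulus_on (fun t => f t - g t).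
Proof.
move=> uf ug K e e0; have e2 : 0 < e / 2 by rewrite divr_gt0.
have [p p0 fp] := uf K _ e2; have [q q0 gq] := ug K _ e2.
exists (Num.min p q); first by rewrite lt_min p0.
move=> s t sK tK; rewrite lt_min => /andP[sp sq].
have -> : f s - g s - (f t - g t) = (f s - f t) - (g s - g t) by ring.
by rewrite (le_lt_trans (ler_normB _ _))// (splitr e) ltrD ?fp ?gq.
Qed.

Lemma modulus2B (f g : R -> R -> R) :
  modulus2_on f -> modulus2_on g -> modulus2_on (fun t u => f t u - g t u).
Proof.
move=> uf ug K; have [[C C0 fC] {}uf] := uf K; have [[C' C0' gC] {}ug] := ug K.
split.
  exists (C + C'); first exact: addr_gt0.
  by move=> s t sK tK; rewrite (le_trans (ler_normB _ _))// lerD ?fC ?gC.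
move=> e e0; have e2 : 0 < e / 2 by rewrite divr_gt0.
have [p p0 fp] := uf _ e2; have [q q0 gq] := ug _ e2.
exists (Num.min p q); first by rewrite lt_min p0.
move=> s s' t t' sK s'K tK t'K; rewrite !lt_min => /andP[sp sq] /andP[tp tq].
have -> : f s t - g s t - (f s' t' - g s' t') = (f s t - f s' t') - (g s t - g s' t') by ring.
by rewrite (le_lt_trans (ler_normB _ _))// (splitr e) ltrD ?fp ?gq.
Qed.

Lemma modulus_cst (c : R) : modulus_on (fun _ : R => c).
Proof. by move=> K e e0; exists 1 => // *; rewrite subrr normr0. Qed.

Lemma modulusZ (c : R) (f : R -> R) : modulus_on f -> modulus_on (fun t => c * f t).
Proof.
move=> uf K e e0; have e2 : 0 < e / (`|c| + 1) by rewrite divr_gt0// ltr_wpDl.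
have [p p0 fp] := uf K _ e2; exists p => // s t sK tK st.
rewrite -mulrBr normrM.
apply: (@le_lt_trans _ _ ((`|c| + 1) * `|f s - f t|)); first by rewrite ler_wpM2r// lerDl.
by rewrite -ltr_pdivlMl ?(mulrC _^-1) ?fp// ltr_wpDl.
Qed.

Lemma modulus_id : modulus_on (@id R).
Proof. by move=> K e e0; exists e. Qed.

Lemma Rintegral0B (f g : R -> R) (t : R) : modulus_on f -> modulus_on g ->
  \int[mu]_(u in `[0, t]) (f u - g u) =
  \int[mu]_(u in `[0, t]) f u - \int[mu]_(u in `[0, t]) g u.
Proof. by move=> uf ug; rewrite RintegralB//; exact: modulus_integrable. Qed.

Lemma Rintegral0_cst (c t : R) : 0 <= t -> \int[mu]_(u in `[0, t]) c = t * c.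
Proof.
move=> t0; have := @Rintegral_near_cst R (fun=> c) 0 t c 0 (modulus_cst c).
rewrite lexx t0 subr0 mul0r => /(_ isT) H; apply/eqP; rewrite mulrC -subr_eq0 -normr_le0; apply: H => u _.
by rewrite subrr normr0.
Qed.

Lemma Rintegral0B2 (f g : R -> R -> R) (t : R) : 0 <= t -> modulus2_on f -> modulus2_on g ->
  \int[mu]_(u in `[0, t]) (f t u - g t u) =
  \int[mu]_(u in `[0, t]) f t u - \int[mu]_(u in `[0, t]) g t u.
Proof. by move=> t0 uf ug; rewrite -Rintegral0B//; exact: modulus2_slice. Qed.

End IntegralAlgebra.

Section RowCvg2.
Variables (R : realType) (d : nat -> R).
Hypothesis d_gt0 : forall n, 0 < d n.

Lemma array_cvgB (a a' : nat -> nat -> nat -> R) (A A' : R -> R -> R) :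
  array_cvg d a A -> array_cvg d a' A' ->
  array_cvg d (fun n k j => a n k j - a' n k j) (fun t u => A t u - A' t u).
Proof.
move=> aA aA' K e e0; have e2 : 0 < e / 2 by rewrite divr_gt0.
have := aA' K _ e2; have := aA K _ e2; apply: filterS2 => n H H' k j jk kK.
have := H k j jk kK; have := H' k j jk kK.
rewrite !ler_norml => /andP[? ?] /andP[? ?]; apply/andP; split; lra.
Qed.

Lemma row_cvg_cst (c : R) : row_cvg d (fun _ _ => c) (fun=> c).
Proof. by move=> K e e0; apply: nearW => n k _; rewrite subrr normr0 ltW. Qed.

Lemma array_cvg_squeeze (a a' : nat -> nat -> nat -> R) (A : R -> R -> R) :
  array_cvg d a A ->
  (forall K e : R, 0 < e -> \forall n \near \oo, forall k j, (j <= k)%N -> k%:R * d n <= K ->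
     `|a' n k j - a n k j| <= e) ->
  array_cvg d a' A.
Proof.
move=> aA H K e e0; have e2 : 0 < e / 2 by rewrite divr_gt0.
have := H K _ e2; have := aA K _ e2; apply: filterS2 => n h1 h2 k j jk kK.
have := h1 k j jk kK; have := h2 k j jk kK.
rewrite !ler_norml => /andP[? ?] /andP[? ?]; apply/andP; split; lra.
Qed.

End RowCvg2.

Section ImbeddedTerms.
Variable R : realType.
Notation mu := (@lebesgue_measure R).
Variables (S : nat -> nat -> 'rV[R]_2) (b : R -> 'rV[R]_2).
Variables (phi : 'rV[R]_2 -> R) (y : 'rV[R]_2).
Local Notation h n := (2 ^- n : R).
Local Notation d := (fun n : nat => (2 ^- n : R) ^+ 2).
Hypothesis b_modulus : modulus_on b.
Hypothesis S_cvg : forall K e : R, 0 < e -> \forall n \near \oo,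
  forall k, k%:R * d n <= K -> `|S n k - b (k%:R * d n)| <= e.
Hypothesis S0 : forall n, S n 0 = 0.
Hypothesis S_step : forall K : R, \forall n \near \oo,
  forall k j, k.+1%:R * d n <= K -> `|S n k.+1 0 j - S n k 0 j| = h n.
Hypothesis phiC2 : Ck 2 phi.

Let h_gt0 n : 0 < h n. Proof. by rewrite invr_gt0 exprn_gt0. Qed.
Let d_gt0 n : 0 < d n. Proof. by rewrite exprn_gt0. Qed.

Lemma h_cvg0 : (fun n => h n) @ \oo --> 0.
Proof.
have := @cvg_expr R 2^-1; rewrite ger0_norm ?invr_ge0// invf_lt1 ?ltr1n// => /(_ isT).
by rewrite (_ : GRing.exp _ = fun n => h n)//; apply/funext => n; rewrite exprVn.
Qed.

Lemma d_cvg0 : d @ \oo --> 0.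
Proof.
rewrite (_ : d = (fun n => h n) \* (fun n => h n))//.
by rewrite -[X in _ --> X](mulr0 (0 : R)); apply: cvgM; exact: h_cvg0.
Qed.

Let lhs t := \int[mu]_(u in `[0, t]) phi (b t - b u - y).
Let common t := \int[mu]_(u in `[0, t]) phi (- b u - y).
Let Lphi t := \int[mu]_(v in `[0, t]) \int[mu]_(u in `[0, v]) laplacian phi (b v - b u - y).

(** The walk starts at 0 and moves by h in each coordinate, so it stays on the
grid; the corner paths are defined only for such points. *)
Lemma S_grid (K : R) : \forall n \near \oo, forall k, k%:R * d n <= K ->
  forall j, exists i : int, S n k 0 j = i%:~R * h n.
Proof.
have := S_step K; apply: filterS => n Hs; elim => [|k IH] kK j.
  by exists 0; rewrite S0 mxE mul0r.
have [i Hi] := IH (kd_le d_gt0 (leqnSn k) kK) j.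
have := Hs k j kK; rewrite Hi => /eqP; rewrite eqr_norml (ltW (h_gt0 n)) andbT.
rewrite !subr_eq => /orP[]/eqP ->.
  by exists (i + 1); rewrite rmorphD/= mulrDl mul1r addrC.
by exists (i - 1); rewrite rmorphB/= mulrBl mul1r addrC.
Qed.

Let cphi : continuous phi. Proof. by case: phiC2. Qed.
Let dphi j x : derivable phi x (unit_vec R j). Proof. by case: phiC2 => _ /(_ j)[]. Qed.
Let cDphi j : continuous (partial j phi). Proof. by case: phiC2 => _ /(_ j)[_ []]. Qed.
Let cHphi i j : continuous (partial i (partial j phi)).
Proof. by case: phiC2 => _ /(_ j)[_ [_ /(_ i)[_]]]. Qed.
Lemma laplacian_continuous : continuous (laplacian phi).
Proof.
by move=> x; exact: (cvgD (@cHphi j1 j1 x) (@cHphi j2 j2 x)).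
Qed.
Let cLphi := laplacian_continuous.

Let m2phi := @field_modulus2 R b y b_modulus phi cphi.
Let m2common : modulus2_on (fun _ u => phi (- b u - y)).
Proof. exact: modulus2_on_snd (@field_modulus R b y b_modulus phi cphi). Qed.
Let m2cst (c : R) : modulus2_on (fun _ _ : R => c).
Proof. exact: modulus2_on_snd (modulus_cst c). Qed.

(** The trapezoid error is proportional to the length of the path, hence to the
norm of S n k, and to the oscillation of the gradient over h. *)
Lemma corner_array : array_cvg d
  (fun n k j => discrete_integral (h n) (corner_path (h n) (S n k))
                  (fun x => nabla phi (x - S n j - y)))
  (fun t u => phi (b t - b u - y) - phi (- b u - y)).
Proof.
apply: (array_cvg_squeeze (a := fun n k j => phi (S n k - S n j - y) - phi (- S n j - y))).
  apply: array_cvgB; first exact: field_array.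
  by apply: row_cvg_array => //; exact: field_row.
move=> K e e0; have [C C0 SC] := walk_bound d_gt0 b_modulus S_cvg K.
have eC : 0 < e / (4 * C) by rewrite divr_gt0// mulr_gt0.
have [q1 q10 H1] := unif_on_ball (C + (C + `|y|)) (@cDphi j1) eC.
have [q2 q20 H2] := unif_on_ball (C + (C + `|y|)) (@cDphi j2) eC.
near=> n => k j jk kK.
have SCn : forall k, k%:R * d n <= K -> `|S n k| <= C by near: n.
have Sg : forall k, k%:R * d n <= K -> forall j, exists i : int, S n k 0 j = i%:~R * h n.
  by near: n; exact: S_grid.
have hq1 : h n < q1 by near: n; exact: mesh_lt h_cvg0 q1 q10.
have hq2 : h n < q2 by near: n; exact: mesh_lt h_cvg0 q2 q20.
have jK := kd_le d_gt0 jk kK.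
have [k1 Hk1] := Sg k kK j1; have [k2 Hk2] := Sg k kK j2.
have := @corner_integral R phi (h n) (e / (4 * C)) (C + (C + `|y|)) (h_gt0 n) dphi _ (S n k) (S n j + y) k1 k2 Hk1 Hk2.
have -> : (fun x => nabla phi (x - (S n j + y))) = (fun x => nabla phi (x - S n j - y)).
  by apply/funext => x; rewrite opprD addrA.
have -> : S n k - (S n j + y) = S n k - S n j - y by rewrite opprD addrA.
have -> : - (S n j + y) = - S n j - y by rewrite opprD.
move=> H; apply: (le_trans (H _ _)).
- move=> i p c pM ch; rewrite distrC; apply: ltW.
  have pc q : `|c| < q -> `|p - (p + c *: unit_vec R i)| < q.
    by move=> cq; rewrite opprD addrA subrr sub0r normrN (le_lt_trans (norm_unit_vec _ _)).
  case: (ord2P i) pc => -> pc; [apply: H1 => //|apply: H2 => //].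
      exact: (pc _ (le_lt_trans ch hq1)).
    exact: (pc _ (le_lt_trans ch hq2)).
- by rewrite lerD ?SCn// (le_trans (ler_normD _ _))// lerD2r SCn.
- rewrite mulrC -mulrA ler_piMr// ?(ltW e0)// mulrC ler_pdivrMr ?mulr_gt0// mul1r.
  by rewrite ler_wpM2l// SCn.
Unshelve. all: by end_near. Qed.

(** The term is a Riemann sum in j of the integrals along corner paths. *)
Lemma trm_lhs_cvg : row_cvg d (fun n k => trm_lhs phi y (h n) (S n) k)
  (fun t => lhs t - common t).
Proof.
have := row_cvg_sumS d_gt0 d_cvg0 (modulus2B m2phi m2common) corner_array.
apply: eq_row_cvg => // [n k|t t0]; last by rewrite -(Rintegral0B2 t0 m2phi m2common).
by rewrite /trm_lhs big_mkord.
Qed.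

Lemma trm_path_cvg : row_cvg d (fun n k => trm_path phi y (h n) (S n) k)
  (fun t => t * phi (- y) - common t).
Proof.
have := array_cvg_diag corner_array.
have := modulus2_diag (modulus2B m2phi m2common).
set f := (f in row_cvg _ f _); set F := (F in modulus_on F) => uF fF.
have h1 := row_cvg_sumS d_gt0 d_cvg0 (modulus2_on_snd uF) (row_cvg_array d_gt0 fF).
have h2 : row_cvg d (fun n k => f n 0 * d n) (fun=> 0).
  have := row_cvg_mesh d_gt0 d_cvg0 uF fF => H K e e0.
  have := H 0 e e0; apply: filterS => n Hn k kK.
  by apply: Hn; rewrite mul0r.
have := row_cvgB d_gt0 h1 h2; apply: eq_row_cvg => // [n k|t t0].
  rewrite /trm_path big_add1/= big_mkord big_ord_recl/= addrC addKr.
  by apply: eq_bigr => i _.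
rewrite subr0 /F; under eq_Rintegral do rewrite subrr sub0r.
rewrite Rintegral0B ?Rintegral0_cst//; first exact: modulus_cst.
exact: field_modulus.
Qed.

Lemma tanaka_sum_cvg : row_cvg d (fun n k => tanaka_sum d S phi y n k)
  (fun t => lhs t - t * phi (- y)).
Proof.
have := row_cvg_sumS d_gt0 d_cvg0 (modulus2B m2phi (m2cst (phi (- y))))
  (array_cvgB (field_array y d_gt0 b_modulus S_cvg cphi)
     (row_cvg_array d_gt0 (row_cvg_cst d (phi (- y))))).
apply: eq_row_cvg => // t t0.
by rewrite -(Rintegral0_cst (phi (- y)) t0) -(Rintegral0B2 t0 m2phi (m2cst (phi (- y)))).
Qed.

Lemma trm_lap_cvg : row_cvg d (fun n k => trm_lap phi y (h n) (S n) k)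
  (fun t => 2^-1 * Lphi t).
Proof.
have mL := @field_modulus2 R b y b_modulus _ cLphi.
have := row_cvg_sumS d_gt0 d_cvg0 mL (field_array y d_gt0 b_modulus S_cvg cLphi).
move=> /(row_cvg_array d_gt0)/(row_cvg_sum d_gt0 d_cvg0 (modulus2_on_snd (modulus_Rintegral mL))).
move=> /(row_cvgZ 2^-1); apply: eq_row_cvg => // n k.
rewrite /trm_lap big_add1/= big_mkord; congr (_ * _).
apply: eq_bigr => r _; rewrite big_mkord mulr_suml; apply: eq_bigr => j _ /=.
by rewrite -mulrA -exprD.
Qed.

(** In the discrete Ito formula the squared increments equal h^2, so the second
order terms are half of the Laplacian term, whose limit is known; the error is
at most e times the elapsed time. *)
Lemma trm_mart_cvg : row_cvg d (fun n k => trm_mart phi y (h n) (S n) k)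
  (fun t => lhs t - t * phi (- y) - 2^-1 * Lphi t).
Proof.
have H := row_cvgB d_gt0 tanaka_sum_cvg trm_lap_cvg.
move=> K e e0; have e2 : 0 < e / 2 by rewrite divr_gt0.
have K1 : 0 < `|K| + 1 by rewrite ltr_wpDl.
have eK : 0 < e / 2 / (2 * (`|K| + 1)) by rewrite divr_gt0// mulr_gt0.
have := H K _ e2; have := S_step K.
have := @discrete_ito R d S b phi y d_gt0 d_cvg0 b_modulus S_cvg phiC2 K _ eK.
apply: filterS3 => n h1 h2 h3 k kK; have := h1 k kK; have := h3 k kK.
have dSE (r : 'I_k) j : (S n r.+1 0 j - S n r 0 j) ^+ 2 = d n.
  rewrite -(h2 r j); last by apply: kd_le kK => //; exact: ltn_ord.
  by rewrite real_normK ?num_real.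
have -> : \sum_(r < k) ((S n r.+1 0 j1 - S n r 0 j1) ^+ 2 + (S n r.+1 0 j2 - S n r 0 j2) ^+ 2)
   = 2 * (k%:R * d n).
  under eq_bigr do rewrite !dSE -mulr2n.
  by rewrite sumr_const card_ord -[_ *+ 2]mulr_natl -[_ *+ k]mulr_natl mulrCA.
have -> : mart_sum d S phi y n k = trm_mart phi y (h n) (S n) k.
  rewrite /trm_mart big_add1/= big_mkord; apply: eq_bigr => r _.
  rewrite big_mkord; apply: eq_bigr => j _ /=.
  by rewrite /walk_step !(mulrC (h n)) !divfK// gt_eqF.
have -> : 2^-1 * (\sum_(r < k) hess_sum d S phi y j1 j1 n r * (S n r.+1 0 j1 - S n r 0 j1) ^+ 2
     + \sum_(r < k) hess_sum d S phi y j2 j2 n r * (S n r.+1 0 j2 - S n r 0 j2) ^+ 2)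
   = trm_lap phi y (h n) (S n) k.
  rewrite /trm_lap big_add1/= big_mkord -big_split/=; congr (_ * _).
  apply: eq_bigr => r _; rewrite !dSE -mulrDl /hess_sum -big_split/= big_mkord mulr_suml.
  by apply: eq_bigr => j _; rewrite /laplacian -mulrDl -mulrA -exprD.
have : e / 2 / (2 * (`|K| + 1)) * (2 * (k%:R * d n)) <= e / 2.
  rewrite -mulrA ler_piMr// ?(ltW e2)// mulrC ler_pdivrMr ?mulr_gt0// mul1r.
  by rewrite ler_wpM2l// (le_trans kK)// (le_trans (ler_norm _))// lerDl.
move: (tanaka_sum _ _ _ _ _ _) (trm_mart _ _ _ _ _) (trm_lap _ _ _ _ _) (lhs _) (Lphi _) => a1 a2 a3 a4 a5.
rewrite !ler_norml => h4 /andP[? ?] /andP[? ?].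
apply/andP; split; lra.
Qed.

Lemma trm_residual_cvg : row_cvg d (fun n k => trm_lhs phi y (h n) (S n) k -
    (trm_path phi y (h n) (S n) k + trm_mart phi y (h n) (S n) k
     + trm_lap phi y (h n) (S n) k)) (fun=> 0).
Proof.
have := row_cvgB d_gt0 trm_lhs_cvg (row_cvgD (row_cvgD trm_path_cvg trm_mart_cvg) trm_lap_cvg).
by apply: eq_row_cvg => // t t0; ring.
Qed.

Lemma modulus_lhs : modulus_on lhs.
Proof. exact: modulus_Rintegral m2phi. Qed.

Lemma modulus_common : modulus_on common.
Proof. exact: modulus_Rintegral m2common. Qed.

Lemma modulus_Lphi : modulus_on Lphi.
Proof.
apply: (modulus_Rintegral (modulus2_on_snd _)); apply: modulus_Rintegral.
exact: field_modulus2.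
Qed.

End ImbeddedTerms.

(** * Sums over the self-intersection local time *)

Section LocalTimeSum.
Variable R : realType.

Lemma card_fiber (I T : choiceType) (s : seq I) (f : I -> T) (x : T) : uniq s ->
  (#|` fset_set [set p | p \in s /\ f p = x]|)%:R = \sum_(p <- s | f p == x) (1 : R).
Proof.
move=> us.
have -> : [set p | p \in s /\ f p = x] = [set` [fset p in [seq p <- s | f p == x]]%fset].
  apply/seteqP; split => p /=; rewrite inE mem_filter.
    by move=> [-> ->]; rewrite eqxx.
  by move=> /andP[/eqP -> ->].
rewrite set_fsetK card_fseq undup_id ?filter_uniq// -big_filter.
by rewrite -sum1_size natr_sum.
Qed.

(** Counting the pairs with a given image and summing over the images is summing
over the pairs. *)
Lemma sum_fiber_card (I T : choiceType) (s : seq I) (f : I -> T) (D : set T) (G : T -> R) :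
  uniq s -> (forall p, p \in s -> D (f p)) ->
  \sum_(x \in D) ((#|` fset_set [set p | p \in s /\ f p = x]|)%:R * G x) =
  \sum_(p <- s) G (f p).
Proof.
move=> us sD; pose r := undup (map f s).
rewrite -(@fsbig_widen _ _ _ _ [set` r]); first last.
- move=> x /= [_ /negP xr]; rewrite card_fiber// big1_seq ?mul0r// => p /andP[/eqP fp ps].
  by case/negP: xr; rewrite -fp mem_undup map_f.
- by move=> x /=; rewrite mem_undup => /mapP[p ps ->]; exact: sD.
rewrite -fsbig_seq ?undup_uniq//.
under eq_bigr do rewrite card_fiber// mulr_suml.
under eq_bigr do rewrite big_mkcond.
rewrite exchange_big/=; apply: eq_big_seq => p ps.
rewrite (bigD1_seq (f p)) ?undup_uniq ?mem_undup ?map_f//= eqxx mul1r.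
by rewrite big1 ?addr0// => x; rewrite eq_sym => /negbTE ->.
Qed.

(** Sums over all pairs i <= j < N, which is the finite set counted by the local
time. *)
Lemma local_time_sum (b : R -> 'rV[R]_2) (m N : nat) (t : R) (g : 'rV[R]_2 -> R) :
  (forall j : nat, (j%:R < t * 2 ^+ (2 * m)) = (j < N)%N) ->
  (forall j : nat, (j < N)%N ->
     forall i : 'I_2, exists k : int, imbedded_walk b m j 0 i = k%:~R * 2 ^- m) ->
  \sum_(x \in grid (2 ^- m)) self_local_time b m t x * g x * 2 ^- (2 * m) =
  \sum_(j < N) (\sum_(i < j.+1)
     g (imbedded_walk b m j - imbedded_walk b m i) * (2 ^- m) ^+ 2) * (2 ^- m) ^+ 2.
Proof.
move=> HN Hg; pose S := imbedded_walk b m.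
pose s := [seq p <- allpairs pair (iota 0 N) (iota 0 N) | (p.1 <= p.2)%N].
have us : uniq s by rewrite filter_uniq// allpairs_uniq ?iota_uniq// => -[? ?] [? ?].
have ms p : p \in s = (p.1 <= p.2)%N && (p.2 < N)%N.
  rewrite mem_filter; case: (leqP p.1 p.2) => //= p12.
  apply/allpairsP/idP => [[q [_ +] ->]|p2N]; first by rewrite mem_iota.
  by exists p; rewrite !mem_iota/= p2N (leq_ltn_trans p12)//; case: p p12 p2N.
pose G x := 2 ^- (2 * m) * g x * 2 ^- (2 * m).
have -> : \sum_(x \in grid (2 ^- m)) self_local_time b m t x * g x * 2 ^- (2 * m) =
    \sum_(x \in grid (2 ^- m))
       ((#|` fset_set [set p | p \in s /\ S p.2 - S p.1 = x]|)%:R * G x).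
  apply: eq_fsbigr => x _; rewrite /self_local_time /G.
  rewrite (_ : [set ij | _] = [set p | p \in s /\ S p.2 - S p.1 = x]); first by ring.
  apply/seteqP; split => -[i j] /=; rewrite ms/= HN.
    by move=> [-> -> ->].
  by move=> [/andP[-> ->] ->].
rewrite sum_fiber_card//; last first.
  move=> p; rewrite ms => /andP[p12 p2] i.
  have [k2 h2] := Hg _ p2 i; have [k1 h1] := Hg _ (leq_ltn_trans p12 p2) i.
  by exists (k2 - k1); rewrite coordB h1 h2 rmorphB/= mulrBl.
rewrite /s big_filter -[allpairs _ _ _]/[seq (i, j) | i <- iota 0 N, j <- iota 0 N].
rewrite big_mkcond big_allpairs/= -[iota 0 N](_ : index_iota 0 N = _); last by rewrite /index_iota subn0.
rewrite exchange_big/= big_mkord; apply: eq_bigr => j _.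
rewrite big_mkord -big_mkcond/= mulr_suml.
rewrite (big_ord_widen _ (fun i => g (S j - S i) * (2 ^- m) ^+ 2 * (2 ^- m) ^+ 2) (ltn_ord j)).
apply: eq_bigr => i _; rewrite /G -exprVn exprM -!exprVn -!exprM.
by rewrite mulnC !exprM mulrAC mulrC mulrA.
Qed.

End LocalTimeSum.

(** * Limits along the imbedded walk *)

(** The condition j < x is strict, so the number of such j is the ceiling of x. *)
Lemma strict_count (R : realType) (x : R) : 0 <= x -> exists N : nat,
  (forall j : nat, (j%:R < x) = (j < N)%N) /\ x <= N%:R <= x + 1.
Proof.
move=> x0; have /andP[h1 h2] := truncn_itv x0; set n := Num.truncn x in h1 h2.
have [h3|h3] := ltP n%:R x.
  exists n.+1; split; last by rewrite -natr1 lerD2r h1 natr1 ltW.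
  move=> j; rewrite ltnS; case: leqP => jn.
    by apply: le_lt_trans h3; rewrite ler_nat.
  by apply/negbTE; rewrite -leNgt (le_trans (ltW h2))// ler_nat.
have -> : x = n%:R by apply/le_anti; rewrite h1 h3.
by exists n; split; [move=> j; rewrite ltr_nat|rewrite lexx lerDl ler01].
Qed.

Lemma strict_count_scaled (R : realType) (t c : R) : 0 <= t -> 0 < c -> exists N : nat,
  (forall j : nat, (j%:R < t * c) = (j < N)%N) /\ t <= N%:R * c^-1 <= t + c^-1.
Proof.
move=> t0 c0; have [N [HN /andP[N1 N2]]] := strict_count (mulr_ge0 t0 (ltW c0)).
exists N; split=> //; rewrite ler_pdivlMr// N1/= ler_pdivrMr// mulrDl mulVf//.
by rewrite gt_eqF.
Qed.

Lemma modulus_round_up (R : realType) (L : R -> R) (t r e q x v : R) :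
  0 <= t -> r < q -> r < 1 -> t <= v <= t + r ->
  (forall s s', 0 <= s <= t + 1 -> 0 <= s' <= t + 1 -> `|s - s'| < q -> `|L s - L s'| < e / 2) ->
  `|x - L v| <= e / 2 -> `|L t - x| <= e.
Proof.
move=> t0 rq r1 /andP[v1 v2] Hq Hx.
rewrite -(subrKA (L v)) (le_trans (ler_normD _ _))// [leRHS]splitr lerD//; last by rewrite distrC.
apply/ltW/Hq; first by rewrite t0 lerDl ler01.
  by rewrite (le_trans t0 v1) (le_trans v2)// lerD2l ltW.
by rewrite distrC ger0_norm ?subr_ge0// ltrBlDl (le_lt_trans v2)// ltrD2l.
Qed.

Section ImbeddedPath.
Variable R : realType.
Notation mu := (@lebesgue_measure R).
Variables (b : R -> 'rV[R]_2) (phi : 'rV[R]_2 -> R) (y : 'rV[R]_2).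
Local Notation h n := (2 ^- n : R).
Local Notation d := (fun n : nat => (2 ^- n : R) ^+ 2).
Local Notation S := (imbedded_walk b).
Hypothesis b_modulus : modulus_on b.
Hypothesis S_cvg : forall K e : R, 0 < e -> \forall n \near \oo,
  forall k, k%:R * d n <= K -> `|S n k - b (k%:R * d n)| <= e.
Hypothesis S0 : forall n, S n 0 = 0.
Hypothesis S_step : forall K : R, \forall n \near \oo,
  forall k j, k.+1%:R * d n <= K -> `|S n k.+1 0 j - S n k 0 j| = h n.
Hypothesis phiC2 : Ck 2 phi.

(** By [local_time_sum] the sum is a double Riemann sum, up to a time which
exceeds t by at most one mesh. *)
Lemma local_time_cvg (g : 'rV[R]_2 -> R) (t : R) : continuous g -> 0 <= t ->
  (fun m : nat => \sum_(x \in grid (2 ^- m))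
     self_local_time b m t x * g x * 2 ^- (2 * m)) @ \oo -->
  \int[mu]_(v in `[0, t]) \int[mu]_(u in `[0, v]) g (b v - b u).
Proof.
move=> cg t0.
have d_gt0 (n : nat) : 0 < d n by rewrite exprn_gt0// invr_gt0 exprn_gt0.
pose L t := \int[mu]_(v in `[0, t]) \int[mu]_(u in `[0, v]) g (b v - b u).
have E : (fun t => \int[mu]_(v in `[0, t]) \int[mu]_(u in `[0, v]) g (b v - b u - 0)) = L.
  apply/funext => s; apply: eq_Rintegral => v _; apply: eq_Rintegral => u _.
  by rewrite subr0.
have mL := @field_modulus2 R b 0 b_modulus g cg.
have HL := row_cvg_sumS d_gt0 (@d_cvg0 R) mL (field_array 0 d_gt0 b_modulus S_cvg cg).
have aL : row_cvg d (fun n k => \sum_(j < k) (\sum_(i < j.+1) g (S n j - S n i - 0) * d n) * d n) L.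
  rewrite -E.
  exact (row_cvg_sum d_gt0 (@d_cvg0 R) (modulus2_on_snd (modulus_Rintegral mL)) (row_cvg_array d_gt0 HL)).
have uL : modulus_on L.
  rewrite -E; exact: modulus_Rintegral (modulus2_on_snd (modulus_Rintegral mL)).
apply/cvgrPdist_le => e e0; rewrite -/(L t).
have e2 : 0 < e / 2 by rewrite divr_gt0.
have [q q0 Hq] := uL (t + 1) _ e2.
have H1 := S_grid S0 S_step (t + 1); have H2 := aL (t + 1) _ e2.
near=> m.
have dq : d m < q by near: m; exact: mesh_lt (@d_cvg0 R) _ q0.
have d1 : d m < 1 by near: m; exact: mesh_lt (@d_cvg0 R) _ ltr01.
have Sg : forall k, k%:R * d m <= t + 1 -> forall j, exists i : int, S m k 0 j = i%:~R * h m.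
  by near: m.
have aLm : forall k : nat, k%:R * d m <= t + 1 ->
  `|\sum_(j < k) (\sum_(i < j.+1) g (S m j - S m i - 0) * d m) * d m - L (k%:R * d m)| <= e / 2.
  by near: m.
have dE : (2 ^+ (2 * m))^-1 = d m by rewrite mulnC exprM -exprVn.
have c0 : (0 : R) < 2 ^+ (2 * m) by rewrite exprn_gt0.
have [N [HN Nt']] := strict_count_scaled t0 c0.
have Nt : t <= N%:R * d m <= t + d m by rewrite -dE.
have NK : N%:R * d m <= t + 1.
  by move: Nt => /andP[_ /le_trans]; apply; rewrite lerD2l ltW.
apply: (modulus_round_up t0 dq d1 Nt Hq).
rewrite (@local_time_sum R b m N t g HN); last first.
  by move=> j jN i; apply: Sg; exact: (kd_le d_gt0 (ltnW jN) NK).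
have := aLm N NK; under eq_bigr do under eq_bigr do rewrite subr0.
exact.
Unshelve. all: by end_near. Qed.

Let lhs t := \int[mu]_(u in `[0, t]) phi (b t - b u - y).
Let common t := \int[mu]_(u in `[0, t]) phi (- b u - y).
Let Lphi t := \int[mu]_(v in `[0, t]) \int[mu]_(u in `[0, v]) laplacian phi (b v - b u - y).

Lemma imbedded_limits :
  (forall K : R, 0 < K ->
    [/\ {uniform `[0, K], along_imbedded b (trm_lhs phi y) @ \oo -->
                 (fun t => lhs t - common t)},
              {uniform `[0, K], along_imbedded b (trm_path phi y) @ \oo -->
                 (fun t => t * phi (- y) - common t)},
              {uniform `[0, K], along_imbedded b (trm_mart phi y) @ \oo -->
                 (fun t => lhs t - t * phi (- y) - 2^-1 * Lphi t)},
              {uniform `[0, K], along_imbedded b (trm_lap phi y) @ \oo -->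
                 (fun t => 2^-1 * Lphi t)}
            & {uniform `[0, K],
                 along_imbedded b (fun h S n =>
                   trm_lhs phi y h S n -
                   (trm_path phi y h S n + trm_mart phi y h S n
                    + trm_lap phi y h S n)) @ \oo -->
                 (fun _ : R => 0 : R)}]) /\
  (forall t : R, 0 <= t ->
          (fun m : nat =>
             \sum_(x \in grid (2 ^- m))
               self_local_time b m t x * laplacian phi (x - y) * 2 ^- (2 * m))
          @ \oo --> Lphi t).
Proof.
have d_gt0 (n : nat) : 0 < d n by rewrite exprn_gt0// invr_gt0 exprn_gt0.
have cLphi := laplacian_continuous phiC2.
split.
  move=> K K0.
  have ul := modulus_lhs y b_modulus phiC2.
  have uc := modulus_common y b_modulus phiC2.
  have uL := modulus_Lphi y b_modulus phiC2.
  have ut : modulus_on (fun t : R => t * phi (- y)).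
    have := modulusZ (phi (- y)) (@modulus_id R).
    by under eq_fun do rewrite mulrC.
  have uL2 := modulusZ 2^-1 uL.
  split.
  - exact (@row_cvg_uniform R d d_gt0 (@d_cvg0 R) _ _ K (trm_lhs_cvg y b_modulus S_cvg S0 S_step phiC2) (modulusB ul uc)).
  - exact (@row_cvg_uniform R d d_gt0 (@d_cvg0 R) _ _ K (trm_path_cvg y b_modulus S_cvg S0 S_step phiC2) (modulusB ut uc)).
  - exact (@row_cvg_uniform R d d_gt0 (@d_cvg0 R) _ _ K (trm_mart_cvg y b_modulus S_cvg S_step phiC2) (modulusB (modulusB ul ut) uL2)).
  - exact (@row_cvg_uniform R d d_gt0 (@d_cvg0 R) _ _ K (trm_lap_cvg y b_modulus S_cvg phiC2) uL2).
  - exact (@row_cvg_uniform R d d_gt0 (@d_cvg0 R) _ _ K (trm_residual_cvg y b_modulus S_cvg S0 S_step phiC2) (@modulus_cst R 0)).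
move=> t t0; have := @local_time_cvg (fun x => laplacian phi (x - y)) t _ t0; apply.
have c1 : continuous (fun x : 'rV[R]_2 => x - y).
  by move=> x; exact: (cvgB cvg_id (cvg_cst y)).
by move=> x; exact: (continuous_comp (c1 x) (cLphi _)).
Qed.

End ImbeddedPath.

(** * Skorohod times of a continuous path *)

Section Skorohod.
Variable R : realType.
Variables (w : R -> R) (h : R).
Hypothesis w_modulus : modulus_on w.
Hypothesis h_gt0 : 0 < h.
Local Notation s := (skorohod_time w h).

(** The set whose infimum is the next Skorohod time after a Skorohod time a. *)
Definition next_hits (a : R) : set R := [set u | a < u /\ `|w u - w a| = h].

(** The first k Skorohod times are genuine hitting times, rather than the infimum
of an empty set. *)
Definition hits_upto (k : nat) : Prop := forall i, (i < k)%N -> next_hits (s i) !=set0.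

Lemma next_hit_exists (a u : R) : 0 <= a -> a <= u -> h <= `|w u - w a| ->
  exists2 c, next_hits a c & c <= u.
Proof.
move=> a0 au hu.
have u0 := le_trans a0 au.
have mf : modulus_on (fun v => `|w v - w a|).
  move=> K e e0; have [q q0 H] := w_modulus K e0; exists q => // v v' vK v'K vv'.
  apply: le_lt_trans (H _ _ vK v'K vv').
  by rewrite (le_trans (ler_dist_dist _ _))// opprB addrA subrK.
have cf : {within `[a, u], continuous (fun v => `|w v - w a|)}.
  apply: continuous_subspaceW (modulus_within (K := u) mf).
  by apply: subset_itvr; rewrite bnd_simp.
have [|c] := @IVT _ (fun v => `|w v - w a|) a u h au cf.
  by rewrite subrr normr0 ge_min le_max (ltW h_gt0) hu orbT.
rewrite in_itv/= => /andP[ac cu] E; exists c => //; split=> //.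
rewrite lt_neqAle ac andbT; apply/eqP => ca.
by move: h_gt0; rewrite -E -ca subrr normr0 ltxx.
Qed.

(** The infimum is attained because the path is continuous; it is not a itself,
where the distance is 0. *)
Lemma next_hits_inf (a : R) : 0 <= a -> next_hits a !=set0 ->
  next_hits a (inf (next_hits a)).
Proof.
move=> a0 [u Hu]; set E := next_hits a; set i := inf E.
have hE : has_inf E.
  by split; [exists u|exists a => v [/ltW]].
have ai : a <= i by apply: lb_le_inf; [exists u|move=> v [/ltW]].
have iu : i <= u by apply: ge_inf => //; case: hE.
have u0 : 0 <= u by rewrite (le_trans a0)// (le_trans ai).
have Ei : `|w i - w a| = h.
  apply/eqP; apply/negPn/negP => Ni.
  have e0 : 0 < `| (`|w i - w a|) - h| by rewrite normr_gt0 subr_eq0.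
  have [q q0 Hq] := w_modulus (u + 1) e0.
  have q10 : 0 < Num.min q 1 by rewrite lt_min q0 ltr01.
  have [v Ev vi] := inf_adherent q10 hE; rewrite -/i in vi.
  have iv : i <= v by apply: ge_inf => //; case: hE.
  have viq : `|i - v| < q.
    by rewrite distrC ger0_norm ?subr_ge0// ltrBlDl (lt_le_trans vi)// lerD2l ge_min lexx.
  have vu1 : v <= u + 1.
    by rewrite (le_trans (ltW vi))// lerD// ge_min lexx orbT.
  have i0 := le_trans a0 ai.
  have := Hq i v; rewrite i0 (le_trans i0 iv) vu1 (le_trans iv vu1) => /(_ isT isT viq).
  rewrite ltNge => /negP; apply; case: Ev => _ <-.
  by rewrite (le_trans (ler_dist_dist _ _))// opprB addrA subrK.
split=> //; rewrite lt_neqAle ai andbT; apply/eqP => ia.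
by move: h_gt0; rewrite -Ei -ia subrr normr0 ltxx.
Qed.

Lemma skorohod_ge0 k : 0 <= s k.
Proof.
elim: k => //= k IH; rewrite -/(next_hits (s k)).
have [->|/set0P ne] := eqVneq (next_hits (s k)) set0; first by rewrite inf0.
by case: (next_hits_inf IH ne) => /(le_lt_trans IH)/ltW.
Qed.

Lemma hits_uptoW k j : (j <= k)%N -> hits_upto k -> hits_upto j.
Proof. by move=> jk H i ij; apply: H; exact: leq_trans ij jk. Qed.

Lemma skorohod_hit k i : hits_upto k -> (i < k)%N ->
  s i < s i.+1 /\ `|w (s i.+1) - w (s i)| = h.
Proof. by move=> H ik; exact: (next_hits_inf (skorohod_ge0 i) (H i ik)). Qed.

Lemma skorohod_homo k i j : hits_upto k -> (i <= j)%N -> (j <= k)%N -> s i <= s j.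
Proof.
move=> H; elim: j => [|j IH]; first by rewrite leqn0 => /eqP ->.
rewrite leq_eqVlt => /orP[/eqP -> //|ij] jk.
rewrite (le_trans (IH ij (ltnW jk)))// ltW//.
by have [] := skorohod_hit H jk.
Qed.

Lemma skorohod_inside k i u : hits_upto k -> (i < k)%N ->
  s i <= u < s i.+1 -> `|w u - w (s i)| < h.
Proof.
move=> H ik /andP[iu ui]; rewrite ltNge; apply/negP => hu.
have [c cE cu] := next_hit_exists (skorohod_ge0 i) iu hu.
have : s i.+1 <= c by apply: ge_inf => //; exists (s i) => v [/ltW].
by rewrite leNgt (le_lt_trans cu ui).
Qed.

(** N is the number of Skorohod times in ]0, t]. *)
Definition crossings (t : R) (N : nat) : Prop :=
  [/\ hits_upto N, s N <= t & forall u, s N <= u <= t -> `|w u - w (s N)| < h].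

(** Each crossing takes at least the time given by the modulus of continuity for
the height h, so only finitely many fit into [0, t]. *)
Lemma crossings_exists (t : R) : 0 <= t -> exists N, crossings t N.
Proof.
move=> t0; apply: contrapT => /forallNP HN.
have H N : hits_upto N /\ s N <= t.
  elim: N => [|N [IH1 IH2]]; first by split.
  have [u /andP[Nu ut] hu] : exists2 u, s N <= u <= t & h <= `|w u - w (s N)|.
    apply: contrapT => /forall2NP Hu; apply: (HN N); split=> // u Nut.
    by have [//|/negP] := Hu u; rewrite -ltNge.
  have [c cE cu] := next_hit_exists (skorohod_ge0 N) Nu hu.
  split; last first.
    apply: le_trans ut; apply: le_trans cu.
    by apply: ge_inf => //; exists (s N) => v [/ltW].
  move=> i; rewrite ltnS leq_eqVlt => /orP[/eqP ->|]; last exact: IH1.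
  by exists c.
have [q q0 Hq] := w_modulus t h_gt0.
have step N : q <= s N.+1 - s N.
  have [h1 h2] := skorohod_hit (H N.+1).1 (ltnSn N).
  rewrite leNgt; apply/negP => lq.
  have := Hq (s N.+1) (s N); rewrite !skorohod_ge0 (H N).2 (H N.+1).2 => /(_ isT isT).
  by rewrite ger0_norm ?subr_ge0 ?(ltW h1)// h2 ltxx => /(_ lq).
have sN N : N%:R * q <= s N.
  elim: N => [|N IH]; first by rewrite mul0r.
  rewrite -natr1 mulrDl mul1r (le_trans (lerD IH (step N)))//.
  by rewrite addrC subrK.
have /andP[_ h2] := truncn_itv (divr_ge0 t0 (ltW q0)).
move: h2; rewrite ltr_pdivrMr// ltNge => /negP; apply.
exact: le_trans (sN _) (H _).2.
Qed.

Lemma crossings_next (t : R) (N k : nat) : crossings t N -> (N < k)%N ->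
  hits_upto k -> t < s k.
Proof.
move=> [_ _ HN] Nk Hk; apply: lt_le_trans (skorohod_homo Hk Nk (leqnn k)).
have [h1 h2] := skorohod_hit Hk Nk.
rewrite ltNge; apply/negP => st.
by have := HN (s N.+1); rewrite (ltW h1) st h2 ltxx => /(_ isT).
Qed.

End Skorohod.

Section SkorohodClock.
Variable R : realType.
Variable w : R -> R.
Hypothesis w_modulus : modulus_on w.
Local Notation h n := (2 ^- n : R).
Local Notation d := (fun n : nat => (2 ^- n : R) ^+ 2).

Hypothesis count_cvg : forall (a p : nat) (e : R), 0 < e -> \forall m \near \oo,
  forall N, crossings w (h m) (a%:R * 2 ^- p) N -> `|N%:R * d m - a%:R * 2 ^- p| <= e.

Lemma near_forall_lt (A : nat) (Q : nat -> nat -> Prop) :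
  (forall a, \forall m \near \oo, Q a m) -> \forall m \near \oo, forall a, (a < A)%N -> Q a m.
Proof.
move=> H; elim: A => [|A IH]; first by apply: nearW.
apply: filterS2 IH (H A) => m H1 H2 a.
by rewrite ltnS leq_eqVlt => /orP[/eqP ->|/H1].
Qed.

(** The counting function and the Skorohod times are inverse to each other and
both are monotone, so knowing the count at the points of a fine dyadic grid is
enough. *)
Lemma skorohod_clock (K e : R) : 0 < e -> \forall m \near \oo, forall k, k%:R * d m <= K ->
  hits_upto w (h m) k /\ `|skorohod_time w (h m) k - k%:R * d m| <= e.
Proof.
move=> e0.
have [p p2] : exists p : nat, 2 ^- p * 2 <= e.
  have [p Hp] : exists p : nat, 2 / e < p%:R.
    by exists (Num.truncn (2 / e)).+1; have /andP[] := truncn_itv (divr_ge0 (ler0n R 2) (ltW e0)).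
  exists p; rewrite mulrC ler_pdivrMr ?exprn_gt0//; move: Hp; rewrite ltr_pdivrMr// => Hp.
  rewrite (le_trans (ltW Hp))// mulrC ler_wpM2l ?(ltW e0)//.
  by rewrite -natrX ler_nat ltnW// ltn_expl.
set r : R := 2 ^- p in p2; have r0 : 0 < r by rewrite invr_gt0 exprn_gt0.
pose A := (Num.truncn (`|K| / r)).+4.
have := @near_forall_lt A _ (fun a => count_cvg a p (divr_gt0 r0 (ltr0Sn R 1))).
rewrite -/r; apply: filterS => m Hm k kK.
have hm : 0 < h m by rewrite invr_gt0 exprn_gt0.
have dm : 0 < d m by rewrite exprn_gt0.
have kd0 : 0 <= k%:R * d m by rewrite mulr_ge0// ltW.
have /andP[l1 l2] := truncn_itv (divr_ge0 kd0 (ltW r0)).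
set l := Num.truncn _ in l1 l2.
have {}l1 : l%:R * r <= k%:R * d m by rewrite -ler_pdivlMr.
have {}l2 : k%:R * d m < l.+1%:R * r by rewrite -ltr_pdivrMr.
(* l 2^-p <= k 4^-m < (l+1) 2^-p: the clock is compared with its counts at l+2
   and l-1, leaving 2^-p of room on each side for the error of the counts *)
have lA : (l.+2 < A)%N.
  rewrite /A !ltnS; apply: leqW; apply: le_truncn; rewrite ler_wpM2r ?invr_ge0 ?(ltW r0)//.
  exact: le_trans kK (ler_norm K).
have t0 a : 0 <= a%:R * r by rewrite mulr_ge0// ltW.
have [N HN] := crossings_exists w_modulus hm (t0 l.+2).
have := Hm _ lA N HN; rewrite ler_norml => /andP[hN _].
have kN : (k <= N)%N.
  rewrite -(ler_nat R) -(ler_pM2r dm); apply: le_trans (ltW l2) _.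
  by move: hN r0; rewrite -(natr1 l.+1) mulrDl mul1r; lra.
have [ok sN _] := HN.
have okk := hits_uptoW kN ok; split=> //.
have up : skorohod_time w (h m) k <= k%:R * d m + e.
  apply: (le_trans (skorohod_homo w_modulus hm ok kN (leqnn N))); apply: (le_trans sN).
  by move: l1 p2; rewrite -!natr1 !mulrDl !mul1r; lra.
suff lo : k%:R * d m - e <= skorohod_time w (h m) k.
  by rewrite ler_norml; apply/andP; split; lra.
have [l0|l0] := posnP l.
  apply: le_trans (skorohod_ge0 w_modulus hm k).
  by move: l2 p2 r0; rewrite l0 mul1r; lra.
have l1A : (l.-1 < A)%N by rewrite (leq_ltn_trans (leq_pred l))// (leq_trans _ lA)// ltnS leqW.
have [N' HN'] := crossings_exists w_modulus hm (t0 l.-1).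
have := Hm _ l1A N' HN'; rewrite ler_norml => /andP[_ hN'].
have lE : l%:R = l.-1%:R + 1 :> R by rewrite natr1 prednK.
have N'k : (N' < k)%N.
  rewrite -(ltr_nat R) -(ltr_pM2r dm); apply: lt_le_trans l1.
  by move: hN' r0; rewrite lE mulrDl mul1r; lra.
have := crossings_next w_modulus hm HN' N'k okk.
by move: l2 p2 r0; rewrite -(natr1 l) lE !mulrDl !mul1r; lra.
Qed.

End SkorohodClock.

Section ImbeddedWalkCvg.
Variable R : realType.
Variable b : R -> 'rV[R]_2.
Hypothesis b_modulus : forall j, modulus_on (fun t => b t 0 j).
Hypothesis b0 : b 0 = 0.
Local Notation h n := (2 ^- n : R).
Local Notation d := (fun n : nat => (2 ^- n : R) ^+ 2).
Hypothesis count_cvg : forall (j : 'I_2) (a p : nat) (e : R), 0 < e -> \forall m \near \oo,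
  forall N, crossings (fun t => b t 0 j) (h m) (a%:R * 2 ^- p) N ->
    `|N%:R * d m - a%:R * 2 ^- p| <= e.

Lemma near_ord2 (Q : 'I_2 -> nat -> Prop) :
  (forall j, \forall m \near \oo, Q j m) -> \forall m \near \oo, forall j, Q j m.
Proof. by move=> H; apply: filterS2 (H j1) (H j2) => m h1 h2 j; have [->|->] := ord2P j. Qed.

Lemma imbedded_walk0 m : imbedded_walk b m 0 = 0.
Proof. by apply/rowP => j; rewrite !mxE b0 mxE. Qed.

(** The walk samples the path at the Skorohod times, which are close to k 4^-m;
the two coordinates have different clocks. *)
Lemma imbedded_walk_cvg (K e : R) : 0 < e -> \forall m \near \oo,
  forall k, k%:R * d m <= K -> `|imbedded_walk b m k - b (k%:R * d m)| <= e.
Proof.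
move=> e0.
suff : \forall m \near \oo, forall j k, k%:R * d m <= K ->
    `|(imbedded_walk b m k - b (k%:R * d m)) 0 j| <= e.
  by apply: filterS => m H k kK; apply: norm_le_coord => j; exact: H.
apply: near_ord2 => j; have [q q0 Hq] := b_modulus j (K + 1) e0.
have q1 : 0 < Num.min (q / 2) 1 by rewrite lt_min divr_gt0// ltr01.
have := skorohod_clock (b_modulus j) (count_cvg j) K q1.
apply: filterS => m H k kK; have [_ Hs] := H k kK.
have hm : 0 < h m by rewrite invr_gt0 exprn_gt0.
have kd0 : 0 <= k%:R * d m by rewrite mulr_ge0// exprn_ge0// ltW.
have s0 := skorohod_ge0 (b_modulus j) hm k.
rewrite !mxE; apply/ltW/Hq.
- rewrite s0/=; move: Hs; rewrite le_min ler_norml => /andP[_].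
  by rewrite ler_norml => /andP[_]; rewrite lerBlDl => /le_trans; apply; rewrite lerD2r.
- by rewrite kd0 (le_trans kK)// lerDl.
- by move: Hs; rewrite le_min => /andP[/le_lt_trans + _]; apply; rewrite ltr_pdivrMr// ltr_pMr// ltr1n.
Qed.

Lemma imbedded_walk_step (K : R) : \forall m \near \oo, forall k j, k.+1%:R * d m <= K ->
  `|imbedded_walk b m k.+1 0 j - imbedded_walk b m k 0 j| = h m.
Proof.
suff : \forall m \near \oo, forall j k, k.+1%:R * d m <= K ->
    `|imbedded_walk b m k.+1 0 j - imbedded_walk b m k 0 j| = h m.
  by apply: filterS => m H k j; exact: H.
apply: near_ord2 => j.
have := skorohod_clock (b_modulus j) (count_cvg j) K ltr01.
apply: filterS => m H k kK; have [ok _] := H _ kK.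
have hm : 0 < h m by rewrite invr_gt0 exprn_gt0.
by rewrite !mxE; have [_] := skorohod_hit (b_modulus j) hm ok (ltnSn k).
Qed.

End ImbeddedWalkCvg.

(** * Weighted sums of squared increments *)

Section WeightedSums.
Variable R : realType.

(** An Abel-type estimate by blocks of length q: on a block the weight is almost
constant, so that only the increments of the partial sums of x matter. *)
Lemma block_sum_bound (q n B : nat) (c x : nat -> R) (o C D : R) :
  0 <= o -> 0 <= C -> 0 <= D ->
  (forall r, (r <= n)%N -> `|c r| <= C) ->
  (forall r r', (r <= r' <= n)%N -> (r' <= r + q)%N -> `|c r' - c r| <= o) ->
  (forall k, (k <= n)%N -> `|\sum_(0 <= r < k) x r| <= D) ->
  forall k, (k <= n)%N -> (k <= B * q)%N ->
  `|\sum_(0 <= r < k) c r * x r| <= B%:R * (2 * C * D) + o * \sum_(0 <= r < k) `|x r|.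
Proof.
move=> o0 C0 D0 cC co xD; elim: B => [|B IH] k kn kB.
  have -> : k = 0%N by apply/eqP; rewrite -leqn0.
  by rewrite !big_geq// normr0 mul0r mulr0 addr0.
have CD0 : 0 <= 2 * C * D by rewrite !mulr_ge0.
(* only the last, possibly incomplete, block is new *)
have [kB'|Bk] := leqP k (B * q).
  by rewrite (le_trans (IH k kn kB'))// lerD2r ler_wpM2r// ler_nat.
have Bn : (B * q <= n)%N by apply: leq_trans (ltnW Bk) kn.
rewrite (big_cat_nat (leq0n (B * q)) (ltnW Bk))/=.
rewrite (big_cat_nat (leq0n (B * q)) (ltnW Bk))/= mulrDr.
have h1 := IH _ Bn (leqnn _).
have -> : \sum_(B * q <= r < k) c r * x r =
  c (B * q)%N * (\sum_(0 <= r < k) x r - \sum_(0 <= r < B * q) x r)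
  + \sum_(B * q <= r < k) (c r - c (B * q)%N) * x r.
  rewrite (big_cat_nat (leq0n (B * q)) (ltnW Bk))/= (addrC (\sum_(0 <= r < B * q) x r)) addrK.
  by rewrite mulr_sumr -big_split/=; apply: eq_bigr => r _; ring.
have h2 : `|c (B * q)%N * (\sum_(0 <= r < k) x r - \sum_(0 <= r < B * q) x r)| <= C * (2 * D).
  rewrite normrM ler_pM ?cC// (le_trans (ler_normB _ _))//.
  by rewrite mulr2n mulrDl mul1r lerD ?xD.
have h3 : `|\sum_(B * q <= r < k) (c r - c (B * q)%N) * x r| <= o * \sum_(B * q <= r < k) `|x r|.
  rewrite (le_trans (ler_norm_sum _ _ _))// mulr_sumr !big_nat ler_sum// => r /andP[r1 r2].
  rewrite normrM ler_wpM2r//; apply: co; first by rewrite r1 (leq_trans (ltnW r2)).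
  by rewrite (leq_trans (ltnW r2))// (leq_trans kB)// mulSn addnC.
rewrite (le_trans (ler_normD _ _))// -natr1 mulrDl mul1r.
rewrite (le_trans (lerD h1 (ler_normD _ _)))//.
rewrite (le_trans (lerD (lexx _) (lerD h2 h3)))//.
move: (\sum_(_ <= _ < _) _) (\sum_(_ <= _ < _) _) => u v; lra.
Qed.

Local Notation d := (fun n : nat => 2 ^- n : R).

Lemma dyadic_gt0 n : 0 < d n. Proof. by rewrite invr_gt0 exprn_gt0. Qed.

Lemma dyadic_pow (n p a : nat) : (p <= n)%N -> (a * 2 ^ (n - p))%:R * d n = a%:R * d p.
Proof.
move=> pn; rewrite natrM natrX -mulrA; congr (_ * _).
by rewrite -{2}(subnK pn) exprD invfM mulrA mulfV ?mul1r// gt_eqF// exprn_gt0.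
Qed.

(** Polya's argument: a monotone function that converges to a line at dyadic
times is squeezed between its values at neighbouring dyadic times. *)
Lemma row_cvg_monotone (x : nat -> nat -> R) (c : R) : (forall n r, 0 <= x n r) ->
  (forall a p : nat, (fun n => \sum_(r < a * 2 ^ (n - p)) x n r) @ \oo --> c * (a%:R * d p)) ->
  row_cvg d (fun n k => \sum_(r < k) x n r) (fun t => c * t).
Proof.
move=> x0 H.
have c0 : 0 <= c.
  have := H 1%N 0%N; rewrite mul1r expr0 invr1 mulr1 => H1.
  rewrite -(cvg_lim _ H1)//; apply: limr_ge; first by apply/cvg_ex; eexists; exact: H1.
  by apply: nearW => n; apply: sumr_ge0.
move=> K e e0.
have c1 : 0 < c + 1 by rewrite ltr_wpDl.
have [p p2] : exists p : nat, (c + 1) * d p <= e / 2.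
  have q0 : 0 < e / 2 / (c + 1) by rewrite !divr_gt0.
  have H1 := mesh_lt (@h_cvg0 R) q0.
  have [p Hp] := filter_ex H1; exists p; move: Hp; rewrite ltr_pdivlMr// mulrC => /ltW; exact.
(* the dyadic times a 2^-p with a < A include a right neighbour of each point
   of [0, K] *)
pose A := (Num.truncn (`|K| / d p)).+3.
have e2 : 0 < e / 2 by rewrite divr_gt0.
have := @near_forall_lt A (fun a n => `|c * (a%:R * d p) - \sum_(r < a * 2 ^ (n - p)) x n r| <= e / 2)
   (fun a => _).
move=> HA.
have {}HA : \forall n \near \oo, forall a, (a < A)%N ->
   `|c * (a%:R * d p) - \sum_(r < a * 2 ^ (n - p)) x n r| <= e / 2.
  apply: HA; first by move=> a; have /cvgrPdist_le/(_ _ e2) := H a p.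
near=> n => k kK.
have pn : (p <= n)%N by near: n; exact: nbhs_infty_ge.
have HAn : forall a, (a < A)%N -> `|c * (a%:R * d p) - \sum_(r < a * 2 ^ (n - p)) x n r| <= e / 2.
  by near: n.
pose Q k := \sum_(r < k) x n r.
have Qm i j : (i <= j)%N -> Q i <= Q j.
  move=> ij; rewrite /Q -(big_mkord xpredT (x n)) -[leRHS](big_mkord xpredT (x n)).
  by rewrite (big_cat_nat (leq0n i) ij)/= lerDl sumr_ge0.
have q0 : (0 < 2 ^ (n - p))%N by rewrite expn_gt0.
pose a := (k %/ 2 ^ (n - p))%N.
have ak : (a * 2 ^ (n - p) <= k)%N by exact: leq_divM.
have ka : (k <= a.+1 * 2 ^ (n - p))%N by rewrite ltnW// ltn_ceil.
have dn := dyadic_gt0 n; have dp := dyadic_gt0 p.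
have ak' : a%:R * d p <= k%:R * d n by rewrite -(dyadic_pow a pn) ler_wpM2r ?(ltW dn)// ler_nat.
have ka' : k%:R * d n <= a.+1%:R * d p by rewrite -(dyadic_pow a.+1 pn) ler_wpM2r ?(ltW dn)// ler_nat.
have aA : (a.+1 < A)%N.
  rewrite /A !ltnS; apply: leqW; rewrite truncn_ge_nat ?divr_ge0 ?(ltW dp)// ler_pdivlMr//.
  by rewrite (le_trans ak')// (le_trans kK)// ler_norm.
have := HAn _ (ltnW aA); have := HAn _ aA.
have := Qm _ _ ak; have := Qm _ _ ka; rewrite -/(Q _) -/(Q _).
have h1 := ler_wpM2l c0 ak'; have h2 := ler_wpM2l c0 ka'.
have h3 : c * (a.+1%:R * d p) = c * (a%:R * d p) + c * d p by rewrite -natr1 mulrDl mul1r mulrDr.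
have h4 : c * d p <= e / 2.
  by apply: le_trans p2; rewrite ler_wpM2r ?(ltW dp)// lerDl.
rewrite -!/(Q _); move: h1 h2 h4; rewrite h3.
move: (c * (k%:R * d n)) (c * (a%:R * d p)) (c * d p) (Q _) (Q _) (Q _) => u1 u2 u3 v1 v2 v3.
rewrite !ler_norml => ? ? ? ? ? /andP[? ?] /andP[? ?]; apply/andP; split; lra.
Unshelve. all: by end_near. Qed.

End WeightedSums.

Lemma dist3 (R : realFieldType) (a a' b b' o : R) :
  `|a - a'| <= o / 3 -> `|a' - b'| < o / 3 -> `|b - b'| <= o / 3 -> `|a - b| <= o.
Proof.
by rewrite !ler_norml ltr_norml => /andP[? ?] /andP[? ?] /andP[? ?]; apply/andP; split; lra.
Qed.

Section WeightedRows.
Variable R : realType.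
Notation mu := (@lebesgue_measure R).
Local Notation d := (fun n : nat => 2 ^- n : R).
Let d_gt0 := @dyadic_gt0 R.
Let d_cvg0 := @h_cvg0 R.

Lemma row_cvg_bound (a : nat -> nat -> R) (A : R -> R) (K : R) : modulus_on A ->
  row_cvg d a A -> exists2 C : R, 0 < C & \forall n \near \oo,
    forall k, k%:R * d n <= K -> `|a n k| <= C.
Proof.
move=> uA aA; have [C C0 AC] := modulus_bound K uA.
exists (C + 1); first by rewrite addr_gt0.
have := aA K _ ltr01; apply: filterS => n H k kK.
rewrite -(subrK (A (k%:R * d n)) (a n k)) (le_trans (ler_normD _ _))//.
by rewrite addrC lerD ?H// AC// kK mulr_ge0// ltW.
Qed.

(** Cut [0, K] into a fixed number of blocks, short enough for the weight to be
almost constant on each; then let the partial sums of x tend to 0. *)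
Lemma row_cvg_weighted0 (c x : nat -> nat -> R) (Cf : R -> R) :
  modulus_on Cf -> row_cvg d c Cf ->
  row_cvg d (fun n k => \sum_(r < k) x n r) (fun=> 0) ->
  (forall K, exists V : R, \forall n \near \oo, forall k, k%:R * d n <= K ->
     \sum_(r < k) `|x n r| <= V) ->
  row_cvg d (fun n k => \sum_(r < k) c n r * x n r) (fun=> 0).
Proof.
move=> uC cC x0 xV K e e0.
have [V1 HV1] := xV K.
have [C C0 HC] := row_cvg_bound K uC cC.
pose V2 := `|V1| + 1; have V20 : 0 < V2 by rewrite ltr_wpDl.
have o0 : 0 < e / 2 / V2 by rewrite !divr_gt0.
have o3 : 0 < e / 2 / V2 / 3 by rewrite !divr_gt0.
have [q q0 Hq] := uC K _ o3.
have [p Hp] := filter_ex (mesh_lt d_cvg0 q0).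
(* A blocks of 2^(n-p) steps, each of duration 2^-p < q, cover [0, K] *)
pose A := (Num.truncn (`|K| / d p)).+1.
have D0 : 0 < e / 2 / (A%:R * (2 * C)) by rewrite !divr_gt0// !mulr_gt0// ltr0n.
near=> n => k kK.
have pn : (p <= n)%N by near: n; exact: nbhs_infty_ge.
have HCn : forall k, k%:R * d n <= K -> `|c n k| <= C by near: n.
have HVn : forall k, k%:R * d n <= K -> \sum_(r < k) `|x n r| <= V1 by near: n.
have Hcn : forall k, k%:R * d n <= K -> `|c n k - Cf (k%:R * d n)| <= e / 2 / V2 / 3.
  by near: n; exact: cC.
have Hxn : forall k, k%:R * d n <= K -> `|\sum_(r < k) x n r - 0| <= e / 2 / (A%:R * (2 * C)).
  by near: n; exact: x0.
have dn := d_gt0 n; have dp := d_gt0 p.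
have kAq : (k <= A * 2 ^ (n - p))%N.
  rewrite -(ler_nat R) -(ler_pM2r dn) dyadic_pow// (le_trans kK)// (le_trans (ler_norm K))//.
  rewrite -ler_pdivrMr// ltW//.
  by have /andP[_] := truncn_itv (divr_ge0 (normr_ge0 K) (ltW dp)).
have kd j : (j <= k)%N -> j%:R * d n <= K by move=> jk; exact: (kd_le d_gt0 jk kK).
have := @block_sum_bound R (2 ^ (n - p)) k A (c n) (x n) (e / 2 / V2) C
  (e / 2 / (A%:R * (2 * C))) (ltW o0) (ltW C0) (ltW D0).
move=> /(_ (fun r rk => HCn r (kd r rk))) H.
have {}H := H _ _ k (leqnn k) kAq.
rewrite subr0 -(big_mkord xpredT (fun r => c n r * x n r)).
apply: (le_trans (H _ _)).
- move=> r r' /andP[rr' r'k] r'q.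
  have h1 := Hcn _ (kd _ r'k); have h2 := Hcn _ (kd _ (leq_trans rr' r'k)).
  have h3 : `|Cf (r'%:R * d n) - Cf (r%:R * d n)| < e / 2 / V2 / 3.
    apply: Hq; rewrite ?kd ?mulr_ge0 ?(ltW dn)//.
      exact: leq_trans rr' r'k.
    rewrite -mulrBl -natrB// normrM !ger0_norm ?(ltW dn)//.
    apply: le_lt_trans Hp; rewrite -[leRHS]mul1r -(dyadic_pow R 1 pn) mul1n.
    by rewrite ler_wpM2r ?(ltW dn)// ler_nat leq_subLR.
  exact: dist3 h1 h3 h2.
- by move=> j jk; rewrite big_mkord -[X in `|X|]subr0 Hxn// kd.
- have -> : A%:R * (2 * C * (e / 2 / (A%:R * (2 * C)))) = e / 2.
    by field; rewrite ?gt_eqF// ltr0n.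
  rewrite [leRHS]splitr lerD2l big_mkord -mulrA ler_piMr ?divr_ge0 ?(ltW e0)//.
  rewrite mulrC ler_pdivrMr// mul1r (le_trans (HVn _ kK))// (le_trans (ler_norm _))// lerDl//.
Unshelve. all: by end_near. Qed.

(** The part k1 d n of x n r gives a Riemann sum; the rest has vanishing partial
sums and, being dominated by v, bounded total variation. *)
Lemma row_cvg_weighted (c x v : nat -> nat -> R) (Cf : R -> R) (k1 V : R) :
  modulus_on Cf -> row_cvg d c Cf ->
  row_cvg d (fun n k => \sum_(r < k) x n r) (fun t => k1 * t) ->
  (forall n r, `|x n r| <= v n r) ->
  row_cvg d (fun n k => \sum_(r < k) v n r) (fun t => V * t) ->
  row_cvg d (fun n k => \sum_(r < k) c n r * x n r)
    (fun t => k1 * \int[mu]_(u in `[0, t]) Cf u).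
Proof.
move=> uC cC xk xv vV.
have h1 := row_cvgZ k1 (row_cvg_sum d_gt0 d_cvg0 (modulus2_on_snd uC) (row_cvg_array d_gt0 cC)).
have h2 : row_cvg d (fun n k => \sum_(r < k) c n r * (x n r - k1 * d n)) (fun=> 0).
  refine (@row_cvg_weighted0 c (fun n r => x n r - k1 * d n) Cf uC cC _ _).
  - have := row_cvgB d_gt0 xk (row_cvgZ k1 (row_cvg_time d)).
    apply: eq_row_cvg => // [n k|t _]; last by rewrite subrr.
    rewrite sumrB; congr (_ - _); by rewrite sumr_const card_ord -[RHS]mulr_natl mulrCA.
  - move=> K; have uV : modulus_on (fun t : R => V * t) := modulusZ V (@modulus_id R).
    have [C C0 HC] := row_cvg_bound K uV vV.
    exists (C + `|k1| * `|K|); apply: filterS HC => n HC k kK.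
    apply: (@le_trans _ _ (\sum_(r < k) (v n r + `|k1| * d n))).
      apply: ler_sum => r _; rewrite (le_trans (ler_normB _ _))// lerD// normrM.
      by rewrite (ger0_norm (ltW (d_gt0 n))).
    rewrite big_split/= lerD//; first exact: le_trans (ler_norm _) (HC k kK).
    rewrite sumr_const card_ord -mulrnAr ler_wpM2l// -mulr_natl.
    exact: le_trans kK (ler_norm K).
have := row_cvgD h1 h2; apply: eq_row_cvg => // [n k|t _]; last by rewrite addr0.
by rewrite mulr_sumr -big_split/=; apply: eq_bigr => r _; ring.
Qed.

End WeightedRows.

(** * The Ito formula along dyadic samples *)

Lemma norm_mul_le_energy (R : realDomainType) (a c : R) : `|a * c| <= a ^+ 2 + c ^+ 2.
Proof.
rewrite normrM -(real_normK (num_real a)) -(real_normK (num_real c)).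
have := sqr_ge0 (`|a| - `|c|); rewrite sqrrB.
have := sqr_ge0 `|a|; have := sqr_ge0 `|c|; have := mulr_ge0 (normr_ge0 a) (normr_ge0 c).
move: (`|a| ^+ 2) (`|c| ^+ 2) (`|a| * `|c|) => u v x; lra.
Qed.

(** The martingale sum evaluates the second partial derivative at the corner of
each step; this isolates the first order correction, which is a mixed second
derivative times a product of increments. *)
Lemma mart_regroup (R : realType) (k : nat) (c : R) (A1 B2 B2' H : nat -> nat -> R)
    (u v : nat -> R) :
  \sum_(r < k) \sum_(j < r.+1) (A1 r j * u r + B2' r j * v r) * c
  - \sum_(r < k) ((\sum_(j < r.+1) A1 r j * c) * u r + (\sum_(j < r.+1) B2 r j * c) * v r)
  - \sum_(r < k) (\sum_(j < r.+1) H r j * c) * (u r * v r) =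
  \sum_(r < k) \sum_(j < r.+1) (B2' r j - B2 r j - u r * H r j) * v r * c.
Proof.
rewrite -!sumrB; apply: eq_bigr => r _.
rewrite !mulr_suml -big_split/= -!sumrB; apply: eq_bigr => j _ /=; ring.
Qed.

Section DyadicIto.
Variable R : realType.
Notation mu := (@lebesgue_measure R).
Variables (b : R -> 'rV[R]_2) (phi : 'rV[R]_2 -> R) (y : 'rV[R]_2).
Local Notation d := (fun n : nat => 2 ^- n : R).
Let d_gt0 := @dyadic_gt0 R.
Let d_cvg0 := @h_cvg0 R.
Local Notation S := (fun (n k : nat) => b (k%:R * d n)).
Local Notation dS n r j := (S n r.+1 0 j - S n r 0 j).
Hypothesis b_modulus : modulus_on b.
Hypothesis phiC2 : Ck 2 phi.
Hypothesis qv : forall (j : 'I_2) (a p : nat),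
  (fun n => \sum_(r < a * 2 ^ (n - p)) dS n r j ^+ 2) @ \oo --> a%:R * d p.
Hypothesis cov : forall a p : nat,
  (fun n => \sum_(r < a * 2 ^ (n - p)) dS n r j1 * dS n r j2) @ \oo --> (0 : R).

Let S_cvg (K e : R) : 0 < e -> \forall n \near \oo,
  forall k, k%:R * d n <= K -> `|S n k - b (k%:R * d n)| <= e.
Proof. by move=> e0; apply: nearW => n k _; rewrite subrr normr0 ltW. Qed.

Definition grad_sum j n r := \sum_(l < r.+1) partial j phi (S n r - S n l - y) * d n.
(** The sums for the left-point rule, which is adapted to the filtration, unlike
the corner rule of [mart_sum]. *)
Definition ito_sum n k := \sum_(r < k) (grad_sum j1 n r * dS n r j1 + grad_sum j2 n r * dS n r j2).

Let cphi : continuous phi. Proof. by case: phiC2. Qed.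
Let cHphi i j : continuous (partial i (partial j phi)).
Proof. by case: phiC2 => _ /(_ j)[_ [_ /(_ i)[_]]]. Qed.

Lemma qv_row j : row_cvg d (fun n k => \sum_(r < k) dS n r j ^+ 2) id.
Proof.
refine (eq_row_cvg d_gt0 _ _
  (@row_cvg_monotone R (fun n r => dS n r j ^+ 2) 1 (fun n r => sqr_ge0 _) _)) => //.
  by move=> t _; rewrite mul1r.
by move=> a p; rewrite mul1r; exact: qv.
Qed.

Lemma energy_row : row_cvg d (fun n k => \sum_(r < k) (dS n r j1 ^+ 2 + dS n r j2 ^+ 2))
  (fun t => 2 * t).
Proof.
have := row_cvgD (qv_row j1) (qv_row j2); apply: eq_row_cvg => // [n k|t _].
  by rewrite big_split.
by rewrite mulr2n mulrDl mul1r.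
Qed.

(** Sums of products are not monotone; by polarization they are combinations of
sums of squares, which are. *)
Lemma cov_row : row_cvg d (fun n k => \sum_(r < k) dS n r j1 * dS n r j2) (fun=> 0).
Proof.
have H : row_cvg d (fun n k => \sum_(r < k) (dS n r j1 + dS n r j2) ^+ 2) (fun t => 2 * t).
  refine (@row_cvg_monotone R (fun n r => (dS n r j1 + dS n r j2) ^+ 2) 2 (fun n r => sqr_ge0 _) _).
  move=> a p.
  have h := cvgD (cvgD (@qv j1 a p) (@qv j2 a p)) (cvgM (@cov a p) (cvg_cst (2 : R))).
  have -> : 2 * (a%:R * d p) = a%:R * d p + a%:R * d p + 0 * 2 :> R by ring.
  rewrite [X in X @ _](_ : _ = (fun n => \sum_(r < a * 2 ^ (n - p)) dS n r j1 ^+ 2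
      + \sum_(r < a * 2 ^ (n - p)) dS n r j2 ^+ 2
      + (\sum_(r < a * 2 ^ (n - p)) dS n r j1 * dS n r j2) * 2)); first exact: h.
  apply/funext => n.
  by rewrite mulr_suml -!big_split/=; apply: eq_bigr => r _; rewrite sqrrD mulr_natr addrAC.
have := row_cvgZ 2^-1 (row_cvgB d_gt0 H energy_row).
apply: eq_row_cvg => // [n k|t _]; last by rewrite subrr mulr0.
by rewrite -sumrB mulr_sumr; apply: eq_bigr => r _; field.
Qed.

(** The total energy stays bounded, so errors of the form e * energy vanish. *)
Lemma energy_small (a c : nat -> nat -> R) (A : R -> R) :
  row_cvg d a A ->
  (forall K e : R, 0 < e -> \forall n \near \oo, forall k, k%:R * d n <= K ->
    `|c n k - a n k| <= e * \sum_(r < k) (dS n r j1 ^+ 2 + dS n r j2 ^+ 2)) ->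
  row_cvg d c A.
Proof.
move=> aA H K e e0; have e2 : 0 < e / 2 by rewrite divr_gt0.
have u2 : modulus_on (fun t : R => 2 * t) := modulusZ 2 (@modulus_id R).
have [C C0 HC] := row_cvg_bound K u2 energy_row.
have := H K (e / 2 / C) (divr_gt0 e2 C0).
have := aA K _ e2; move: HC; apply: filterS3 => n h1 h2 h3 k kK.
rewrite -(subrK (a n k) (c n k)) -addrA (le_trans (ler_normD _ _))// [leRHS]splitr.
rewrite lerD ?h2// (le_trans (h3 k kK))//.
rewrite mulrAC ler_pdivrMr// ler_wpM2l ?(ltW e2)//.
exact: le_trans (ler_norm _) (h1 k kK).
Qed.

Lemma mid_correction (K e : R) : 0 < e -> \forall n \near \oo, forall k, k%:R * d n <= K ->
  `|mart_sum d S phi y n k - ito_sum n k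
    - \sum_(r < k) hess_sum d S phi y j1 j2 n r * (dS n r j1 * dS n r j2)|
  <= e * \sum_(r < k) (dS n r j1 ^+ 2 + dS n r j2 ^+ 2).
Proof.
move=> e0.
have [C C0 SC] := walk_bound d_gt0 b_modulus S_cvg K.
have K1 : 0 < `|K| + 1 by rewrite ltr_wpDl.
have [q q0 Hq] := ito_step (C + C + `|y|) phiC2 (divr_gt0 e0 K1).
move: SC (small_steps d_gt0 d_cvg0 b_modulus S_cvg K q0); apply: filterS2 => n SC Hs k kK.
have -> := @mart_regroup R k (d n)
  (fun r j => partial j1 phi (S n r - S n j - y))
  (fun r j => partial j2 phi (S n r - S n j - y))
  (fun r j => partial j2 phi (vec (S n r.+1 0 j1) (S n r 0 j2) - S n j - y))
  (fun r j => partial j1 (partial j2 phi) (S n r - S n j - y))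
  (fun r => dS n r j1) (fun r => dS n r j2).
rewrite mulr_sumr (le_trans (ler_norm_sum _ _ _))// ler_sum// => r _.
rewrite (le_trans (ler_norm_sum _ _ _))//.
have rK : r.+1%:R * d n <= K by apply: (kd_le d_gt0 _ kK); exact: ltn_ord.
have hd j : `|dS n r j| < q.
  have -> : dS n r j = (S n r.+1 - S n r) 0 j by rewrite !mxE.
  by rewrite (le_lt_trans (coord_le_norm _ _))// Hs.
set A := _ ^+ 2 + _ ^+ 2.
have A0 : 0 <= A by rewrite addr_ge0 ?sqr_ge0.
apply: (@le_trans _ _ (\sum_(j < r.+1) (e / (`|K| + 1) * A * d n))).
  apply: ler_sum => j _; rewrite normrM (ger0_norm (ltW (d_gt0 n))) ler_wpM2r ?(ltW (d_gt0 n))//.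
  have -> : vec (S n r.+1 0 j1) (S n r 0 j2) - S n j - y =
      S n r - S n j - y + dS n r j1 *: unit_vec R j1.
    by apply: rV2P; rewrite !planeE; ring.
  have xM : `|S n r - S n j - y| <= C + C + `|y|.
    rewrite (le_trans (ler_normB _ _))// lerD2r (le_trans (ler_normB _ _))//.
    rewrite lerD// SC//; apply: (kd_le d_gt0 _ kK); first by rewrite ltnW.
    exact: leq_trans (ltnW (ltn_ord j)) (ltn_ord r).
  have [_ h] := Hq _ _ _ xM (hd j1) (hd j2).
  rewrite normrM (le_trans (ler_wpM2r (normr_ge0 _) h))// -(mulrA (e / _)).
  have eK0 : 0 <= e / (`|K| + 1) by rewrite divr_ge0// ltW.
  rewrite ler_wpM2l//.
  by rewrite -normrM; exact: norm_mul_le_energy.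
have E : e / (`|K| + 1) * A * d n *+ r.+1 = e * A * (r.+1%:R * d n / (`|K| + 1)).
  by rewrite -[LHS]mulr_natr; ring.
rewrite sumr_const card_ord E ler_piMr ?mulr_ge0// ?(ltW e0)//.
rewrite ler_pdivrMr// mul1r (le_trans rK)// (le_trans (ler_norm _))// lerDl//.
Qed.

Let lhs t := \int[mu]_(u in `[0, t]) phi (b t - b u - y).
Let Lphi t := \int[mu]_(v in `[0, t]) \int[mu]_(u in `[0, v]) laplacian phi (b v - b u - y).
Let H i j t := \int[mu]_(u in `[0, t]) partial i (partial j phi) (b t - b u - y).

Lemma hess_row i j : row_cvg d (hess_sum d S phi y i j) (H i j).
Proof.
exact (row_cvg_sumS d_gt0 d_cvg0 (field_modulus2 y b_modulus (@cHphi i j))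
  (field_array y d_gt0 b_modulus S_cvg (@cHphi i j))).
Qed.

Lemma hess_modulus i j : modulus_on (H i j).
Proof. exact: modulus_Rintegral (field_modulus2 y b_modulus (@cHphi i j)). Qed.

Lemma laplacian_split t : 0 <= t ->
  Lphi t = \int[mu]_(v in `[0, t]) H j1 j1 v + \int[mu]_(v in `[0, t]) H j2 j2 v.
Proof.
move=> t0.
have cL := laplacian_continuous phiC2.
have mL := field_modulus2 y b_modulus cL.
have m2 := field_modulus2 y b_modulus (@cHphi j2 j2).
have uL : modulus_on (fun v => \int[mu]_(u in `[0, v]) laplacian phi (b v - b u - y)).
  exact: modulus_Rintegral mL.
rewrite -[LHS](subrK (\int[mu]_(v in `[0, t]) H j2 j2 v)); congr (_ + _).
rewrite /Lphi -Rintegral0B//; last exact: hess_modulus.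
apply: eq_Rintegral => v; rewrite inE/= in_itv/= => /andP[v0 _].
rewrite /H -(Rintegral0B2 v0 mL m2); apply: eq_Rintegral => u _.
by rewrite /laplacian addrK.
Qed.

(** The discrete Ito formula, with the quadratic variation in place of the
squares h^2, and then the change from the corner rule to the left-point rule,
whose correction is a weighted covariation and tends to 0. *)
Lemma dyadic_ito : row_cvg d ito_sum (fun t => lhs t - t * phi (- y) - 2^-1 * Lphi t).
Proof.
have HT : row_cvg d (tanaka_sum d S phi y) (fun t => lhs t - t * phi (- y)).
  have m2c : modulus2_on (fun _ _ : R => phi (- y)) by exact: modulus2_on_snd (modulus_cst _).
  have m2p := field_modulus2 y b_modulus cphi.
  have := row_cvg_sumS d_gt0 d_cvg0 (modulus2B m2p m2c)
    (array_cvgB (field_array y d_gt0 b_modulus S_cvg cphi)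
       (row_cvg_array d_gt0 (row_cvg_cst d (phi (- y))))).
  apply: eq_row_cvg => // t t0.
  by rewrite -(Rintegral0_cst (phi (- y)) t0) -(Rintegral0B2 t0 m2p m2c).
have HQ j : row_cvg d (fun n k => \sum_(r < k) hess_sum d S phi y j j n r * dS n r j ^+ 2)
    (fun t => 1 * \int[mu]_(u in `[0, t]) H j j u).
  refine (@row_cvg_weighted R (hess_sum d S phi y j j) (fun n r => dS n r j ^+ 2) (fun n r => dS n r j ^+ 2) (H j j) 1 1 _ _ _ _ _).
  - exact: hess_modulus.
  - exact (@hess_row _ _).
  - by refine (eq_row_cvg d_gt0 _ _ (qv_row j)) => // t _; rewrite mul1r.
  - by move=> n r; rewrite ger0_norm ?sqr_ge0.
  - by refine (eq_row_cvg d_gt0 _ _ (qv_row j)) => // t _; rewrite mul1r.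
have HC : row_cvg d (fun n k => \sum_(r < k) hess_sum d S phi y j1 j2 n r * (dS n r j1 * dS n r j2))
    (fun t => 0 * \int[mu]_(u in `[0, t]) H j1 j2 u).
  refine (@row_cvg_weighted R (hess_sum d S phi y j1 j2) (fun n r => dS n r j1 * dS n r j2) (fun n r => dS n r j1 ^+ 2 + dS n r j2 ^+ 2) (H j1 j2) 0 2 _ _ _ _ _).
  - exact: hess_modulus.
  - exact (@hess_row _ _).
  - by refine (eq_row_cvg d_gt0 _ _ cov_row) => // t _; rewrite mul0r.
  - by move=> n r; exact: norm_mul_le_energy.
  - exact energy_row.
have HL : row_cvg d (fun n k => 2^-1 *
     (\sum_(r < k) hess_sum d S phi y j1 j1 n r * dS n r j1 ^+ 2
      + \sum_(r < k) hess_sum d S phi y j2 j2 n r * dS n r j2 ^+ 2)) (fun t => 2^-1 * Lphi t).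
  refine (eq_row_cvg d_gt0 (fun _ _ => erefl) _ (row_cvgZ 2^-1 (row_cvgD (HQ j1) (HQ j2)))).
  by move=> t t0; congr (_ * _); rewrite (laplacian_split t0); congr (_ + _); exact: mul1r.
have HM : row_cvg d (mart_sum d S phi y) (fun t => lhs t - t * phi (- y) - 2^-1 * Lphi t).
  refine (energy_small (row_cvgB d_gt0 HT HL) _) => K e e0.
  have := discrete_ito y d_gt0 d_cvg0 b_modulus S_cvg phiC2 K e0.
  apply: filterS => n hn k kK; apply: le_trans (hn k kK).
  by rewrite distrC opprD addrA addrAC.
have HM' : row_cvg d (ito_sum) (fun t => lhs t - t * phi (- y) - 2^-1 * Lphi t
    - 0 * \int[mu]_(u in `[0, t]) H j1 j2 u).
  refine (energy_small (row_cvgB d_gt0 HM HC) _) => K e e0.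
  have := mid_correction K e0.
  apply: filterS => n hn k kK; apply: le_trans (hn k kK).
  by rewrite distrC addrAC.
refine (eq_row_cvg d_gt0 (fun _ _ => erefl) _ HM').
by move=> t t0; rewrite mul0r subr0.
Qed.

End DyadicIto.

(** * Elementary integrands *)

Section Clip.
Variable R : realType.
(** Elementary integrands have to be bounded; truncation keeps them adapted. *)
Definition clip (c x : R) : R := Num.max (- c) (Num.min x c).

Lemma clip_id (c x : R) : `|x| <= c -> clip c x = x.
Proof. by rewrite ler_norml => /andP[h1 h2]; rewrite /clip min_l// max_r. Qed.

Lemma clip_bound (c x : R) : 0 <= c -> `|clip c x| <= c.
Proof.
move=> c0; rewrite /clip ler_norml le_max lexx/= ge_max ge_min lexx orbT andbT.
by rewrite (le_trans _ c0)// oppr_le0.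
Qed.

(** Stopping at t keeps the full steps before t and one incomplete step. *)
Lemma telescope_min (xi : nat -> R) (f : R -> R) (d t : R) (N : nat) : 0 < d -> 0 <= t ->
  (Num.truncn (t / d) < N)%N ->
  \sum_(k < N) xi k * (f (Num.min (k.+1%:R * d) t) - f (Num.min (k%:R * d) t)) =
  \sum_(k < Num.truncn (t / d)) xi k * (f (k.+1%:R * d) - f (k%:R * d))
  + xi (Num.truncn (t / d)) * (f t - f ((Num.truncn (t / d))%:R * d)).
Proof.
move=> d0 t0; set k0 := Num.truncn _ => k0N.
have /andP[h1 h2] := truncn_itv (divr_ge0 t0 (ltW d0)); rewrite -/k0 in h1 h2.
have {}h1 : k0%:R * d <= t by rewrite -ler_pdivlMr.
have {}h2 : t < k0.+1%:R * d by rewrite -ltr_pdivrMr.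
have le_d (i j : nat) : (i <= j)%N -> i%:R * d <= j%:R * d.
  by move=> ij; rewrite ler_wpM2r ?(ltW d0)// ler_nat.
pose F k := xi k * (f (Num.min (k.+1%:R * d) t) - f (Num.min (k%:R * d) t)).
rewrite -(big_mkord xpredT F) (big_cat_nat (leq0n k0.+1) k0N)/= big_nat_recr//=.
rewrite [X in _ + X]big1_seq ?addr0.
  rewrite big_mkord; congr (_ + _).
    apply: eq_bigr => k _; have kk0 := ltn_ord k.
    rewrite /F !min_l//; first exact: le_trans (le_d _ _ (ltnW kk0)) h1.
    exact: le_trans (le_d _ _ kk0) h1.
  by rewrite /F (min_r (ltW h2)) (min_l h1).
move=> k; rewrite mem_index_iota => /andP[_ /andP[k0k _]].
rewrite /F !min_r ?subrr ?mulr0//; first exact: le_trans (ltW h2) (le_d _ _ k0k).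
exact: le_trans (ltW h2) (le_d _ _ (leqW k0k)).
Qed.

Lemma step_eval (xi : nat -> R) (d v : R) (N k : nat) : 0 < d -> (k < N)%N ->
  k%:R * d < v -> v <= k.+1%:R * d ->
  \sum_(j < N) xi j * \1_(`]j%:R * d, j.+1%:R * d]%classic) v = xi k.
Proof.
move=> d0 kN kv vk.
have lt_d (i j : nat) : i%:R * d < j%:R * d -> (i < j)%N by rewrite ltr_pM2r// ltr_nat.
rewrite (bigD1 (Ordinal kN))//= indicE mem_set/= ?in_itv/= ?kv ?vk// mulr1.
rewrite big1 ?addr0// => j jk; rewrite indicE memNset ?mulr0//= in_itv/= => /andP[j1 j2].
have kj := lt_d _ _ (lt_le_trans kv j2); have jk' := lt_d _ _ (lt_le_trans j1 vk).
case/eqP: jk; apply: val_inj => /=; apply/eqP.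
by rewrite eqn_leq -ltnS jk' -ltnS kj.
Qed.

Lemma ceil_index (d v : R) : 0 < d -> 0 < v ->
  exists k : nat, k%:R * d < v /\ v <= k.+1%:R * d.
Proof.
move=> d0 v0; have [N [HN /andP[N1 _]]] := strict_count (divr_ge0 (ltW v0) (ltW d0)).
case: N HN N1 => [|N] HN N1.
  by have := HN 0%N; rewrite divr_gt0.
exists N; rewrite -ltr_pdivlMr// HN ltnSn; split=> //.
by rewrite -ler_pdivrMr.
Qed.

End Clip.

Section SimpleApproximation.
Variable R : realType.
Notation mu := (@lebesgue_measure R).
Variables (b : R -> 'rV[R]_2) (phi : 'rV[R]_2 -> R) (y : 'rV[R]_2).
Local Notation d := (fun n : nat => 2 ^- n : R).
Let d_gt0 := @dyadic_gt0 R.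
Let d_cvg0 := @h_cvg0 R.
Local Notation G := (grad_sum b phi y).
Hypothesis b_modulus : modulus_on b.
Variables (I : R -> R).
Hypothesis I_modulus : modulus_on I.
Hypothesis I_cvg : row_cvg d (ito_sum b phi y) I.
Let H j t := \int[mu]_(u in `[0, t]) partial j phi (b t - b u - y).
Hypothesis cphi : forall j, continuous (partial j phi).

Lemma grad_modulus j : modulus_on (H j).
Proof. exact: modulus_Rintegral (field_modulus2 y b_modulus (@cphi j)). Qed.

Lemma grad_row j : row_cvg d (G j) (H j).
Proof.
have S_cvg (K e : R) : 0 < e -> \forall n \near \oo, forall k, k%:R * d n <= K ->
    `|b (k%:R * d n) - b (k%:R * d n)| <= e.
  by move=> e0; apply: nearW => n k _; rewrite subrr normr0 ltW.
exact (row_cvg_sumS d_gt0 d_cvg0 (field_modulus2 y b_modulus (@cphi j))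
  (field_array y d_gt0 b_modulus S_cvg (@cphi j))).
Qed.

Definition sample_value n j k := clip n%:R (G j n k).

Lemma sample_valueE (K : R) : \forall n \near \oo, forall j k, k%:R * d n <= K ->
  sample_value n j k = G j n k.
Proof.
apply: near_ord2 => j; have [C C0 HC] := row_cvg_bound K (grad_modulus j) (@grad_row j).
have : \forall n \near \oo, C <= n%:R by exact: nbhs_infty_ger.
move: HC; apply: filterS2 => n h1 h2 k kK.
by apply: clip_id; rewrite (le_trans (h1 k kK)).
Qed.

(** On ]k 2^-n, (k+1) 2^-n] the step process is the Riemann sum for the integrand
at the left endpoint. *)
Lemma sample_eval_cvg (K e : R) : 0 < e -> \forall n \near \oo, forall j v, 0 <= v <= K ->
  `|\sum_(k < n * 2 ^ n) sample_value n j k * \1_(`]k%:R * d n, k.+1%:R * d n]%classic) v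
    - H j v| <= e.
Proof.
move=> e0; have e2 : 0 < e / 2 by rewrite divr_gt0.
apply: near_ord2 => j; have [q q0 Hq] := grad_modulus j K e2.
have Hs := sample_valueE K; have Hg := @grad_row j K _ e2.
near=> n => v /andP[v0 vK].
have Hsn : forall j k, k%:R * d n <= K -> sample_value n j k = G j n k by near: n.
have Hgn : forall k, k%:R * d n <= K -> `|G j n k - H j (k%:R * d n)| <= e / 2 by near: n.
have dq : d n < q by near: n; exact: mesh_lt d_cvg0 q q0.
have Kn : K < n%:R by near: n; exact: nbhs_infty_gtr.
have dn := d_gt0 n.
have [v_eq0|] := eqVneq v 0.
  rewrite v_eq0 big1 => [|k _].
    by rewrite sub0r normrN /H set_itv1 Rintegral_set1 normr0 ltW.
  rewrite indicE memNset ?mulr0//= in_itv/= => /andP[+ _].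
  by rewrite ltNge mulr_ge0// ltW.
move=> vn0; have {}vn0 : 0 < v by rewrite lt_neqAle eq_sym vn0.
have [k [k1 k2]] := ceil_index dn vn0.
have kK : k%:R * d n <= K by rewrite (le_trans (ltW k1)).
have kN : (k < n * 2 ^ n)%N.
  rewrite -(ltr_nat R) natrM natrX -ltr_pdivrMr ?exprn_gt0//.
  exact: le_lt_trans kK Kn.
rewrite (step_eval _ dn kN k1 k2) Hsn//.
rewrite -(subrKA (H j (k%:R * d n))) (le_trans (ler_normD _ _))// [leRHS]splitr lerD// ?Hgn//.
apply/ltW/Hq; rewrite ?kK ?v0 ?vK ?mulr_ge0 ?(ltW dn)//.
rewrite distrC ger0_norm ?subr_ge0 ?(ltW k1)//.
by rewrite (le_lt_trans _ dq)// lerBlDl (le_trans k2)// -natr1 mulrDl mul1r.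
Unshelve. all: by end_near. Qed.

(** At grid points the integral is [ito_sum]; between grid points the incomplete
step is a bounded value times a small increment. *)
Lemma sample_integral_cvg (K e : R) : 0 < e -> \forall n \near \oo, forall t, 0 <= t <= K ->
  `|\sum_(j < 2) \sum_(k < n * 2 ^ n) sample_value n j k *
      (b (Num.min (k.+1%:R * d n) t) 0 j - b (Num.min (k%:R * d n) t) 0 j)
    - I t| <= e.
Proof.
move=> e0; have e2 : 0 < e / 2 by rewrite divr_gt0.
have e3 : 0 < e / 2 / 3 by rewrite divr_gt0.
have [q q0 Hq] := I_modulus K e3.
have [C1 C10 HC1] := row_cvg_bound K (grad_modulus j1) (@grad_row j1).
have [C2 C20 HC2] := row_cvg_bound K (grad_modulus j2) (@grad_row j2).
have C0 : 0 < C1 + C2 by rewrite addr_gt0.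
have eC : 0 < e / 2 / (C1 + C2) by rewrite divr_gt0.
have [q' q'0 Hq'] := b_modulus K eC.
have Hs := sample_valueE K; have HI := I_cvg K e3.
near=> n => t /andP[t0 tK].
have Hsn : forall j k, k%:R * d n <= K -> sample_value n j k = G j n k by near: n.
have HIn : forall k, k%:R * d n <= K -> `|ito_sum b phi y n k - I (k%:R * d n)| <= e / 2 / 3 by near: n.
have HC1n : forall k, k%:R * d n <= K -> `|G j1 n k| <= C1 by near: n.
have HC2n : forall k, k%:R * d n <= K -> `|G j2 n k| <= C2 by near: n.
have dq : d n < q by near: n; exact: mesh_lt d_cvg0 q q0.
have dq' : d n < q' by near: n; exact: mesh_lt d_cvg0 q' q'0.
have Kn : K < n%:R by near: n; exact: nbhs_infty_gtr.
have dn := d_gt0 n.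
set k0 := Num.truncn (t / d n).
have /andP[h1 h2] := truncn_itv (divr_ge0 t0 (ltW dn)); rewrite -/k0 in h1 h2.
have {}h1 : k0%:R * d n <= t by rewrite -ler_pdivlMr.
have {}h2 : t < k0.+1%:R * d n by rewrite -ltr_pdivrMr.
have k0K : k0%:R * d n <= K := le_trans h1 tK.
have k0N : (k0 < n * 2 ^ n)%N.
  rewrite -(ltr_nat R) natrM natrX -ltr_pdivrMr ?exprn_gt0//.
  exact: le_lt_trans k0K Kn.
have tk : `|t - k0%:R * d n| < Num.min q q'.
  rewrite ger0_norm ?subr_ge0// lt_min; move: h2; rewrite -natr1 mulrDl mul1r -ltrBlDl => h2.
  by rewrite (lt_trans h2 dq) (lt_trans h2 dq').
have E : \sum_(j < 2) \sum_(k < n * 2 ^ n) sample_value n j k *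
      (b (Num.min (k.+1%:R * d n) t) 0 j - b (Num.min (k%:R * d n) t) 0 j) =
    ito_sum b phi y n k0 + (G j1 n k0 * (b t 0 j1 - b (k0%:R * d n) 0 j1)
       + G j2 n k0 * (b t 0 j2 - b (k0%:R * d n) 0 j2)).
  have T j : \sum_(k < n * 2 ^ n) sample_value n j k *
      (b (Num.min (k.+1%:R * d n) t) 0 j - b (Num.min (k%:R * d n) t) 0 j) =
     \sum_(k < k0) G j n k * (b (k.+1%:R * d n) 0 j - b (k%:R * d n) 0 j)
     + G j n k0 * (b t 0 j - b (k0%:R * d n) 0 j).
    rewrite (telescope_min (sample_value n j) (fun t => b t 0 j) dn t0 k0N) -/k0.
    rewrite Hsn//; congr (_ + _); apply: eq_bigr => k _.
    by rewrite Hsn// (kd_le d_gt0 (ltnW (ltn_ord k))).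
  rewrite big_ord_recl big_ord1 -/j1 (_ : lift _ _ = j2) ?T; last exact: val_inj.
  by rewrite addrACA -big_split.
rewrite E.
have k00 : 0 <= k0%:R * d n by rewrite mulr_ge0// ltW.
move: tk; rewrite lt_min => /andP[tkq tkq'].
have hb j : `|b t 0 j - b (k0%:R * d n) 0 j| <= e / 2 / (C1 + C2).
  rewrite -coordB (le_trans (coord_le_norm _ _))// ltW// Hq'// ?t0 ?tK ?k00 ?k0K//.
have hI : `|I (k0%:R * d n) - I t| < e / 2 / 3.
  by rewrite distrC Hq// ?t0 ?tK ?k00 ?k0K.
have hG : `|G j1 n k0 * (b t 0 j1 - b (k0%:R * d n) 0 j1)
       + G j2 n k0 * (b t 0 j2 - b (k0%:R * d n) 0 j2)| <= e / 2.
  have -> : e / 2 = C1 * (e / 2 / (C1 + C2)) + C2 * (e / 2 / (C1 + C2)).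
    by rewrite -mulrDl [RHS]mulrC divfK// gt_eqF.
  by rewrite (le_trans (ler_normD _ _))// lerD// normrM ler_pM ?HC1n ?HC2n.
have hT : `|ito_sum b phi y n k0 - I t| <= e / 2.
  by apply: (@dist3 _ _ (I (k0%:R * d n)) _ (I t)); rewrite ?HIn// subrr normr0 ltW.
rewrite addrAC (le_trans (ler_normD _ _))// [leRHS]splitr lerD//.
Unshelve. all: by end_near. Qed.

End SimpleApproximation.

(** * Counting Skorohod times from samples *)

Section Tracker.
Variable R : realType.

(** A sampled substitute for the last level hit by the path: it jumps as soon as
the sampled path comes eta-close to the next level.  Being a function of the
past samples, it is adapted, and no stopping time is involved. *)
Fixpoint tracker (h eta : R) (v : nat -> R) (i : nat) : R :=
  match i with
  | 0%N => 0
  | i'.+1 => let L := tracker h eta v i' in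
      if h - eta <= `|v i'.+1 - L| then L + h * Num.sg (v i'.+1 - L) else L
  end.

(** The clipping is inactive along the paths of interest; it serves to make the
integrand bounded by h on the whole probability space. *)
Definition tracker_sum (h eta : R) (v : nat -> R) (M : nat) : R :=
  \sum_(i < M) clip h (v i - tracker h eta v i) * (v i.+1 - v i).

Variables (w : R -> R) (h : R).
Hypothesis w_modulus : modulus_on w.
Hypothesis w0 : w 0 = 0.
Hypothesis h_gt0 : 0 < h.
Local Notation s := (skorohod_time w h).
Local Notation d := (fun n : nat => 2 ^- n : R).

(** Compactness of [a, c]. *)
Lemma strict_below (a c l : R) : 0 <= a -> (forall u, a <= u <= c -> `|w u - l| < h) ->
  exists2 eta, 0 < eta & forall u, a <= u <= c -> `|w u - l| < h - eta.
Proof.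
move=> a0 H; have [ac|ca] := leP a c; last first.
  by exists 1 => // u /andP[/le_trans h1 /h1]; rewrite leNgt ca.
have mf : modulus_on (fun v => `|w v - l|).
  move=> K e e0; have [q q0 Hq] := w_modulus K e0; exists q => // v v' vK v'K vv'.
  apply: le_lt_trans (Hq _ _ vK v'K vv').
  by rewrite (le_trans (ler_dist_dist _ _))// opprB addrA subrK.
have cf : {within `[a, c], continuous (fun v => `|w v - l|)}.
  apply: continuous_subspaceW (modulus_within (K := c) mf).
  by apply: subset_itvr; rewrite bnd_simp.
have [x xac Hx] := EVT_max ac cf.
rewrite in_itv/= in xac; have Hxh := H x xac.
exists ((h - `|w x - l|) / 2); first by rewrite divr_gt0// subr_gt0.
move=> u uac; have := Hx u; rewrite in_itv/= => /(_ uac).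
move: (`|w u - l|) (`|w x - l|) Hxh => p q; lra.
Qed.

Lemma finite_min (N : nat) (Q : nat -> R -> Prop) :
  (forall k e e', Q k e -> 0 < e' -> e' <= e -> Q k e') ->
  (forall k, (k < N)%N -> exists2 e, 0 < e & Q k e) ->
  exists2 e, 0 < e & forall k, (k < N)%N -> Q k e.
Proof.
move=> Qm; elim: N => [|N IH] H; first by exists 1.
have [k kN|e e0 He] := IH; first by apply: H; exact: ltnW.
have [e' e'0 He'] := H N (ltnSn N).
have m0 : 0 < Num.min e e' by rewrite lt_min e0.
exists (Num.min e e') => // k; rewrite ltnS leq_eqVlt => /orP[/eqP ->|kN].
  by apply: Qm He' _ _; rewrite // ge_min lexx orbT.
by apply: Qm (He k kN) _ _; rewrite // ge_min lexx.
Qed.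

Section Jump.
Variables (L L' x x' eta : R).

(** (x' - L)^2 = (x - L)^2 + 2 (x - L) (x' - x) + (x' - x)^2. *)
Lemma no_jump_identity (A k : R) :
  `|A - (k * h ^+ 2 + (x - L) ^+ 2)| <= k * (2 * h * eta) ->
  `|A + (2 * ((x - L) * (x' - x)) + (x' - x) ^+ 2) - (k * h ^+ 2 + (x' - L) ^+ 2)|
    <= k * (2 * h * eta).
Proof. by move=> H; rewrite [X in `|X|](_ : _ = A - (k * h ^+ 2 + (x - L) ^+ 2))//; ring. Qed.

(** (x' - L)^2 = h^2 + 2 h sg (x' - L') + (x' - L')^2, where |x' - L'| <= eta: the
count increases by one and the error by 2 h eta. *)
Lemma jump_identity (A k sg : R) : sg ^+ 2 = 1 -> L' = L + h * sg ->
  `|x' - L'| <= eta ->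
  `|A - (k * h ^+ 2 + (x - L) ^+ 2)| <= k * (2 * h * eta) ->
  `|A + (2 * ((x - L) * (x' - x)) + (x' - x) ^+ 2) - ((k + 1) * h ^+ 2 + (x' - L') ^+ 2)|
    <= (k + 1) * (2 * h * eta).
Proof.
move=> sg2 E x'L H.
have -> : A + (2 * ((x - L) * (x' - x)) + (x' - x) ^+ 2) - ((k + 1) * h ^+ 2 + (x' - L') ^+ 2)
  = (A - (k * h ^+ 2 + (x - L) ^+ 2)) + 2 * h * (sg * (x' - L')).
  have -> : L = L' - h * sg by rewrite E addrK.
  have -> : (k + 1) * h ^+ 2 = k * h ^+ 2 + h ^+ 2 * sg ^+ 2 by rewrite sg2; ring.
  by ring.
rewrite (le_trans (ler_normD _ _))// [leRHS]mulrDl [1 * _]mul1r lerD// normrM.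
rewrite gtr0_norm ?mulr_gt0// ler_wpM2l ?mulr_ge0 ?(ltW h_gt0)//.
suff -> : `|sg * (x' - L')| = `|x' - L'| by [].
have : `|sg| ^+ 2 = 1 by rewrite real_normK ?num_real.
by move=> /eqP; rewrite sqrf_eq1 => /orP[|]/eqP E1; rewrite normrM E1 ?mul1r//;
  have := normr_ge0 sg; rewrite E1 ler0N1.
Qed.

End Jump.

Lemma sign_of_jump (D x : R) : `|D| = h -> `|x| < h / 4 -> h * Num.sg (D + x) = D.
Proof.
move=> /eqP; rewrite eqr_norml => /andP[/orP[]/eqP -> _]; rewrite ltr_norml => /andP[x1 x2].
  by rewrite gtr0_sg ?mulr1//; lra.
by rewrite ltr0_sg ?mulrN1//; lra.
Qed.

Lemma overshoot (D x eta : R) : `|D| = h -> `|x| < h / 4 ->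
  h - eta <= `|D + x| -> `|D + x| <= h -> `|x| <= eta.
Proof.
move=> /eqP; rewrite eqr_norml => /andP[/orP[]/eqP -> _]; rewrite ltr_norml => /andP[x1 x2].
  by rewrite gtr0_norm ?ler_norml; [move=> *; apply/andP; split; lra|lra].
by rewrite ltr0_norm ?ler_norml; [move=> *; apply/andP; split; lra|lra].
Qed.

Lemma far_from_old (D x eta : R) : `|D| = h -> `|x| < eta -> h - eta <= `|D + x|.
Proof.
move=> <- xe; have := ler_normB (D + x) x; rewrite addrK; move: (`|D + x|) (`|x|) xe => u v; lra.
Qed.

Section TrackerInvariant.
Variables (T g sigma eta q dt : R) (N M : nat).
Hypotheses (ok : hits_upto w h N) (g0 : 0 < g) (sg : sigma * 2 = g)
  (eta0 : 0 < eta) (eta4 : eta <= h / 4) (dt0 : 0 < dt) (dtq : dt < q) (dts : dt < sigma)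
  (MT : M%:R * dt = T).
Hypothesis Hg : forall u v, 0 <= u <= T -> 0 <= v <= T -> `|u - v| < g -> `|w u - w v| < h / 4.
Hypothesis Hq : forall u v, 0 <= u <= T -> 0 <= v <= T -> `|u - v| < q -> `|w u - w v| < eta.
Hypothesis Hinside : forall k, (k < N)%N -> forall u, s k <= u <= s k.+1 - sigma ->
  `|w u - w (s k)| < h - eta.
Hypothesis HN : s N <= T /\ forall u, s N <= u <= T -> `|w u - w (s N)| < h - eta.
Let t (i : nat) := i%:R * dt.
Let v i := w (t i).
Let L := tracker h eta v.
Let A i := 2 * tracker_sum h eta v i + \sum_(j < i) (v j.+1 - v j) ^+ 2.

(** The tracker sits at the k-th level hit.  It may have jumped early, by at
most sigma, but no Skorohod time is missed.  The last clause is the discrete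
form of 2 int (w - L) dw + [w] = k h^2 + (w - L)^2, with an error of 2 h eta for
each jump. *)
Definition tracked (i k : nat) : Prop :=
  [/\ L i = w (s k), s k - sigma <= t i, (k < N)%N -> t i < s k.+1,
      `|v i - L i| <= h - eta &
      `|A i - (k%:R * h ^+ 2 + (v i - L i) ^+ 2)| <= k%:R * (2 * h * eta)].

Let sigma0 : 0 < sigma. Proof. by move: g0; rewrite -sg pmulr_lgt0. Qed.
Let sigma_g : sigma < g. Proof. by rewrite -sg ltr_pMr// ltr1n. Qed.

Let s_range k : (k <= N)%N -> 0 <= s k <= T.
Proof.
move=> kN; rewrite skorohod_ge0//=.
by case: HN => h1 _; apply: le_trans h1; apply: (skorohod_homo w_modulus h_gt0 ok kN).
Qed.

Let t_range i : (i <= M)%N -> 0 <= t i <= T.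
Proof. by move=> iM; rewrite mulr_ge0 ?(ltW dt0)//= -MT ler_wpM2r ?(ltW dt0)// ler_nat. Qed.

Let tS i : t i.+1 = t i + dt. Proof. by rewrite /t -natr1 mulrDl mul1r. Qed.

Let before k i : (k <= N)%N -> (i < M)%N -> s k - sigma <= t i -> t i.+1 < s k ->
  `|v i.+1 - w (s k)| < h - eta.
Proof.
move=> kN iM h1 h2.
have : `|v i.+1 - w (s k)| < h / 4.
  apply: Hg; rewrite ?t_range ?s_range//.
  rewrite distrC gtr0_norm ?subr_gt0//; apply: le_lt_trans sigma_g.
  by move: h1 dt0; rewrite tS; lra.
by move/lt_le_trans; apply; move: eta4 h_gt0; lra.
Qed.

Let level_step k : (k < N)%N -> `|w (s k.+1) - w (s k)| = h.
Proof. by move=> kN; have [_] := skorohod_hit w_modulus h_gt0 ok kN. Qed.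

(** A jump happens exactly when the path is about to hit, or has just hit, the
next level: sigma excludes jumps far before the hitting time and eta < h/4 with
the modulus of continuity makes the sign of the jump right. *)
Lemma tracked_step i k : (i < M)%N -> (k <= N)%N -> tracked i k ->
  exists2 k', (k' <= N)%N & tracked i.+1 k'.
Proof.
move=> iM kN [EL sk tk wL HA].
have Gi : clip h (v i - L i) = v i - L i.
  by apply: clip_id; rewrite (le_trans wL)// gerBl ltW.
have AS : A i.+1 = A i + (2 * ((v i - L i) * (v i.+1 - v i)) + (v i.+1 - v i) ^+ 2).
  rewrite /A /tracker_sum !big_ord_recr/= -/(L i) Gi; ring.
have LS : L i.+1 = if h - eta <= `|v i.+1 - L i| then L i + h * Num.sg (v i.+1 - L i) else L i.
  by [].
have tT := t_range iM; have tiT := t_range (ltnW iM).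
move: LS; case: ifPn => hj LS; last first.
  rewrite -ltNge in hj.
  exists k => //; split; rewrite ?LS//.
  - by rewrite (le_trans sk)// tS lerDl ltW.
  - move=> kN'; rewrite ltNge; apply/negP => h1; move: hj; apply/negP; rewrite -leNgt EL.
    have -> : v i.+1 - w (s k) = (w (s k.+1) - w (s k)) + (v i.+1 - w (s k.+1)).
      by rewrite [RHS]addrC subrKA.
    apply: far_from_old; first exact: level_step.
    apply: Hq; rewrite ?s_range//.
    rewrite ger0_norm ?subr_ge0//; apply: le_lt_trans dtq.
    by move: (tk kN'); rewrite tS; move=> ?; lra.
  - exact: ltW.
  - by rewrite AS; exact: no_jump_identity.
rewrite EL in hj LS.
have kN' : (k < N)%N.
  rewrite ltn_neqAle kN andbT; apply/eqP => kE.
  move: hj; apply/negP; rewrite -ltNge.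
  have [h1|h1] := leP (s k) (t i.+1); last exact: before.
  by case: HN => _; rewrite -kE; apply; rewrite h1; case/andP: tT.
have tk' := tk kN'.
(* the jump takes place within sigma of the next Skorohod time *)
have h_late : t i.+1 < s k.+1 + sigma by rewrite tS ltrD.
have h_notold : s k <= t i.+1.
  by rewrite leNgt; apply/negP => h1; move: hj; apply/negP; rewrite -ltNge; exact: before.
have h_early : s k.+1 - sigma < t i.+1.
  rewrite ltNge; apply/negP => h1; move: hj; apply/negP; rewrite -ltNge.
  by apply: Hinside; rewrite ?h_notold.
have x4 : `|v i.+1 - w (s k.+1)| < h / 4.
  apply: Hg; rewrite ?s_range//; apply: lt_trans sigma_g.
  by rewrite ltr_norml; apply/andP; split; lra.
have E : v i.+1 - w (s k) = (w (s k.+1) - w (s k)) + (v i.+1 - w (s k.+1)).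
  by rewrite [RHS]addrC subrKA.
have LE : L i.+1 = w (s k.+1).
  by rewrite LS E (sign_of_jump (level_step kN') x4) addrC subrK.
have x_eta : `|v i.+1 - w (s k.+1)| <= eta.
  have [h1|h1] := leP (s k.+1) (t i.+1).
    apply/ltW/Hq; rewrite ?s_range//.
    rewrite ger0_norm ?subr_ge0//; apply: le_lt_trans dtq.
    by rewrite tS; lra.
  apply: overshoot (level_step kN') x4 _ _; rewrite -E//.
  apply/ltW; rewrite /v; apply: (skorohod_inside w_modulus h_gt0 ok kN').
  by rewrite h_notold h1.
exists k.+1 => //; split; rewrite ?LE//.
- exact: ltW.
- move=> k1N; apply: (lt_trans h_late); rewrite ltNge; apply/negP => h1.
  have [h2 h3] := skorohod_hit w_modulus h_gt0 ok k1N.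
  have := @Hg (s k.+2) (s k.+1); rewrite !s_range// h3 ger0_norm ?subr_ge0 ?(ltW h2)//.
  have -> : s k.+2 - s k.+1 < g by apply: le_lt_trans sigma_g; rewrite lerBlDl.
  by move=> /(_ isT isT isT); move: h_gt0; lra.
- by rewrite (le_trans (ltW x4))//; move: eta4 h_gt0; lra.
- have sg2 : Num.sg (v i.+1 - w (s k)) ^+ 2 = 1.
    rewrite sqr_sg; case: eqP => // E0; move: hj; rewrite E0 normr0; move: eta4 h_gt0 eta0; lra.
  rewrite AS -(natr1 k).
  apply: (@jump_identity (L i) (w (s k.+1)) (v i) (v i.+1) eta (A i) k%:R _ sg2 _ x_eta HA).
  by rewrite -LE LS EL.
Qed.

Lemma tracked_all i : (i <= M)%N -> exists2 k, (k <= N)%N & tracked i k.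
Proof.
elim: i => [_|i IH iM]; last by have [k kN] := IH (ltnW iM); exact: tracked_step.
have v0 : v 0 = 0 by rewrite /v /t mul0r.
have L0 : L 0 = 0 by [].
have s0 : s 0 = 0 by [].
exists 0%N => //; split.
- by rewrite L0 s0 w0.
- by rewrite s0 /t mul0r sub0r oppr_le0 ltW.
- by move=> N0; rewrite /t mul0r -[X in X < _]s0; have [] := skorohod_hit w_modulus h_gt0 ok N0.
- by rewrite v0 L0 subrr normr0; move: eta4 h_gt0; lra.
- have -> : A 0 = 0 by rewrite /A /tracker_sum !big_ord0 mulr0 addr0.
  by rewrite v0 L0 subrr expr0n/= !mul0r addr0 subrr normr0.
Qed.

Lemma tracker_final :
  `|A M - (N%:R * h ^+ 2 + (w T - w (s N)) ^+ 2)| <= N%:R * (2 * h * eta).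
Proof.
have [k kN [EL _ tk _]] := tracked_all (leqnn M).
have -> : N = k.
  apply/eqP; rewrite eqn_leq kN andbT leqNgt; apply/negP => kN'.
  have := tk kN'; rewrite /t MT ltNge => /negP; apply.
  by have /andP[] := s_range kN'.
by rewrite /v /t MT -/t -/v EL.
Qed.

End TrackerInvariant.

(** Here eta is chosen first and the grid is refined afterwards; the quadratic
variation then replaces the sum of squares by the elapsed time. *)
Lemma tracker_cvg (a p N : nat) (e : R) : 0 < e -> crossings w h (a%:R * d p) N ->
  (fun n => \sum_(r < a * 2 ^ (n - p)) (w (r.+1%:R * d n) - w (r%:R * d n)) ^+ 2) @ \oo
    --> a%:R * d p ->
  exists2 eta0 : R, 0 < eta0 & forall eta, 0 < eta -> eta <= eta0 -> \forall n \near \oo,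
    `|2 * tracker_sum h eta (fun i => w (i%:R * d n)) (a * 2 ^ (n - p))
      - (N%:R * h ^+ 2 + (w (a%:R * d p) - w (s N)) ^+ 2 - a%:R * d p)| <= e.
Proof.
set T := a%:R * d p => e0 [ok sT HT] qv.
have h4 : 0 < h / 4 by rewrite divr_gt0.
have [g g0 Hg] := w_modulus T h4.
pose sigma := g / 2; have sg : sigma * 2 = g by rewrite /sigma divfK.
have sigma0 : 0 < sigma by rewrite divr_gt0.
have e2 : 0 < e / 2 by rewrite divr_gt0.
have [eta1 eta10 H1] : exists2 eta, 0 < eta & forall k, (k < N)%N ->
    forall u, s k <= u <= s k.+1 - sigma -> `|w u - w (s k)| < h - eta.
  apply: finite_min => [k x x' Hx x'0 x'x u uk|k kN].
    by rewrite (lt_le_trans (Hx u uk))// lerB.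
  apply: strict_below; first exact: skorohod_ge0.
  move=> u /andP[u1 u2]; apply: (skorohod_inside w_modulus h_gt0 ok kN); rewrite u1/=.
  by rewrite (le_lt_trans u2)// ltrBlDr ltrDl.
have [eta2 eta20 H2] := strict_below (skorohod_ge0 w_modulus h_gt0 N) HT.
have B0 : 0 < 2 * h * N%:R + 1 by rewrite ltr_wpDl// !mulr_ge0// ltW.
have eta30 : 0 < e / 2 / (2 * h * N%:R + 1) by rewrite divr_gt0.
(* below the distance to the next level that the path keeps in the interior of
   each excursion (eta1, eta2), below h / 4 so that the direction of a jump is
   read off correctly, and such that N jumps cost at most e / 2 *)
exists (Num.min (Num.min eta1 eta2) (Num.min (h / 4) (e / 2 / (2 * h * N%:R + 1)))).
  by rewrite !lt_min eta10 eta20 h4 eta30.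
move=> eta eta0; rewrite !le_min => /andP[/andP[le1 le2] /andP[le3 le4]].
have [q q0 Hq] := w_modulus T eta0.
near=> n.
have pn : (p <= n)%N by near: n; exact: nbhs_infty_ge.
have dq : d n < q by near: n; exact: mesh_lt (@h_cvg0 R) q q0.
have ds : d n < sigma by near: n; exact: mesh_lt (@h_cvg0 R) sigma sigma0.
have Hqv : `|T - \sum_(r < a * 2 ^ (n - p)) (w (r.+1%:R * d n) - w (r%:R * d n)) ^+ 2| <= e / 2.
  by near: n; move/cvgrPdist_le : qv => /(_ _ e2).
have := @tracker_final T g sigma eta q (d n) N (a * 2 ^ (n - p)) ok g0 sg eta0 le3 (dyadic_gt0 R n) dq ds
  (dyadic_pow R a pn) Hg Hq.
move=> /(_ (fun k kN u uk => lt_le_trans (H1 k kN u uk) (lerB (lexx h) le1))).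
move=> /(_ (conj sT (fun u uk => lt_le_trans (H2 u uk) (lerB (lexx h) le2)))).
have le5 : N%:R * (2 * h * eta) <= e / 2.
  have -> : N%:R * (2 * h * eta) = eta * (2 * h * N%:R) by ring.
  apply: (@le_trans _ _ (eta * (2 * h * N%:R + 1))).
    by rewrite ler_wpM2l ?(ltW eta0)// lerDl.
  by rewrite -ler_pdivlMr.
move: Hqv le5.
move: (tracker_sum _ _ _ _) (\sum_(_ < _) _) (_ ^+ 2) (N%:R * (2 * h * eta)) (N%:R * h ^+ 2) => Z Q x y z.
rewrite !ler_norml => /andP[? ?] ? /andP[? ?]; apply/andP; split; lra.
Unshelve. all: by end_near. Qed.

End Tracker.

(** * Moments of the normal law *)

Section GaussianMoments.
Variable R : realType.
Notation mu := (@lebesgue_measure R).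

Lemma ge0_integral_normal_prob (m s : R) (f : R -> \bar R) :
  measurable_fun setT f -> (forall x, (0 <= f x)%E) ->
  (\int[normal_prob m s]_x f x = \int[mu]_x (f x * (normal_pdf m s x)%:E))%E.
Proof.
move=> mf f0; have dom := normal_prob_dominates m s.
rewrite -(Radon_Nikodym_SigmaFinite.change_of_variables dom f0 measurableT mf).
apply: ae_eq_integral => //.
- apply: emeasurable_funM => //; apply: (measurable_int mu).
  exact: Radon_Nikodym_SigmaFinite.f_integrable.
- apply: emeasurable_funM => //=; apply/measurableT_comp => //=.
  exact: measurable_normal_pdf.
- apply: ae_eqe_mul2l => /=; apply: integral_ae_eq => //=.
  + exact: Radon_Nikodym_SigmaFinite.f_integrable.
  + by apply/measurable_EFinP; exact: measurable_normal_pdf.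
  + by move=> E _ mE; rewrite -Radon_Nikodym_SigmaFinite.f_integral.
Qed.

(** The integrand times the centred density is the density with mean c. *)
Lemma exp_linear_normal (s c : R) : 0 < s ->
  (\int[normal_prob 0 s]_x (expR (c * x / s ^+ 2 - c ^+ 2 / (2 * s ^+ 2)))%:E = 1)%E.
Proof.
move=> s0; have sn0 : s != 0 by rewrite gt_eqF.
rewrite ge0_integral_normal_prob; last 2 first.
- apply/measurable_EFinP; apply: continuous_measurable_fun => x.
  apply: continuous_comp; last exact: continuous_expR.
  apply: cvgB; last exact: cvg_cst.
  by apply: cvgM; [apply: cvgM; [exact: cvg_cst|exact: cvg_id]|exact: cvg_cst].
- by move=> x; rewrite lee_fin expR_ge0.
rewrite -(integral_normal_pdf c s); apply: eq_integral => x _.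
rewrite -EFinM; congr EFin; rewrite !normal_pdfE// mulrCA; congr (_ * _).
rewrite /normal_fun -expRD; congr expR; field.
exact: sn0.
Qed.

(** The integrand times the density of deviation s is th times the density of
deviation th s. *)
Lemma exp_square_normal (s th : R) : 0 < s -> 0 < th ->
  (\int[normal_prob 0 s]_x (expR ((1 - th ^- 2) * x ^+ 2 / (2 * s ^+ 2)))%:E = th%:E)%E.
Proof.
move=> s0 th0; have sn0 : s != 0 by rewrite gt_eqF.
have tn0 : th != 0 by rewrite gt_eqF.
rewrite ge0_integral_normal_prob; last 2 first.
- apply/measurable_EFinP; apply: continuous_measurable_fun => x.
  apply: continuous_comp; last exact: continuous_expR.
  by apply: cvgM; [apply: cvgM; [exact: cvg_cst|exact: exprn_continuous]|exact: cvg_cst].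
- by move=> x; rewrite lee_fin expR_ge0.
transitivity (th%:E * \int[mu]_x (normal_pdf 0 (th * s) x)%:E)%E; last first.
  by rewrite integral_normal_pdf mule1.
rewrite -(integralZl measurableT (integrable_normal_pdf 0 (th * s)) th).
apply: eq_integral => x _; rewrite -!EFinM; congr EFin.
rewrite !normal_pdfE ?mulf_neq0// mulrCA [RHS]mulrA; congr (_ * _).
  rewrite /normal_peak.
  have -> : (th * s) ^+ 2 * pi *+ 2 = th ^+ 2 * (s ^+ 2 * pi *+ 2).
    by rewrite exprMn mulrnAr mulrA.
  rewrite sqrtrM ?sqr_ge0// sqrtr_sqr (gtr0_norm th0).
  by rewrite invfM mulrA mulfV// mul1r.
rewrite /normal_fun -expRD; congr expR; field.
by rewrite sn0 tn0.
Qed.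

End GaussianMoments.

(** * Square integrable random variables *)

Section Expectation.
Context d (T : measurableType d) (R : realType) (P : probability T R).
Implicit Types X Y : T -> R.
Definition intg X := P.-integrable setT (EFin \o X).
Definition Ex X : R := \int[P]_w X w.

Lemma intg_dominated X Y : measurable_fun setT X -> (forall w, `|X w| <= Y w) ->
  intg Y -> intg X.
Proof.
move=> mX XY iY; apply: (le_integrable measurableT _ _ iY).
  exact/measurable_EFinP.
by move=> w _ /=; rewrite lee_fin (le_trans (XY w))// ler_norm.
Qed.

Lemma intg_cst (c : R) : intg (fun=> c).
Proof.
exact: finite_measure_integrable_cst.
Qed.

Lemma intgD X Y : intg X -> intg Y -> intg (fun w => X w + Y w).
Proof. by move=> iX iY; have := integrableD measurableT iX iY; apply: eq_integrable. Qed.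

Lemma intgZ (c : R) X : intg X -> intg (fun w => c * X w).
Proof. by move=> iX; have := integrableZl measurableT c iX; apply: eq_integrable. Qed.

Lemma ExD X Y : intg X -> intg Y -> Ex (fun w => X w + Y w) = Ex X + Ex Y.
Proof. exact: RintegralD. Qed.

Lemma ExB X Y : intg X -> intg Y -> Ex (fun w => X w - Y w) = Ex X - Ex Y.
Proof. exact: RintegralB. Qed.

Lemma ExZ (c : R) X : intg X -> Ex (fun w => c * X w) = c * Ex X.
Proof. by move=> iX; exact: RintegralZl. Qed.

Lemma Ex_cst (c : R) : Ex (fun=> c) = c.
Proof.
rewrite /Ex Rintegral_cst//; transitivity (c * fine (1%E : \bar R)); last by rewrite mulr1.
by congr (_ * fine _); exact: probability_setT.
Qed.

Lemma Ex_le X Y : intg X -> intg Y -> (forall w, X w <= Y w) -> Ex X <= Ex Y.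
Proof. by move=> iX iY H; exact: le_Rintegral. Qed.

Lemma ExE X : intg X -> (\int[P]_w (X w)%:E = (Ex X)%:E)%E.
Proof. by move=> iX; rewrite /Ex /Rintegral fineK//; exact: integrable_fin_num. Qed.

Lemma intg_sum (n : nat) (F : nat -> T -> R) : (forall i, (i < n)%N -> intg (F i)) ->
  intg (fun w => \sum_(i < n) F i w) /\
  Ex (fun w => \sum_(i < n) F i w) = \sum_(i < n) Ex (F i).
Proof.
elim: n => [|n IH] H.
  split; last by rewrite big_ord0 -[RHS](Ex_cst 0); congr Ex; apply/funext => w; rewrite big_ord0.
  by rewrite (_ : (fun _ => _) = fun=> 0); [exact: intg_cst|apply/funext => w; rewrite big_ord0].
have [h1 h2] := IH (fun i ni => H i (ltnW ni)).
have -> : (fun w => \sum_(i < n.+1) F i w) = (fun w => \sum_(i < n) F i w + F n w).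
  by apply/funext => w; rewrite big_ord_recr.
split; first by apply: intgD => //; exact: H.
by rewrite ExD ?h2 ?big_ord_recr//; exact: H.
Qed.

Definition L2 X := measurable_fun setT X /\ intg (fun w => X w ^+ 2).

(** 2 |X Y| <= X^2 + Y^2. *)
Lemma L2_mul X Y : L2 X -> L2 Y -> intg (fun w => X w * Y w).
Proof.
move=> [mX iX] [mY iY]; apply: (intg_dominated _ _ (intgD iX iY)).
  exact: measurable_funM.
move=> w; rewrite normrM -(real_normK (num_real (X w))) -(real_normK (num_real (Y w))).
have := sqr_ge0 (`|X w| - `|Y w|); rewrite sqrrB.
have := sqr_ge0 `|X w|; have := sqr_ge0 `|Y w|; have := mulr_ge0 (normr_ge0 (X w)) (normr_ge0 (Y w)).
move: (`|X w| ^+ 2) (`|Y w| ^+ 2) (`|X w| * `|Y w|) => u v x; lra.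
Qed.

Lemma L2D X Y : L2 X -> L2 Y -> L2 (fun w => X w + Y w).
Proof.
move=> hX hY; split; first by apply: measurable_funD; [case: hX|case: hY].
have [_ iX] := hX; have [_ iY] := hY.
rewrite (_ : (fun _ => _) = fun w => X w ^+ 2 + (2 * (X w * Y w)) + Y w ^+ 2).
  by apply: intgD => //; apply: intgD => //; apply: intgZ; exact: L2_mul.
by apply/funext => w; rewrite sqrrD mulr_natl.
Qed.

Lemma L2_bounded_mul (c : R) X Y : measurable_fun setT X -> (forall w, `|X w| <= c) ->
  L2 Y -> L2 (fun w => X w * Y w).
Proof.
move=> mX Xc [mY iY]; split; first exact: measurable_funM.
apply: (intg_dominated _ _ (intgZ (c ^+ 2) iY)).
  by apply: measurable_funX; exact: measurable_funM.
move=> w; rewrite exprMn normrM !normrX ler_pM ?exprn_ge0//.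
  by rewrite lerXn2r ?nnegrE ?(le_trans (normr_ge0 _) (Xc w)).
by rewrite real_normK ?num_real.
Qed.

Lemma L2_cst (c : R) : L2 (fun=> c).
Proof. by split => //; exact: intg_cst. Qed.

Lemma L2_intg X : L2 X -> intg X.
Proof.
move=> hX; have := L2_mul hX (L2_cst 1).
by rewrite (_ : (fun _ => _) = X)//; apply/funext => w; rewrite mulr1.
Qed.

Lemma L2_sqrD X Y : L2 X -> L2 Y -> Ex (fun w => (X w + Y w) ^+ 2) =
  Ex (fun w => X w ^+ 2) + 2 * Ex (fun w => X w * Y w) + Ex (fun w => Y w ^+ 2).
Proof.
move=> hX hY; have [_ iX] := hX; have [_ iY] := hY; have iXY := L2_mul hX hY.
rewrite (_ : (fun _ => _) = fun w => X w ^+ 2 + (2 * (X w * Y w)) + Y w ^+ 2).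
  by rewrite ExD ?ExD ?ExZ//; [exact: intgZ|apply: intgD => //; exact: intgZ].
by apply/funext => w; rewrite sqrrD mulr_natl.
Qed.

Lemma chebyshev_L2 X (e c : R) : 0 < e -> L2 X -> Ex (fun w => X w ^+ 2) <= c ->
  (P [set w | (e <= `|X w|)%R] <= (c / e ^+ 2)%:E)%E.
Proof.
move=> e0 [mX iX] Xc; set A := [set w | _].
have mA : measurable A.
  rewrite -(setTI A) (_ : A = (fun w : T => `|X w|) @^-1` (`[e, +oo[%classic : set R)).
    by apply: measurableT_comp => //; exact: measurableT_comp.
  by apply/seteqP; split => w /=; rewrite in_itv/= andbT.
have iA : intg (\1_A : T -> R).
  by apply: (intg_dominated _ _ (intg_cst 1)) => // w; rewrite indicE; case: (_ \in _); rewrite ?normr1 ?normr0.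
have PA : P A = (Ex (\1_A : T -> R))%:E by rewrite -ExE// integral_indic// setIT.
rewrite PA lee_fin ler_pdivlMr ?exprn_gt0// mulrC -ExZ//.
apply: le_trans Xc; apply: Ex_le => //; first exact: intgZ.
move=> w; rewrite indicE; have [|] := boolP (w \in A); last by rewrite mulr0 sqr_ge0.
rewrite inE /A/= mulr1 -(real_normK (num_real (X w))) => Xe.
by rewrite lerXn2r// nnegrE// ltW.
Qed.

End Expectation.

(** * Independence and Gaussian variables *)

Section Independence.
Context d (T : measurableType d) (R : realType) (P : probability T R).
Implicit Types X Y : T -> R.

(** The joint law agrees with the product of the laws on rectangles, hence
everywhere; Fubini gives the product of the means. *)
Lemma Ex_indep X Y : L2 P X -> L2 P Y ->
  (forall A B : set R, measurable A -> measurable B ->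
     P (X @^-1` A `&` Y @^-1` B) = (P (X @^-1` A) * P (Y @^-1` B))%E) ->
  Ex P (fun w => X w * Y w) = Ex P X * Ex P Y.
Proof.
move=> hX hY indep.
have [mX _] := hX; have [mY _] := hY.
have iX := L2_intg hX; have iY := L2_intg hY; have iXY := L2_mul hX hY.
have mW : measurable_fun setT (fun w => (X w, Y w)) by exact: measurable_fun_pair.
pose X' : {mfun T >-> R} := HB.pack X (isMeasurableFun.Build _ _ _ _ X mX).
pose Y' : {mfun T >-> R} := HB.pack Y (isMeasurableFun.Build _ _ _ _ Y mY).
pose W' : {mfun T >-> (R * R)%type} :=
  HB.pack (fun w => (X w, Y w)) (isMeasurableFun.Build _ _ _ _ _ mW).
pose m1 : probability R R := distribution P X'.
pose m2 : probability R R := distribution P Y'.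
pose m' : probability (R * R)%type R := distribution P W'.
pose f (z : R * R) : \bar R := (z.1 * z.2)%:E.
have mf : measurable_fun setT f.
  by apply/measurable_EFinP; apply: measurable_funM; [exact: measurable_fst|exact: measurable_snd].
have prodE (S : set (R * R)) : measurable S -> S `<=` setT -> (m1 \x m2)%E S = m' S.
  move=> mS _; apply: product_measure_unique => //.
have E1 : (\int[m']_z f z = \int[P]_w (X w * Y w)%:E)%E.
  exact: (integral_pushforward (phi := fun w => (X w, Y w)) mW mf iXY measurableT).
have E2 : (\int[m1 \x m2]_z f z = \int[m']_z f z)%E.
  by apply: eq_measure_integral => S mS _; exact: prodE.
have if' : m'.-integrable setT f.
  exact: (integrable_pushforward (phi := fun w => (X w, Y w)) mW mf iXY measurableT).
have iff : (m1 \x m2)%E.-integrable setT f.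
  apply/integrableP; split => //; have /integrableP[_] := if'.
  by congr (_ < _)%E; apply: eq_measure_integral => S mS _; exact/esym/prodE.
have := integral12_prod_meas1 iff; rewrite E2 E1.
have E3 : (\int[m1]_x (x%:E) = (Ex P X)%:E)%E.
  rewrite -ExE//; apply: (integral_pushforward (phi := X) mX _ iX measurableT).
  exact/measurable_EFinP.
have E4 : (\int[m2]_x (x%:E) = (Ex P Y)%:E)%E.
  rewrite -ExE//; apply: (integral_pushforward (phi := Y) mY _ iY measurableT).
  exact/measurable_EFinP.
have i1 : m1.-integrable setT (EFin \o @id R).
  apply: (integrable_pushforward (phi := X) mX _ iX measurableT).
  exact/measurable_EFinP.
have i2 : m2.-integrable setT (EFin \o @id R).
  apply: (integrable_pushforward (phi := Y) mY _ iY measurableT).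
  exact/measurable_EFinP.
rewrite (_ : (fun x => \int[m2]_y f (x, y))%E = fun x => (x * Ex P Y)%:E); last first.
  apply/funext => x; rewrite /f/=.
  transitivity (x%:E * \int[m2]_y y%:E)%E; last by rewrite E4 EFinM.
  rewrite -(integralZl measurableT i2 x).
  by apply: eq_integral => y' _; rewrite EFinM.
rewrite (ExE iXY) => H; apply: EFin_inj; rewrite -H EFinM -E3.
rewrite -(integralZr measurableT i1 (Ex P Y)).
by apply: eq_integral => x _; rewrite EFinM.
Qed.

End Independence.

Section GaussianVariable.
Context d (T : measurableType d) (R : realType) (P : probability T R).
Variables (X : T -> R) (s : R).
Hypothesis mX : measurable_fun setT X.
Hypothesis s0 : 0 < s.
Hypothesis law : forall A : set R, measurable A -> P [set w | A (X w)] = normal_prob 0 s A.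

Lemma gauss_integral (g : R -> R) : measurable_fun setT g -> (forall x, 0 <= g x) ->
  (\int[P]_w (g (X w))%:E = \int[normal_prob 0 s]_x (g x)%:E)%E.
Proof.
move=> mg g0.
pose X1 : T -> measurableTypeR R := X.
have mX1 : measurable_fun setT X1 by exact: mX.
pose X' : {mfun T >-> measurableTypeR R} := HB.pack X1 (isMeasurableFun.Build _ _ _ _ X1 mX1).
pose m1 : probability (measurableTypeR R) R := distribution P X'.
pose nu : probability (measurableTypeR R) R := normal_prob 0 s.
transitivity (\int[m1]_x (g x)%:E)%E.
  apply/esym; apply: (@ge0_integral_pushforward _ _ _ _ _ X1 mX1 P setT (EFin \o g)) => //.
  - exact/measurable_EFinP.
  - by move=> y _ /=; rewrite lee_fin.
by apply: (eq_measure_integral nu) => A mA _; exact: law.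
Qed.

Lemma gauss_intg (g h : R -> R) (c : R) : measurable_fun setT g -> measurable_fun setT h ->
  (forall x, `|g x| <= h x) -> (\int[normal_prob 0 s]_x (h x)%:E = c%:E)%E ->
  [/\ intg P (fun w => g (X w)), intg P (fun w => h (X w)) & Ex P (fun w => h (X w)) = c].
Proof.
move=> mg mh gh hc.
have h0 x : 0 <= h x by apply: le_trans (gh x).
have E := gauss_integral mh h0.
have ih : intg P (fun w => h (X w)).
  apply/integrableP; split; first by apply/measurable_EFinP; exact: measurableT_comp.
  under eq_integral do rewrite /= ger0_norm//.
  by rewrite E hc ltry.
split=> //.
  by apply: (intg_dominated _ _ ih) => //; exact: measurableT_comp.
by rewrite /Ex /Rintegral E hc.
Qed.

Let mexp (a : R) : measurable_fun setT (fun x : R => expR (a * x ^+ 2 / (2 * s ^+ 2))).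
Proof.
apply: continuous_measurable_fun => x; apply: continuous_comp; last exact: continuous_expR.
by apply: cvgM; [apply: cvgM; [exact: cvg_cst|exact: exprn_continuous]|exact: cvg_cst].
Qed.

Let mexp1 (c : R) : measurable_fun setT (fun x : R => expR (c * x / s ^+ 2 - c ^+ 2 / (2 * s ^+ 2))).
Proof.
apply: continuous_measurable_fun => x; apply: continuous_comp; last exact: continuous_expR.
apply: cvgB; last exact: cvg_cst.
by apply: cvgM; [apply: cvgM; [exact: cvg_cst|exact: cvg_id]|exact: cvg_cst].
Qed.

Lemma expR_ge_sqr (u : R) : 0 <= u -> u ^+ 2 / 4 <= expR u.
Proof.
move=> u0; have -> : u = u / 2 + u / 2 by rewrite -splitr.
rewrite expRD; have := expR_ge1Dx (u / 2); move: (expR _) => v.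
rewrite -splitr => h.
have -> : u ^+ 2 / 4 = (u / 2) * (u / 2) by field.
by apply: ler_pM; rewrite ?divr_ge0//; lra.
Qed.

(** From u^2 / 4 <= exp u, applied to a multiple of X^2 whose exponential has a
known mean. *)
Lemma gauss_pow4 : intg P (fun w => X w ^+ 4) /\ Ex P (fun w => X w ^+ 4) <= 64 * s ^+ 4.
Proof.
have s2 : 0 < s ^+ 2 by rewrite exprn_gt0.
(* th = 2 in the rescaled density: u = a X^2 / (2 s^2) = 3 X^2 / (8 s^2), hence
   X^4 = 64/9 s^4 u^2 <= 256/9 s^4 exp u, and exp u has mean 2 *)
pose a : R := 1 - 2 ^- 2.
have aE : a = 3 / 4 by rewrite /a; field.
pose k := 256 / 9 * s ^+ 4.
have key x : `|x ^+ 4| <= k * expR (a * x ^+ 2 / (2 * s ^+ 2)).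
  rewrite ger0_norm; last by rewrite (exprM x 2 2) sqr_ge0.
  have u0 : 0 <= a * x ^+ 2 / (2 * s ^+ 2).
    have a0 : 0 <= a by rewrite aE.
    by apply: divr_ge0; apply: mulr_ge0 => //; exact: sqr_ge0.
  have k0 : 0 <= k by rewrite mulr_ge0// exprn_ge0// ltW.
  rewrite (le_trans _ (ler_wpM2l k0 (expR_ge_sqr u0)))//.
  rewrite le_eqVlt; apply/orP; left; apply/eqP; rewrite aE /k; field.
  by rewrite gt_eqF.
have mk : measurable_fun setT (fun x : R => k * expR (a * x ^+ 2 / (2 * s ^+ 2))).
  by apply: measurable_funM => //; exact: mexp.
have Ek : (\int[normal_prob 0 s]_x (k * expR (a * x ^+ 2 / (2 * s ^+ 2)))%:E = (k * 2)%:E)%E.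
  rewrite EFinM -(exp_square_normal s0 (ltr0Sn R 1)).
  have k0 : (0 <= k%:E)%E by rewrite lee_fin mulr_ge0// exprn_ge0// ltW.
  rewrite -ge0_integralZl.
  - by apply: eq_integral => x _; rewrite EFinM.
  - exact: measurableT.
  - by apply/measurable_EFinP; exact: mexp.
  - by move=> x _; rewrite lee_fin expR_ge0.
  - exact: k0.
have [i4 ik E] := gauss_intg (exprn_measurable 4) mk key Ek.
split=> //; rewrite (le_trans (Ex_le i4 ik _))//.
  by move=> w; rewrite (le_trans (ler_norm _)).
rewrite E /k; have : 0 <= s ^+ 4 by rewrite exprn_ge0// ltW.
by move: (s ^+ 4) => u; lra.
Qed.

Lemma gauss_L2 : L2 P X /\ L2 P (fun w => X w ^+ 2).
Proof.
have [i4 _] := gauss_pow4.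
have m2 : measurable_fun setT (fun w => X w ^+ 2) by exact: measurable_funX.
split; split => //.
  apply: (intg_dominated _ _ (intgD (intg_cst P 1) i4)) => // w.
  rewrite ger0_norm ?sqr_ge0// (exprM (X w) 2 2).
  have := sqr_ge0 (X w ^+ 2 - 1); have := sqr_ge0 (X w); move: (X w ^+ 2) => u; nra.
by under [X in intg _ X]funext => w do rewrite -exprM.
Qed.

(** Take the mean of 1 + u <= exp u for the exponential martingale with parameter
c = E X: it reads 1 + c^2 / (2 s^2) <= 1. *)
Lemma gauss_mean : Ex P X = 0.
Proof.
have [hX _] := gauss_L2; have iX := L2_intg hX.
have s2 : 0 < s ^+ 2 by rewrite exprn_gt0.
set m := Ex P X.
have hge x : `|expR (m * x / s ^+ 2 - m ^+ 2 / (2 * s ^+ 2))| <= expR (m * x / s ^+ 2 - m ^+ 2 / (2 * s ^+ 2)).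
  by rewrite ger0_norm// expR_ge0.
have [_ ie Ee] := gauss_intg (mexp1 m) (mexp1 m) hge (exp_linear_normal m s0).
have := Ex_le (intgD (intg_cst P (1 - m ^+ 2 / (2 * s ^+ 2))) (intgZ (m / s ^+ 2) iX)) ie.
rewrite Ee ExD; [|exact: intg_cst|exact: intgZ].
rewrite ExZ// Ex_cst -/m => H.
have {H} : 1 - m ^+ 2 / (2 * s ^+ 2) + m / s ^+ 2 * m <= 1.
  apply: H => w; have := expR_ge1Dx (m * X w / s ^+ 2 - m ^+ 2 / (2 * s ^+ 2)).
  by apply: le_trans; rewrite le_eqVlt; apply/orP; left; apply/eqP; field; rewrite gt_eqF.
have -> : 1 - m ^+ 2 / (2 * s ^+ 2) + m / s ^+ 2 * m = 1 + m ^+ 2 / (2 * s ^+ 2).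
  by field; rewrite gt_eqF.
rewrite gerDl pmulr_lle0 ?invr_gt0 ?mulr_gt0// => m2.
by apply/eqP; rewrite -sqrf_eq0 eq_le m2 sqr_ge0.
Qed.

(** Letting th tend to 1 from above gives v <= 1, and from below v >= 1. *)
Lemma variance_pinch (v : R) :
  (forall th : R, 0 < th -> (th - 1) * (v * (th + 1) - 2 * th ^+ 2) <= 0) -> v = 1.
Proof.
move=> H; apply/le_anti/andP; split; rewrite leNgt; apply/negP => hv.
- pose e := (v - 1) / 4; have e0 : 0 < e by rewrite divr_gt0// subr_gt0.
  have vE : v = 1 + 4 * e by rewrite /e; field.
  have := H (1 + e); rewrite addr_gt0// => /(_ isT); rewrite vE leNgt => /negP; apply.
  have -> : (1 + e - 1) * ((1 + 4 * e) * (1 + e + 1) - 2 * (1 + e) ^+ 2) = e ^+ 2 * (5 + 2 * e) by ring.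
  by rewrite mulr_gt0 ?exprn_gt0// addr_gt0// mulr_gt0.
- have [v0|v0] := leP v 0.
    have := H 2^-1; rewrite invr_gt0 => /(_ (ltr0Sn _ _)).
    have -> : (2^-1 - 1) * (v * (2^-1 + 1) - 2 * 2^-1 ^+ 2) = 4^-1 - 3 / 4 * v by field.
    by move: v0; lra.
  pose e := (1 - v) / 4; have e0 : 0 < e by rewrite divr_gt0// subr_gt0.
  have vE : v = 1 - 4 * e by rewrite /e; field.
  have e1 : e < 1 by rewrite /e; lra.
  have := H (1 - e); rewrite subr_gt0 e1 => /(_ isT); rewrite vE leNgt => /negP; apply.
  have -> : (1 - e - 1) * ((1 - 4 * e) * (1 - e + 1) - 2 * (1 - e) ^+ 2) = e ^+ 2 * (5 - 2 * e) by ring.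
  by rewrite mulr_gt0 ?exprn_gt0//; lra.
Qed.

(** The mean of 1 + u <= exp u with u = (1 - th^-2) X^2 / (2 s^2) bounds the
variance from one side for th > 1 and from the other side for th < 1. *)
Lemma gauss_variance : Ex P (fun w => X w ^+ 2) = s ^+ 2.
Proof.
have [[_ i2] _] := gauss_L2.
have s2 : 0 < s ^+ 2 by rewrite exprn_gt0.
have sn0 : s != 0 by rewrite gt_eqF.
set v := Ex P _.
suff : v / s ^+ 2 = 1 by move=> /divr1_eq.
apply: variance_pinch => th th0.
have tn0 : th != 0 by rewrite gt_eqF.
have hge x : `|expR ((1 - th ^- 2) * x ^+ 2 / (2 * s ^+ 2))| <= expR ((1 - th ^- 2) * x ^+ 2 / (2 * s ^+ 2)).
  by rewrite ger0_norm// expR_ge0.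
have [_ ie Ee] := gauss_intg (mexp (1 - th ^- 2)) (mexp (1 - th ^- 2)) hge (exp_square_normal s0 th0).
have := Ex_le (intgD (intg_cst P 1) (intgZ ((1 - th ^- 2) / (2 * s ^+ 2)) i2)) ie.
rewrite Ee ExD; [|exact: intg_cst|exact: intgZ].
rewrite ExZ// Ex_cst -/v => H.
have {H} : 1 + (1 - th ^- 2) / (2 * s ^+ 2) * v <= th.
  apply: H => w; have := expR_ge1Dx ((1 - th ^- 2) * X w ^+ 2 / (2 * s ^+ 2)).
  by apply: le_trans; rewrite le_eqVlt; apply/orP; left; apply/eqP; field; rewrite sn0 tn0.
move=> H; have t2 : 0 < 2 * th ^+ 2 by rewrite mulr_gt0 ?exprn_gt0.
have := ler_wpM2l (ltW t2) H; rewrite -subr_ge0 -oppr_le0 opprB; apply: le_trans.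
by rewrite le_eqVlt; apply/orP; left; apply/eqP; field; rewrite sn0 tn0.
Qed.

End GaussianVariable.

(** * Brownian increments *)

Section GeneratedMeasurability.
Context d (T : measurableType d) (R : realType) (J : Type) (X : J -> T -> R).
Implicit Types (D : set J) (Y : T -> R).

Definition generators D : set (set T) :=
  [set E | exists j B, [/\ D j, measurable B & E = X j @^-1` B]].

(** Measurability with respect to a generated sub-sigma-algebra is measurability on
this measurable type, so that the closure properties of measurable functions
apply to it. *)
Definition gen_type D : measurableType _ := g_sigma_algebraType (generators D).

Definition known D Y : Prop := measurable_fun [set: gen_type D] (Y : gen_type D -> R).

Lemma known_preimage D Y (B : set R) : known D Y -> measurable B ->
  sigma_of X D (Y @^-1` B).
Proof. by move=> mY mB; have := mY measurableT B mB; rewrite setTI. Qed.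

Lemma known_gen D j : D j -> known D (X j).
Proof.
move=> Dj _ B mB; rewrite setTI; apply: sub_sigma_algebra.
by exists j, B.
Qed.

Lemma generators_measurable D : (forall j, D j -> measurable_fun setT (X j)) ->
  sigma_of X D `<=` measurable.
Proof.
move=> mX; apply: smallest_sub; first exact: sigma_algebra_measurable.
by move=> E [j [B [Dj mB ->]]]; rewrite -[_ @^-1` _]setTI; exact: mX.
Qed.

Lemma known_measurable D Y : (forall j, D j -> measurable_fun setT (X j)) ->
  known D Y -> measurable_fun setT Y.
Proof.
move=> mX kY _ B mB; rewrite setTI; apply: (generators_measurable mX).
exact: known_preimage.
Qed.

Lemma sigma_ofS D D' : D `<=` D' -> sigma_of X D `<=` sigma_of X D'.
Proof.
move=> DD'; apply: smallest_sub; first exact: smallest_sigma_algebra.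
move=> E [j [B [Dj mB ->]]]; apply: sub_sigma_algebra.
by exists j, B; split=> //; exact: DD'.
Qed.

Lemma knownS D D' Y : D `<=` D' -> known D Y -> known D' Y.
Proof.
move=> DD' kY _ B mB; rewrite setTI; apply: (sigma_ofS DD').
exact: known_preimage.
Qed.

End GeneratedMeasurability.

Section TrackerMeasurability.
Context d (T : measurableType d) (R : realType).

Lemma clip_measurable (c : R) (Y : T -> R) : measurable_fun setT Y ->
  measurable_fun setT (fun w => clip c (Y w)).
Proof.
move=> mY; apply: (@measurable_maxr _ _ _ _ (fun=> - c) (fun w => Num.min (Y w) c)) => //.
exact: (@measurable_minr _ _ _ _ Y (fun=> c)).
Qed.

Lemma sg_measurable (Y : T -> R) : measurable_fun setT Y ->
  measurable_fun setT (fun w => Num.sg (Y w)).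
Proof.
move=> mY; rewrite (_ : (fun _ => _) =
    fun w => if 0 < Y w then 1 else if Y w < 0 then -1 else 0); last first.
  apply/funext => w; case: (ltrgtP (Y w) 0) => [yn|yp|->]; rewrite ?sgr0//.
  - exact: ltr0_sg.
  - exact: gtr0_sg.
apply: measurable_fun_ifT => //; first exact: measurable_fun_ltr.
by apply: measurable_fun_ifT => //; exact: measurable_fun_ltr.
Qed.

(** Stated on an arbitrary measurable type, it also shows that the tracker is
adapted. *)
Lemma tracker_measurable (h eta : R) (v : nat -> T -> R) (n : nat) :
  (forall i, (i <= n)%N -> measurable_fun setT (v i)) ->
  measurable_fun setT (fun w => tracker h eta (v ^~ w) n).
Proof.
elim: n => [|n IH] mv //=.
have mL := IH (fun i ni => mv i (leqW ni)).
have mD := measurable_funB (mv n.+1 (leqnn _)) mL.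
apply: measurable_fun_ifT => //.
  by apply: measurable_fun_ler => //; exact: measurableT_comp.
by apply: measurable_funD => //; apply: measurable_funM => //; exact: sg_measurable.
Qed.

End TrackerMeasurability.

Section BrownianIncrements.
Context d (T : measurableType d) (R : realType) (P : probability T R).
Variable B : R -> {RV P >-> R}.
Hypothesis hB : brownian B.

Definition past (s : R) : (T -> R) -> Prop := known (fun u => B u : T -> R) `[0, s].

Lemma past_measurable s Y : past s Y -> measurable_fun setT Y.
Proof. by apply: known_measurable => j _. Qed.

Lemma pastS s t Y : s <= t -> past s Y -> past t Y.
Proof.
move=> st; apply: knownS => u /=; rewrite !in_itv/= => /andP[-> us].
exact: le_trans st.
Qed.

Lemma past_value s t : 0 <= s <= t -> past t (B s).
Proof. by move=> st; apply: known_gen; rewrite /= in_itv. Qed.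

Lemma increment_indep (s t : R) (G : T -> R) (g : R -> R) : 0 <= s -> s < t ->
  past s G -> L2 P G -> measurable_fun setT g ->
  L2 P (fun w => g (B t w - B s w)) ->
  Ex P (fun w => G w * g (B t w - B s w)) = Ex P G * Ex P (fun w => g (B t w - B s w)).
Proof.
move=> s0 st kG lG mg lY; apply: Ex_indep => // A C mA mC.
have [_ _ _ H] := hB.
have mgC : measurable (g @^-1` C) by rewrite -[_ @^-1` _]setTI; exact: mg.
exact: (H _ _ s0 st _ _ (known_preimage kG mA) mgC).
Qed.

Lemma increment_moments (s t : R) : 0 <= s -> s < t ->
  let D w := B t w - B s w in
  [/\ L2 P D, L2 P (fun w => D w ^+ 2), Ex P D = 0, Ex P (fun w => D w ^+ 2) = t - s
    & Ex P (fun w => D w ^+ 4) <= 64 * (t - s) ^+ 2].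
Proof.
move=> s0 st D; have [_ _ law _] := hB.
have mD : measurable_fun setT D by apply: measurable_funB.
have r0 : 0 < Num.sqrt (t - s) by rewrite sqrtr_gt0 subr_gt0.
have lawD := law _ _ s0 st.
have sq : Num.sqrt (t - s) ^+ 2 = t - s by rewrite sqr_sqrtr// subr_ge0 ltW.
have [l1 l2] := gauss_L2 mD r0 lawD.
split=> //; first exact: gauss_mean mD r0 lawD.
  by rewrite (gauss_variance mD r0 lawD).
have [_] := gauss_pow4 mD r0 lawD.
by rewrite (exprM _ 2 2) sq.
Qed.

Section GridMartingale.
Variable dt : R.
Hypothesis dt_gt0 : 0 < dt.

Definition increment (i : nat) (w : T) : R := B (i.+1%:R * dt) w - B (i%:R * dt) w.

Let t_ge0 i : 0 <= i%:R * dt. Proof. by rewrite mulr_ge0// ltW. Qed.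
Let t_lt i : i%:R * dt < i.+1%:R * dt. Proof. by rewrite ltr_pM2r// ltr_nat. Qed.

Lemma past_increment i j : (i < j)%N -> past (j%:R * dt) (increment i).
Proof.
move=> ij; apply: measurable_funB; apply: past_value; rewrite t_ge0/=.
  by rewrite ler_pM2r// ler_nat.
by rewrite ler_pM2r// ler_nat ltnW.
Qed.

Lemma grid_moments i :
  [/\ L2 P (increment i), L2 P (fun w => increment i w ^+ 2), Ex P (increment i) = 0,
      Ex P (fun w => increment i w ^+ 2) = dt
    & Ex P (fun w => increment i w ^+ 4) <= 64 * dt ^+ 2].
Proof.
have := increment_moments (t_ge0 i) (t_lt i).
by rewrite -mulrBl -natrB// subSnn mul1r.
Qed.

(** G i is known before the i-th increment and g of the increment is centred, so
the cross terms vanish and the second moments add up. *)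
Lemma martingale_sum (c v : R) (G : nat -> T -> R) (g : R -> R) (M : nat) :
  (forall i, past (i%:R * dt) (G i)) -> (forall i w, `|G i w| <= c) ->
  measurable_fun setT g -> (forall i, L2 P (fun w => g (increment i w))) ->
  (forall i, Ex P (fun w => g (increment i w)) = 0) ->
  (forall i, Ex P (fun w => g (increment i w) ^+ 2) <= v) ->
  let Z w := \sum_(i < M) G i w * g (increment i w) in
  [/\ past (M%:R * dt) Z, L2 P Z & Ex P (fun w => Z w ^+ 2) <= M%:R * (c ^+ 2 * v)].
Proof.
move=> kG Gc mg lg g0 gv.
pose Z N w := \sum_(i < N) G i w * g (increment i w).
suff : [/\ past (M%:R * dt) (Z M), L2 P (Z M) & Ex P (fun w => Z M w ^+ 2) <= M%:R * (c ^+ 2 * v)] by [].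
elim: M => [|M [kZ lZ EZ]].
  rewrite (_ : Z 0%N = fun=> 0); last by apply/funext => w; rewrite /Z big_ord0.
  split; [exact: measurable_cst|exact: L2_cst|].
  by rewrite mul0r Ex_cst expr0n.
have -> : Z M.+1 = fun w => Z M w + G M w * g (increment M w).
  by apply/funext => w; rewrite /Z big_ord_recr.
have mG := past_measurable (kG M).
have lGY := L2_bounded_mul mG (Gc M) (lg M).
split; last 1 first.
- rewrite L2_sqrD//.
  have -> : Ex P (fun w => Z M w * (G M w * g (increment M w))) = 0.
    transitivity (Ex P (fun w => (G M w * Z M w) * g (increment M w))).
      by congr Ex; apply/funext => w; rewrite mulrA (mulrC (Z M w)).
    have kGZ : past (M%:R * dt) (fun w => G M w * Z M w) := measurable_funM (kG M) kZ.
    have lGZ : L2 P (fun w => G M w * Z M w) by exact: L2_bounded_mul (Gc M) lZ.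
    by rewrite (increment_indep (t_ge0 M) (t_lt M) kGZ lGZ mg (lg M)) (g0 M) mulr0.
  rewrite mulr0 addr0 -natr1 mulrDl mul1r lerD//.
  apply: (@le_trans _ _ (c ^+ 2 * Ex P (fun w => g (increment M w) ^+ 2))).
    rewrite -ExZ; last by case: (lg M).
    apply: Ex_le; [by case: lGY|by apply: intgZ; case: (lg M)|].
    move=> w; rewrite exprMn ler_wpM2r ?sqr_ge0// -(real_normK (num_real (G M w))).
    by rewrite lerXn2r ?nnegrE// (le_trans (normr_ge0 _) (Gc M w)).
  by rewrite ler_wpM2l// sqr_ge0.
- apply: measurable_funD; first by apply: pastS kZ; rewrite ltW.
  apply: measurable_funM; first by apply: pastS (kG M); rewrite ltW.
  by apply: measurableT_comp => //; exact: past_increment.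
- exact: L2D.
Qed.

(** The squared increments minus dt are centred, with second moment at most
64 dt^2. *)
Lemma variation_moment (M : nat) :
  let Z w := \sum_(i < M) (increment i w ^+ 2 - dt) in
  L2 P Z /\ Ex P (fun w => Z w ^+ 2) <= M%:R * (64 * dt ^+ 2).
Proof.
have := @martingale_sum 1 (64 * dt ^+ 2) (fun _ _ => 1) (fun x => x ^+ 2 - dt) M.
have E : (fun w => \sum_(i < M) 1 * (increment i w ^+ 2 - dt)) =
    fun w => \sum_(i < M) (increment i w ^+ 2 - dt).
  by apply/funext => w; apply: eq_bigr => i _; rewrite mul1r.
rewrite /= E expr1n mul1r => H.
have lY i : L2 P (fun w => increment i w ^+ 2 - dt).
  by have [_ l2 _ _ _] := grid_moments i; exact: L2D l2 (L2_cst _ (- dt)).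
have [||||||_ lZ EZ] := H => //.
- by move=> i; exact: measurable_cst.
- by move=> i w; rewrite normr1.
- by apply: measurable_funB => //; exact: exprn_measurable.
- move=> i; have [_ l2 _ E2 _] := grid_moments i.
  by rewrite ExB ?E2 ?Ex_cst ?subrr//; [exact: L2_intg|exact: intg_cst].
- move=> i; have [_ l2 _ E2 E4] := grid_moments i.
  have := L2_sqrD l2 (L2_cst P (- dt)).
  rewrite Ex_cst sqrrN => ->.
  have -> : Ex P (fun w => increment i w ^+ 2 * - dt) = - dt * dt.
    rewrite -[X in _ = _ * X]E2 -ExZ; last exact: L2_intg.
    by congr Ex; apply/funext => w; rewrite mulrC.
  under [X in Ex P X]funext => w do rewrite -exprM.
  rewrite -subr_ge0.
  rewrite (_ : _ - _ = (64 * dt ^+ 2 - Ex P (fun w => increment i w ^+ (2 * 2))) + dt ^+ 2); last ring.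
  by rewrite addr_ge0 ?sqr_ge0// subr_ge0.
- split=> //; move: EZ; congr (Ex P _ <= _).
  by apply/funext => w; congr (_ ^+ 2); apply: eq_bigr => i _; rewrite mul1r.
Qed.

(** A martingale sum whose integrand is bounded by h. *)
Lemma tracker_moment (h eta : R) (M : nat) : 0 < h ->
  let Z w := tracker_sum h eta (fun i => B (i%:R * dt) w) M in
  L2 P Z /\ Ex P (fun w => Z w ^+ 2) <= M%:R * (h ^+ 2 * dt).
Proof.
move=> h0; have := @martingale_sum h dt
  (fun i w => clip h (B (i%:R * dt) w - tracker h eta (fun i => B (i%:R * dt) w) i)) id M.
move=> H; have [||||||_ lZ EZ] := H => //.
- move=> i; apply: clip_measurable; apply: measurable_funB.
    by apply: past_value; rewrite t_ge0/=.
  apply: (@tracker_measurable _ (gen_type (fun u => B u : T -> R) _) _ h eta (fun i w => B (i%:R * dt) w)) => j ji.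
  by apply: past_value; rewrite t_ge0/= ler_pM2r// ler_nat.
- by move=> i w; apply: clip_bound; rewrite ltW.
- by move=> i; have [] := grid_moments i.
- by move=> i; have [] := grid_moments i.
- by move=> i; have [_ _ _ ->] := grid_moments i.
Qed.

End GridMartingale.
End BrownianIncrements.

(** * Covariation and Borel-Cantelli *)

Section PlanarCovariation.
Context d (T : measurableType d) (R : realType) (P : probability T R).
Variable W : 'I_2 -> R -> {RV P >-> R}.
Hypothesis hW : planar_brownian W.

Definition own (j : 'I_2) : (T -> R) -> Prop := known (fun u => W j u : T -> R) `[0, +oo[.

Lemma own_past j s Y : past (W j) s Y -> own j Y.
Proof. by apply: knownS => u /=; rewrite !in_itv/= => /andP[->]. Qed.

(** The two coordinates generate independent sigma-algebras. *)
Lemma coordinates_indep Y1 Y2 : own j1 Y1 -> own j2 Y2 -> L2 P Y1 -> L2 P Y2 ->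
  Ex P (fun w => Y1 w * Y2 w) = Ex P Y1 * Ex P Y2.
Proof.
move=> k1 k2 l1 l2; apply: Ex_indep => // A B mA mB.
by have [_] := hW; apply; exact: known_preimage.
Qed.

Variable dt : R.
Hypothesis dt_gt0 : 0 < dt.
Local Notation D j i := (increment (W j) dt i).

Let D_L2 j i : L2 P (D j i).
Proof. by have [+ _] := hW => /(_ j)/grid_moments /(_ _ dt_gt0 i)[]. Qed.
Let D_sqr j i : L2 P (fun w => D j i w ^+ 2).
Proof. by have [+ _] := hW => /(_ j)/grid_moments /(_ _ dt_gt0 i)[]. Qed.

Let D_own j i : own j (D j i).
Proof. exact: own_past (past_increment dt_gt0 (ltnSn i)). Qed.

Let L2_prod X Y : L2 P X -> L2 P Y -> L2 P (fun w => X w ^+ 2) -> L2 P (fun w => Y w ^+ 2) ->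
  L2 P (fun w => X w * Y w).
Proof.
move=> [mX _] [mY _] lX lY; split; first exact: measurable_funM.
by have := L2_mul lX lY; congr (intg P _); apply/funext => w; rewrite exprMn.
Qed.

Let D_prod j i k : L2 P (fun w => D j i w * D j k w).
Proof. exact: L2_prod. Qed.

Lemma increments_orthogonal j i k : (i < k)%N -> Ex P (fun w => D j i w * D j k w) = 0.
Proof.
move=> ik; have [/(_ j) hB _] := hW.
have t0 : 0 <= k%:R * dt by rewrite mulr_ge0// ltW.
have t1 : k%:R * dt < k.+1%:R * dt by rewrite ltr_pM2r// ltr_nat.
have mid : measurable_fun [set: R] (@id R) by exact: measurable_id.
have := @increment_indep _ _ _ _ _ hB _ _ (D j i) id t0 t1 (past_increment dt_gt0 ik) (D_L2 j i) mid (D_L2 j k).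
rewrite /= -/(D j k) => ->.
by have [_ _ -> _ _] := grid_moments hB dt_gt0 k; rewrite mulr0.
Qed.

(** The products of increments over different steps are uncorrelated: conditioning
on one coordinate is replaced by the product rule for the means. *)
Lemma covariation_moment (M : nat) :
  let Z w := \sum_(i < M) D j1 i w * D j2 i w in
  L2 P Z /\ Ex P (fun w => Z w ^+ 2) <= M%:R * dt ^+ 2.
Proof.
pose Z N w := \sum_(i < N) D j1 i w * D j2 i w.
suff : L2 P (Z M) /\ Ex P (fun w => Z M w ^+ 2) <= M%:R * dt ^+ 2 by [].
have l12 i : L2 P (fun w => D j1 i w * D j2 i w) by exact: L2_prod.
elim: M => [|M [lZ EZ]].
  rewrite (_ : Z 0%N = fun=> 0); last by apply/funext => w; rewrite /Z big_ord0.
  split; first exact: L2_cst.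
  by rewrite mul0r Ex_cst expr0n.
have -> : Z M.+1 = fun w => Z M w + D j1 M w * D j2 M w.
  by apply/funext => w; rewrite /Z big_ord_recr.
split; first exact: L2D.
rewrite L2_sqrD//.
have -> : Ex P (fun w => Z M w * (D j1 M w * D j2 M w)) = 0.
  pose F i w := (D j1 i w * D j1 M w) * (D j2 i w * D j2 M w).
  have [_ EF] := @intg_sum _ _ _ P M F (fun i _ => L2_mul (D_prod j1 i M) (D_prod j2 i M)).
  transitivity (Ex P (fun w => \sum_(i < M) F i w)).
    congr Ex; apply/funext => w; rewrite /Z mulr_suml; apply: eq_bigr => i _.
    by rewrite /F mulrACA.
  rewrite EF big1// => i _; rewrite /F coordinates_indep//.
  - by rewrite increments_orthogonal ?mul0r.
  - exact: measurable_funM (@D_own j1 i) (@D_own j1 M).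
  - exact: measurable_funM (@D_own j2 i) (@D_own j2 M).
rewrite mulr0 addr0 -natr1 mulrDl mul1r lerD//.
have -> : (fun w => (D j1 M w * D j2 M w) ^+ 2) = fun w => D j1 M w ^+ 2 * D j2 M w ^+ 2.
  by apply/funext => w; rewrite exprMn.
have [hB _] := hW.
rewrite coordinates_indep//.
- have [_ _ _ -> _] := grid_moments (hB j1) dt_gt0 M.
  by have [_ _ _ -> _] := grid_moments (hB j2) dt_gt0 M; rewrite -expr2.
- exact: measurable_funX (@D_own j1 M).
- exact: measurable_funX (@D_own j2 M).
Qed.

End PlanarCovariation.

Section BorelCantelli.
Context d (T : measurableType d) (R : realType) (P : probability T R).

(** Stated with the geometric bounds that all the applications produce. *)
Lemma borel_cantelli (F : nat -> set T) (c : R) : (forall n, measurable (F n)) ->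
  (forall n, (P (F n) <= (c * 2 ^- n)%:E)%E) ->
  \forall w \ae P, \forall n \near \oo, ~ F n w.
Proof.
move=> mF PF.
have c0 : 0 <= c.
  have := le_trans (measure_ge0 P (F 0%N)) (PF 0%N).
  by rewrite lee_fin expr0 invr1 mulr1.
exists (lim_sup_set F); split.
- apply: bigcap_measurableType => // n _; exact: bigcup_measurable.
- apply: lim_sup_set_cvg0 => //.
  apply: (@le_lt_trans _ _ (\sum_(n <oo) (c * 2 ^- n)%:E)%E).
    by apply: lee_nneseries => n _ //; exact: PF.
  apply: (@le_lt_trans _ _ (2 * c)%:E); last exact: ltry.
  apply: le_trans (@epsilon_trick0 R (2 * c) xpredT _); last by rewrite mulr_ge0.
  apply: lee_nneseries => n _; first by rewrite lee_fin mulr_ge0// invr_ge0 exprn_ge0.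
  by rewrite lee_fin natrX exprS -mulf_div divff// mul1r.
- move=> w /= nw n _; apply: contrapT => h; apply: nw.
  exists n => // k /= nk Fk; apply: h; exists k => //.
Qed.

(** The sets of points that belong to all F n from some rank on increase to the
limit inferior; no summability is needed, so that iterated limits can be taken
at a fixed level of probability. *)
Lemma liminf_measure_le (F : nat -> set T) (c : \bar R) : (forall n, measurable (F n)) ->
  (forall n, (P (F n) <= c)%E) ->
  measurable [set w | \forall n \near \oo, F n w] /\
  (P [set w | \forall n \near \oo, F n w] <= c)%E.
Proof.
move=> mF PF.
pose G N := \bigcap_(n in [set n | (N <= n)%N]) F n.
have mG N : measurable (G N) by exact: bigcap_measurableType.
have E : [set w | \forall n \near \oo, F n w] = \bigcup_N G N.
  apply/seteqP; split => w /=.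
    by move=> [N _ H]; exists N.
  by move=> [N _ H]; exists N.
have mU : measurable (\bigcup_N G N) by exact: bigcup_measurable.
rewrite E; split=> //.
have := @nondecreasing_cvg_mu _ _ _ P G mG mU.
have nd : nondecreasing_seq G.
  move=> m n mn; apply/subsetPset => w H k /= nk; apply: H => /=.
  exact: leq_trans nk.
move=> /(_ nd) H; rewrite -(cvg_lim _ H)//; apply: lime_le; first by apply/cvg_ex; eexists; exact: H.
apply: nearW => n /=; apply: le_trans (PF n); apply: le_measure; rewrite ?inE//.
by move=> w; apply => /=.
Qed.

Lemma L2_ae_cvg0 (X : nat -> T -> R) (c : R) : (forall n, L2 P (X n)) ->
  (forall n, Ex P (fun w => X n w ^+ 2) <= c * 2 ^- n) ->
  \forall w \ae P, (X ^~ w) @ \oo --> 0.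
Proof.
move=> lX EX.
have H k : \forall w \ae P, \forall n \near \oo, ~ (k.+1%:R^-1 <= `|X n w|).
  have k0 : 0 < k.+1%:R^-1 :> R by rewrite invr_gt0.
  apply: (@borel_cantelli (fun n => [set w | k.+1%:R^-1 <= `|X n w|]) (c / k.+1%:R^-1 ^+ 2)).
    move=> n; have [mX _] := lX n.
    rewrite -[X in measurable X]setTI.
    have m : measurable_fun setT (fun w : T => k.+1%:R^-1 <= `|X n w|).
      by apply: measurable_fun_ler => //; exact: measurableT_comp.
    exact: (m measurableT [set true] I).
  by move=> n; rewrite mulrAC; exact: chebyshev_L2.
have := ae_foralln H; apply: filterS => w Hw.
apply/cvgr0Pnorm_lt => e e0.
have [k ke] : exists k : nat, k.+1%:R^-1 < e.
  exists (Num.truncn e^-1); rewrite invf_plt ?posrE//.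
  by rewrite real_truncnS_gt// num_real.
apply: filterS (Hw k) => n /negP; rewrite -ltNge => h; exact: lt_trans ke.
Qed.

End BorelCantelli.

(** * Almost sure properties of Brownian paths *)

Section BrownianPaths.
Context d (T : measurableType d) (R : realType) (P : probability T R).
Local Notation dy := (fun n : nat => 2 ^- n : R).

Lemma block_length_le (a p n : nat) : (a * 2 ^ (n - p))%:R * dy n ^+ 2 <= a%:R * dy n.
Proof.
have d0 : 0 < dy n by exact: dyadic_gt0.
rewrite expr2 mulrA ler_wpM2r ?(ltW d0)// natrM -mulrA ler_piMr//.
rewrite natrX ler_pdivrMr ?exprn_gt0// mul1r.
by rewrite ler_eXn2l ?ltr1n// leq_subr.
Qed.

Lemma modulus_ae (B : R -> {RV P >-> R}) : brownian B ->
  \forall w \ae P, modulus_on (fun t => B t w).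
Proof. by case=> _ + _ _; apply: filterS => w; exact: within_modulus. Qed.

Lemma variation_ae (B : R -> {RV P >-> R}) (a p : nat) : brownian B -> \forall w \ae P,
  (fun n => \sum_(r < a * 2 ^ (n - p)) (B (r.+1%:R * dy n) w - B (r%:R * dy n) w) ^+ 2) @ \oo
    --> a%:R * dy p.
Proof.
move=> hB.
pose X n w := \sum_(i < a * 2 ^ (n - p)) (increment B (dy n) i w ^+ 2 - dy n).
have H n := variation_moment hB (dyadic_gt0 R n) (a * 2 ^ (n - p)).
have bnd n : Ex P (fun w => X n w ^+ 2) <= (64 * a%:R) * dy n.
  have [_ /le_trans] := H n; apply.
  by rewrite mulrCA -mulrA ler_pM2l// block_length_le.
have := L2_ae_cvg0 (fun n => (H n).1) bnd; apply: filterS => w Xw.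
rewrite -[X in _ --> X]add0r.
apply: cvg_trans (cvgD Xw (cvg_cst (a%:R * dy p))); apply: near_eq_cvg.
near=> n; have pn : (p <= n)%N by near: n; exact: nbhs_infty_ge.
rewrite /= -(dyadic_pow R a pn) /X.
have -> : (a * 2 ^ (n - p))%:R * dy n = \sum_(i < a * 2 ^ (n - p)) dy n.
  by rewrite sumr_const card_ord mulr_natl.
by rewrite [LHS](esym (big_split _ _ _ _ _)); apply: eq_bigr => i _ /=; rewrite subrK.
Unshelve. all: by end_near. Qed.

Lemma covariation_ae (W : 'I_2 -> R -> {RV P >-> R}) (a p : nat) : planar_brownian W ->
  \forall w \ae P,
  (fun n => \sum_(r < a * 2 ^ (n - p)) (W j1 (r.+1%:R * dy n) w - W j1 (r%:R * dy n) w)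
     * (W j2 (r.+1%:R * dy n) w - W j2 (r%:R * dy n) w)) @ \oo --> 0.
Proof.
move=> hW; have H n := covariation_moment hW (dyadic_gt0 R n) (a * 2 ^ (n - p)).
apply: (L2_ae_cvg0 (fun n => (H n).1)) => n.
by have [_ /le_trans] := H n; apply; exact: block_length_le.
Qed.

(** If N h^2 is far from the elapsed time, the tracker sum cannot be small: here
x1 = N h^2, x2 is the time, u the square of the last oscillation. *)
Lemma tracker_large (e u v z x1 x2 : R) : e < `|x1 - x2| -> v <= e / 4 -> 0 <= u -> u <= v ->
  `|2 * z - (x1 + u - x2)| <= e / 4 -> e / 4 <= `|z|.
Proof.
move=> ex ve u0 uv; rewrite ler_norml => /andP[h1 h2].
move: ex; rewrite lter_normr => /orP[] ex; rewrite ler_normr; apply/orP; [left|right]; lra.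
Qed.

(** A deviation of N h^2 from the elapsed time forces the tracker sum to be large
for all small eta and, given eta, on all fine grids.  By [liminf_measure_le]
the probability of this is of the order of h^2, which is summable over m. *)
Lemma crossings_ae (B : R -> {RV P >-> R}) (a p : nat) (e : R) : brownian B -> 0 < e ->
  \forall w \ae P, \forall m \near \oo, forall N,
    crossings (fun t => B t w) (dy m) (a%:R * dy p) N ->
    `|N%:R * dy m ^+ 2 - a%:R * dy p| <= e.
Proof.
move=> hB e0.
have e4 : 0 < e / 4 by rewrite divr_gt0.
pose eta i : R := i.+1%:R^-1.
pose Y m i n w := tracker_sum (dy m) (eta i) (fun r => B (r%:R * dy n) w) (a * 2 ^ (n - p)).
have H m i n := tracker_moment hB (dyadic_gt0 R n) (eta i) (a * 2 ^ (n - p)) (dyadic_gt0 R m).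
pose F m i n := [set w | e / 4 <= `|Y m i n w|].
have mF m i n : measurable (F m i n).
  rewrite -[F _ _ _]setTI; have [[mY _] _] := H m i n.
  have mm : measurable_fun setT (fun w : T => e / 4 <= `|Y m i n w|).
    by apply: measurable_fun_ler => //; exact: measurableT_comp.
  exact: (mm measurableT [set true] I).
have PF m i n : (P (F m i n) <= (a%:R / (e / 4) ^+ 2 * dy m)%:E)%E.
  rewrite mulrAC; have [lY EY] := H m i n.
  apply: (chebyshev_L2 e4 lY); rewrite (le_trans EY)// mulrCA.
  have d0 : 0 < dy n by exact: dyadic_gt0.
  have L1 : (a * 2 ^ (n - p))%:R * dy n <= a%:R.
    rewrite natrM -mulrA ler_piMr// natrX ler_pdivrMr ?exprn_gt0// mul1r.
    by rewrite ler_eXn2l ?ltr1n// leq_subr.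
  have h0 : 0 < dy m by exact: dyadic_gt0.
  have h1 : dy m <= 1 by rewrite invf_le1 ?exprn_gt0// exprn_ege1// ler1n.
  have h2 : dy m ^+ 2 <= dy m by rewrite expr2 ler_piMr// ltW.
  have g1 : 0 <= (a * 2 ^ (n - p))%:R * dy n by rewrite mulr_ge0// ltW.
  by rewrite (mulrC (dy m ^+ 2)); apply: ler_pM => //; exact: sqr_ge0.
pose A m := [set w | \forall i \near \oo, [set w' | \forall n \near \oo, F m i n w'] w].
have HA m : measurable (A m) /\ (P (A m) <= (a%:R / (e / 4) ^+ 2 * dy m)%:E)%E.
  by apply: liminf_measure_le => i; have [] := liminf_measure_le (mF m i) (PF m i).
(* F m i n has the right order of probability for each i and n; the limits in n
   and then in i are taken at fixed m *)
have BC := borel_cantelli (fun m => (HA m).1) (fun m => (HA m).2).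
have [W0 _ _ _] := hB.
have MO := modulus_ae hB; have QV := variation_ae a p hB.
near=> w.
have w0 : B 0 w = 0 by near: w.
have wm : modulus_on (fun t => B t w) by near: w.
have wq : (fun n => \sum_(r < a * 2 ^ (n - p)) (B (r.+1%:R * dy n) w - B (r%:R * dy n) w) ^+ 2) @ \oo
    --> a%:R * dy p by near: w.
have wA : \forall m \near \oo, ~ A m w by near: w.
near=> m => N cN; rewrite leNgt; apply/negP => eN.
have : ~ A m w by near: m.
apply.
have hm : dy m ^+ 2 <= e / 4.
  have h0 : 0 < dy m by exact: dyadic_gt0.
  have h1 : dy m <= 1 by rewrite invf_le1 ?exprn_gt0// exprn_ege1// ler1n.
  have : dy m <= e / 4.
    near: m; have := @h_cvg0 R => /cvgr0Pnorm_le/(_ _ e4); apply: filterS => m.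
    by apply: le_trans; exact: ler_norm.
  by apply: le_trans; rewrite expr2 ler_piMr// ltW.
have [eta0 eta00 Heta] := tracker_cvg wm w0 (dyadic_gt0 R m) e4 cN wq.
have osc : (B (a%:R * dy p) w - B (skorohod_time (fun t => B t w) (dy m) N) w) ^+ 2 <= dy m ^+ 2.
  have [_ sT /(_ (a%:R * dy p))] := cN; rewrite sT lexx => /(_ isT) h.
  rewrite -(real_normK (num_real (_ - _))); apply: lerXn2r; last exact: ltW.
    by rewrite nnegrE.
  by rewrite nnegrE; exact/ltW/dyadic_gt0.
near=> i => /=.
have etai : eta i <= eta0.
  by apply: ltW; near: i; exact: (near_infty_natSinv_lt (PosNum eta00)).
have eti0 : 0 < eta i by rewrite invr_gt0.
have := Heta _ eti0 etai; apply: filterS => n.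
rewrite /F /= -/(Y m i n w).
exact: tracker_large eN hm (sqr_ge0 _) osc.
Unshelve. all: by end_near. Qed.

End BrownianPaths.

(** * Good paths *)

Section GoodPaths.
Variable R : realType.
Local Notation dy := (fun n : nat => 2 ^- n : R).

(** The properties of a path, valid almost surely, from which the limits follow
without any further probability. *)
Record good_path (b : R -> 'rV[R]_2) : Prop := GoodPath {
  good_start : b 0 = 0;
  good_coord : forall j, modulus_on (fun t => b t 0 j);
  good_qv : forall (j : 'I_2) (a p : nat),
    (fun n => \sum_(r < a * 2 ^ (n - p)) (b (r.+1%:R * dy n) 0 j - b (r%:R * dy n) 0 j) ^+ 2)
      @ \oo --> a%:R * dy p;
  good_cov : forall a p : nat,
    (fun n => \sum_(r < a * 2 ^ (n - p)) (b (r.+1%:R * dy n) 0 j1 - b (r%:R * dy n) 0 j1)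
      * (b (r.+1%:R * dy n) 0 j2 - b (r%:R * dy n) 0 j2)) @ \oo --> (0 : R);
  good_count : forall (j : 'I_2) (a p : nat) (e : R), 0 < e -> \forall m \near \oo,
    forall N, crossings (fun t => b t 0 j) (dy m) (a%:R * dy p) N ->
      `|N%:R * dy m ^+ 2 - a%:R * dy p| <= e }.

Variables (b : R -> 'rV[R]_2) (phi : 'rV[R]_2 -> R) (y : 'rV[R]_2).
Hypothesis hb : good_path b.
Hypothesis phiC2 : Ck 2 phi.

Lemma good_modulus : modulus_on b.
Proof.
move=> K e e0.
have e2 : 0 < e / 2 by rewrite divr_gt0.
have [d3 d30 H3] := good_coord hb j1 K e2.
have [d4 d40 H4] := good_coord hb j2 K e2.
exists (Num.min d3 d4); first by rewrite lt_min d30.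
move=> s t sK tK; rewrite lt_min => /andP[h3 h4].
apply: (@le_lt_trans _ _ (e / 2)); last by rewrite ltr_pdivrMr// ltr_pMr// ltr1n.
apply: norm_le_coord => j; rewrite coordB.
by case: (ord2P j) => ->; apply: ltW; [exact: H3|exact: H4].
Qed.

Lemma good_limits :
  let lhs t := \int[lebesgue_measure]_(u in `[0, t]) phi (b t - b u - y) in
  let common t := \int[lebesgue_measure]_(u in `[0, t]) phi (- b u - y) in
  let Lphi t := \int[lebesgue_measure]_(v in `[0, t])
    \int[lebesgue_measure]_(u in `[0, v]) laplacian phi (b v - b u - y) in
  (forall K : R, 0 < K ->
    [/\ {uniform `[0, K], along_imbedded b (trm_lhs phi y) @ \oo -->
           (fun t => lhs t - common t)},
        {uniform `[0, K], along_imbedded b (trm_path phi y) @ \oo -->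
           (fun t => t * phi (- y) - common t)},
        {uniform `[0, K], along_imbedded b (trm_mart phi y) @ \oo -->
           (fun t => lhs t - t * phi (- y) - 2^-1 * Lphi t)},
        {uniform `[0, K], along_imbedded b (trm_lap phi y) @ \oo -->
           (fun t => 2^-1 * Lphi t)}
      & {uniform `[0, K],
           along_imbedded b (fun h S n =>
             trm_lhs phi y h S n -
             (trm_path phi y h S n + trm_mart phi y h S n
              + trm_lap phi y h S n)) @ \oo -->
           (fun _ : R => 0 : R)}]) /\
  (forall t : R, 0 <= t ->
    (fun m : nat =>
       \sum_(x \in grid (2 ^- m))
         self_local_time b m t x * laplacian phi (x - y) * 2 ^- (2 * m))
    @ \oo --> Lphi t).
Proof.
have := imbedded_limits y good_modulus (imbedded_walk_cvg (good_coord hb) (good_count hb))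
  (imbedded_walk0 (good_start hb)) (imbedded_walk_step (good_coord hb) (good_count hb)) phiC2.
exact.
Qed.

Lemma good_ito : row_cvg dy (ito_sum b phi y) (fun t =>
  \int[lebesgue_measure]_(u in `[0, t]) phi (b t - b u - y) - t * phi (- y) -
  2^-1 * \int[lebesgue_measure]_(v in `[0, t])
    \int[lebesgue_measure]_(u in `[0, v]) laplacian phi (b v - b u - y)).
Proof. exact (dyadic_ito y good_modulus phiC2 (good_qv hb) (good_cov hb)). Qed.

End GoodPaths.

Section AlmostAllGood.
Context d (T : measurableType d) (R : realType) (P : probability T R).
Variable W : 'I_2 -> R -> {RV P >-> R}.
Hypothesis hW : planar_brownian W.
Local Notation dy := (fun n : nat => 2 ^- n : R).

Lemma ae_ord2 (Q : 'I_2 -> T -> Prop) : (forall j, \forall w \ae P, Q j w) ->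
  \forall w \ae P, forall j, Q j w.
Proof.
move=> H; apply: filterS2 (H j1) (H j2) => w h1 h2 j.
by case: (ord2P j) => ->.
Qed.

Lemma good_ae : \forall w \ae P, good_path (planar_path W w).
Proof.
have [hB _] := hW.
have E1 : \forall w \ae P, forall j, W j 0 w = 0 by apply: ae_ord2 => j; have [] := hB j.
have E2 : \forall w \ae P, forall j, modulus_on (fun t => W j t w).
  exact: ae_ord2 (fun j => modulus_ae (hB j)).
have E3 := ae_ord2 (fun j => ae_foralln (fun a => ae_foralln (fun p => variation_ae a p (hB j)))).
have E4 := ae_foralln (fun a => ae_foralln (fun p => covariation_ae a p hW)).
have k0 k : 0 < k.+1%:R^-1 :> R by rewrite invr_gt0.
have E5 := ae_ord2 (fun j => ae_foralln (fun a => ae_foralln (fun p => ae_foralln (fun k =>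
  crossings_ae a p (hB j) (k0 k))))).
near=> w.
have PE j : (fun t => planar_path W w t 0 j) = fun t => W j t w.
  by apply/funext => t; rewrite mxE.
have E1w : forall j, W j 0 w = 0 by near: w.
have E2w : forall j, modulus_on (fun t => W j t w) by near: w.
split.
- by apply/rowP => j; rewrite !mxE E1w.
- by move=> j; rewrite PE.
- move=> j a p.
  have : (fun n => \sum_(r < a * 2 ^ (n - p)) (W j (r.+1%:R * dy n) w - W j (r%:R * dy n) w) ^+ 2)
      @ \oo --> a%:R * dy p by move: j a p; near: w.
  by apply: cvg_trans; apply: near_eq_cvg; apply: nearW => n; apply: eq_bigr => r _; rewrite !mxE.
- move=> a p.
  have : (fun n => \sum_(r < a * 2 ^ (n - p)) (W j1 (r.+1%:R * dy n) w - W j1 (r%:R * dy n) w)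
     * (W j2 (r.+1%:R * dy n) w - W j2 (r%:R * dy n) w)) @ \oo --> (0 : R) by move: a p; near: w.
  by apply: cvg_trans; apply: near_eq_cvg; apply: nearW => n; apply: eq_bigr => r _; rewrite !mxE.
- move=> j a p e e0; rewrite PE.
  have H : forall k, \forall m \near \oo, forall N,
    crossings (fun t => W j t w) (dy m) (a%:R * dy p) N ->
    `|N%:R * dy m ^+ 2 - a%:R * dy p| <= k.+1%:R^-1 by move: j a p {e e0}; near: w.
  have [k ke] : exists k, k.+1%:R^-1 <= e :> R.
    have := near_infty_natSinv_lt (PosNum e0) => -[k _ /(_ k (leqnn _))] /ltW ke.
    by exists k.
  by apply: filterS (H k) => m h N /h /le_trans; apply.
Unshelve. all: by end_near. Qed.

End AlmostAllGood.

(** * Convergence in outer probability *)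

Section FieldMeasurability.
Context d (T : measurableType d) (R : realType).

Lemma floor_level_measurable (Y : T -> R) (k : int) : measurable_fun setT Y ->
  measurable [set w | Num.floor (Y w) = k].
Proof.
move=> mY.
have -> : [set w | Num.floor (Y w) = k] = Y @^-1` `[k%:~R, (k + 1)%:~R[%classic.
  apply/seteqP; split => w /=; rewrite in_itv/=.
    by move/eqP; rewrite floor_eq.
  by rewrite -floor_eq => /eqP.
by rewrite -[_ @^-1` _]setTI; exact: mY.
Qed.

(** A function that is measurable on each piece of a countable measurable
partition. *)
Lemma measurable_glue (g : T -> int) (F : int -> T -> R) :
  (forall k, measurable [set w | g w = k]) -> (forall k, measurable_fun setT (F k)) ->
  measurable_fun setT (fun w => F (g w) w).
Proof.
move=> mg mF _ B mB; rewrite setTI.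
have -> : (fun w => F (g w) w) @^-1` B =
    \bigcup_k ([set w | g w = k] `&` (F k @^-1` B)).
  apply/seteqP; split => w /=; first by move=> FB; exists (g w).
  by move=> [k _ [/= <-]].
apply: countable_bigcupT_measurable => // k; apply: measurableI => //.
by rewrite -[_ @^-1` _]setTI; exact: mF.
Qed.

Definition dyadic_floor (n : nat) (x : R) : R := (Num.floor (x * 2 ^+ n))%:~R * 2 ^- n.

Lemma dyadic_floor_dist n x : `|dyadic_floor n x - x| <= 2 ^- n.
Proof.
have p0 : 0 < 2 ^+ n :> R by rewrite exprn_gt0.
have /andP[h1 h2] := floor_itv (x * 2 ^+ n).
rewrite distrC ger0_norm; last by rewrite subr_ge0 ler_pdivrMr.
rewrite lerBlDl /dyadic_floor -[X in _ + X]mul1r -mulrDl ler_pdivlMr//.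
by move: h2; rewrite intrD => /ltW.
Qed.

(** Rounding the coordinates to a grid leaves countably many values; the general
case follows by continuity of f as the grid is refined. *)
Lemma field_measurable (f : 'rV[R]_2 -> R) (Y1 Y2 : T -> R) : continuous f ->
  measurable_fun setT Y1 -> measurable_fun setT Y2 ->
  measurable_fun setT (fun w => f (vec (Y1 w) (Y2 w))).
Proof.
move=> cf m1 m2.
apply: (@measurable_fun_cvg _ _ _ _
  (fun n w => f (vec (dyadic_floor n (Y1 w)) (dyadic_floor n (Y2 w))))).
  move=> n; have p_meas (Y : T -> R) k : measurable_fun setT Y ->
      measurable [set w | Num.floor (Y w * 2 ^+ n) = k].
    by move=> mY; apply: floor_level_measurable; exact: measurable_funM.
  apply: (@measurable_glue (fun w => Num.floor (Y1 w * 2 ^+ n))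
    (fun k w => f (vec (k%:~R * 2 ^- n) (dyadic_floor n (Y2 w))))) => [k|k]; first exact: p_meas.
  apply: (@measurable_glue (fun w => Num.floor (Y2 w * 2 ^+ n))
    (fun l w => f (vec (k%:~R * 2 ^- n) (l%:~R * 2 ^- n)))) => l; first exact: p_meas.
  exact: measurable_cst.
move=> w _; apply: (cvg_comp _ f _ (@cf _)).
apply/cvgrPdist_le => e e0.
have := @h_cvg0 R => /cvgr0Pnorm_le/(_ _ e0); apply: filterS => n ne.
apply: norm_le_coord => j; rewrite coordB.
have {}ne : 2 ^- n <= e := le_trans (ler_norm _) ne.
by case: (ord2P j) => ->; rewrite !planeE distrC (le_trans (dyadic_floor_dist _ _)).
Qed.

End FieldMeasurability.

Lemma triangle_gap (R : realType) (e x1 x2 x3 : R) : 0 < x1 - e -> 0 < (x1 - e) / 2 ->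
  x2 <= (x1 - e) / 2 -> x1 <= x3 + x2 -> e < x3.
Proof. by move=> h1 h2 h3 h4; lra. Qed.

Section VanishingInProbability.
Context d (T : measurableType d) (R : realType) (P : probability T R).
Implicit Types A D : nat -> set T.

(** Almost sure convergence implies convergence in probability, through the
decreasing unions of the sets D m. *)
Lemma vanishes_ae A D : (forall n, measurable (D n)) ->
  (\forall w \ae P, forall n, A n w -> D n w) ->
  (\forall w \ae P, \forall n \near \oo, ~ D n w) -> vanishes_in_prob P A.
Proof.
move=> mD [N [mN N0 HN]] [N' [mN' N'0 HN']].
(* the null set N, outside of which A n lies in D n, is added to each superset *)
pose E n := N `|` \bigcup_(m in [set m | (n <= m)%N]) D m.
have mE n : measurable (E n) by apply: measurableU => //; exact: bigcup_measurable.
have mI : measurable (\bigcap_n E n) by exact: bigcap_measurableType.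
exists E; split=> //.
  move=> n w Aw; have [Nw|Nw] := pselect (N w); first by left.
  right; exists n => //=; move: Aw.
  by apply: contrapT => h; apply: Nw; apply: HN => /= H; apply: h; exact: H.
have : (P \o E) @ \oo --> P (\bigcap_n E n).
  apply: nonincreasing_cvg_mu => //.
    by rewrite (le_lt_trans (probability_le1 P (mE 0%N)))// ltry.
  move=> m n mn; apply/subsetPset => w [Nw|[k /= nk Dk]]; first by left.
  by right; exists k => //=; exact: leq_trans nk.
suff -> : P (\bigcap_n E n) = 0 by [].
apply/eqP; rewrite eq_le measure_ge0 andbT.
have <- : P (N `|` N') = 0 by rewrite -[RHS]N0; exact: measureU0.
apply: le_measure; rewrite ?inE//; first exact: measurableU.
move=> w Ew; have [Nw|Nw] := pselect (N w); first by left.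
right; apply: HN' => -[n _ H].
have [//|[k /= nk Dk]] := Ew n I; exact: H Dk.
Qed.

Lemma vanishesS A A' : (\forall w \ae P, forall n, A n w -> A' n w) ->
  vanishes_in_prob P A' -> vanishes_in_prob P A.
Proof.
move=> [N [mN N0 HN]] [E [mE AE cE]].
exists (fun n => E n `|` N); split=> [n|n w Aw|]; first exact: measurableU.
  have [Nw|Nw] := pselect (N w); [by right|left; apply: AE].
  by apply: contrapT => h; apply: Nw; apply: HN => /= H; apply: h; exact: H.
apply: cvg_trans cE; apply: near_eq_cvg; apply: nearW => n /=.
exact/esym/measureU0.
Qed.

Lemma vanishesU A A' : vanishes_in_prob P A -> vanishes_in_prob P A' ->
  vanishes_in_prob P (fun n => A n `|` A' n).
Proof.
move=> [E [mE AE cE]] [E' [mE' AE' cE']].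
exists (fun n => E n `|` E' n); split=> [n|n|]; first exact: measurableU.
  exact: setUSS.
have c2 : (fun n => P (E n) + P (E' n))%E @ \oo --> 0%E.
  by rewrite -[X in _ --> X]adde0; exact: cvgeD.
apply: squeeze_cvge (cvg_cst 0%E) c2; apply: nearW => n.
by rewrite measure_ge0/= measureU2.
Qed.

Variables (X : nat -> R -> T -> R) (L : R -> T -> R) (K e : R).

(** The limit L is not known to be measurable, so the supersets are built from
differences X n - X m at rational times.  If X n is far from L at some time,
then, by the last hypothesis, also at an earlier rational time q, and X m is
close to L at q for m large. *)
Lemma uniform_vanishes : 0 < e -> (forall n t, measurable_fun setT (X n t)) ->
  (\forall w \ae P, (forall e' : R, 0 < e' -> \forall n \near \oo, forall t : R, 0 <= t <= K ->
     `|X n t w - L t w| <= e') /\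
   (forall n, X n 0 w = L 0 w) /\
   (forall n (t : R), 0 < t -> e < `|X n t w - L t w| ->
     exists a, [/\ 0 <= a, a < t & forall s, a < s < t -> e < `|X n s w - L s w|])) ->
  vanishes_in_prob P (fun n => [set w | exists t, 0 <= t <= K /\ e < `|X n t w - L t w|]).
Proof.
move=> e0 mX H.
pose D n := \bigcup_(m in [set m | (n <= m)%N])
  \bigcup_(q in [set q : rat | 0 <= (ratr q : R) <= K])
    [set w | e < `|X n (ratr q) w - X m (ratr q) w|].
apply: (@vanishes_ae _ D).
- move=> n; apply: bigcup_measurable => m _.
  rewrite bigcup_mkcond; apply: bigcupT_measurable_rat => q; case: ifPn => // _.
  rewrite -[X in measurable X]setTI.
  have mm : measurable_fun setT (fun w : T => e < `|X n (ratr q) w - X m (ratr q) w|).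
    apply: measurable_fun_ltr => //; apply: measurableT_comp => //.
    exact: measurable_funB.
  exact: (mm measurableT [set true] I).
- apply: filterS H => w [H1 [H2 H3]] n [t [/andP[t0 tK] et]].
  (* at time 0 the processes agree with their limit *)
have {}t0 : 0 < t.
    rewrite lt_neqAle t0 andbT; apply/eqP => t0'; move: et.
    by rewrite -t0' H2 subrr normr0 ltNge ltW.
  have [a [a0 at_ Ha]] := H3 n t t0 et.
  have [q] := rat_in_itvoo at_; rewrite in_itv/= => aqt.
  have /andP[aq qt] := aqt.
  have qK : 0 <= (ratr q : R) <= K.
    by rewrite (le_trans a0 (ltW aq)) (le_trans (ltW qt) tK).
  have eq := Ha _ aqt.
  pose r := `|X n (ratr q) w - L (ratr q) w| - e.
  have r0 : 0 < r by rewrite subr_gt0.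
  have r2 : 0 < r / 2 by rewrite divr_gt0.
  have [m0 _ Hm] := H1 _ r2.
  have Hm1 := Hm (maxn m0 n) (leq_maxl _ _) _ qK.
  exists (maxn m0 n); first exact: leq_maxr.
  exists q => //=.
  have := ler_distD (X (maxn m0 n) (ratr q) w) (X n (ratr q) w) (L (ratr q) w).
  move: r0 r2 Hm1; rewrite /r.
  set x1 := `|X n _ w - L _ w|; set x2 := `|X _ _ w - L _ w|; set x3 := `|X n _ w - X _ _ w|.
  by move: x1 x2 x3; exact: triangle_gap.
- apply: filterS H => w [H1 [H2 H3]].
  have e2 : 0 < e / 2 by rewrite divr_gt0.
  have [n0 _ Hn] := H1 _ e2; exists n0 => // n /= n0n [m /= nm [q qK /=]].
  apply/negP; rewrite -leNgt.
  have h1 := Hn n n0n _ qK; have h2 := Hn m (leq_trans n0n nm) _ qK.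
  rewrite -(subrKA (L (ratr q) w)) (le_trans (ler_normD _ _))// [leRHS]splitr lerD//.
  by rewrite distrC.
Qed.

End VanishingInProbability.

(** * The Ito integral *)

Section ModulusComplements.
Variable R : realType.

Lemma modulus_sum (n : nat) (F : 'I_n -> R -> R) : (forall i, modulus_on (F i)) ->
  modulus_on (fun t => \sum_(i < n) F i t).
Proof.
move=> uF; elim: n F uF => [|n IH] F uF.
  by under [X in modulus_on X]funext => t do rewrite big_ord0; exact: modulus_cst.
under [X in modulus_on X]funext => t do rewrite big_ord_recr/= -[X in _ + X]opprK.
apply: modulusB; first exact: (IH (fun i => F (widen_ord (leqnSn n) i))).
under [X in modulus_on X]funext => t do rewrite -mulN1r.
exact: modulusZ.
Qed.

(** Stopping does not increase distances between times. *)
Lemma modulus_stopped (c : R) (f : R -> R) : 0 <= c -> modulus_on f ->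
  modulus_on (fun t => f (Num.min c t)).
Proof.
move=> c0 uf K e e0; have [p p0 fp] := uf K _ e0; exists p => // s t /andP[s0 sK] /andP[t0 tK] st.
apply: fp; rewrite ?le_min ?c0 ?s0 ?t0 ?ge_min ?sK ?tK ?orbT//.
apply: le_lt_trans st.
have [cs|sc] := leP c s; have [ct|tc] := leP c t => //.
- by rewrite subrr normr0.
- rewrite !ger0_norm ?subr_ge0 ?(ltW tc)//; last exact: le_trans (ltW tc) cs.
  by rewrite lerB.
- rewrite distrC (distrC s) !ger0_norm ?subr_ge0 ?(ltW sc)//; last exact: le_trans (ltW sc) ct.
  by rewrite lerB.
Qed.

(** A large value at t > 0 persists on an interval to the left of t. *)
Lemma modulus_left (f : R -> R) (e t : R) : modulus_on f -> 0 < t -> e < `|f t| ->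
  exists a, [/\ 0 <= a, a < t & forall s, a < s < t -> e < `|f s|].
Proof.
move=> uf t0 et; have r0 : 0 < `|f t| - e by rewrite subr_gt0.
have [p p0 fp] := uf t _ r0.
exists (Num.max 0 (t - p)); rewrite le_max lexx gt_max t0 ltrBlDr ltrDl; split=> //.
move=> s /andP[]; rewrite gt_max => /andP[s0 ps] st.
have : `|f t - f s| < `|f t| - e.
  apply: fp; rewrite ?(ltW t0) ?(ltW s0) ?(ltW st) ?lexx//.
  by rewrite gtr0_norm ?subr_gt0// ltrBlDl -ltrBlDr.
have := ler_normD (f t - f s) (f s); rewrite subrK.
by move: `|f t| `|f s| `|_ - _| => a b c h1 h2; move: h1 h2; lra.
Qed.

Lemma modulus_measurable (f : R -> R) : modulus_on f ->
  measurable_fun (`[0, +oo[%classic : set R) f.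
Proof.
move=> uf.
have -> : `[0, +oo[%classic = \bigcup_n `[0, n%:R]%classic :> set R.
  apply/seteqP; split => x /=; rewrite in_itv/= ?andbT.
    move=> x0; exists (Num.truncn x).+1 => //=.
    by rewrite in_itv/= x0 ltW// real_truncnS_gt// num_real.
  by move=> [n _]; rewrite /= in_itv/= => /andP[].
apply/measurable_fun_bigcup => n //.
apply: subspace_continuous_measurable_fun => //.
exact: modulus_within.
Qed.

End ModulusComplements.

Lemma CkS (R : realType) (k : nat) (f : 'rV[R]_2 -> R) : Ck k.+1 f -> Ck k f.
Proof.
elim: k f => [|k IH] f; first by case.
move=> [cf H]; split=> // j; have [dj Cj] := H j; split=> //; exact: IH.
Qed.

Section ItoIntegral.
Context d (T : measurableType d) (R : realType) (P : probability T R).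
Variable W : 'I_2 -> R -> {RV P >-> R}.
Hypothesis hW : planar_brownian W.
Variables (phi : 'rV[R]_2 -> R) (y : 'rV[R]_2).
Hypothesis phiC2 : Ck 2 phi.
Local Notation dy := (fun n : nat => 2 ^- n : R).

Let cgrad j : continuous (partial j phi). Proof. by case: phiC2 => _ /(_ j)[_ []]. Qed.

(** The martingale part of the Tanaka-Rosen-Yor formula, defined by that formula. *)
Definition martingale_part (t : R) (w : T) : R :=
  let b := planar_path W w in
  \int[lebesgue_measure]_(u in `[0, t]) phi (b t - b u - y) - t * phi (- y) -
  2^-1 * \int[lebesgue_measure]_(v in `[0, t])
    \int[lebesgue_measure]_(u in `[0, v]) laplacian phi (b v - b u - y).

Definition integrand (j : 'I_2) (v : R) (w : T) : R :=
  let b := planar_path W w in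
  \int[lebesgue_measure]_(u in `[0, v]) partial j phi (b v - b u - y).

Definition sampled_process (n : nat) : simple_process T R :=
  SimpleProcess (n * 2 ^ n) (fun k => k%:R * dy n)
    (fun j k w => sample_value (planar_path W w) phi y n j k).

(** The Riemann sum at time k 2^-n uses the path only up to that time. *)
Lemma sample_known n j k : known (fun ju : 'I_2 * R => W ju.1 ju.2 : T -> R)
  [set ju | 0 <= ju.2 <= k%:R * dy n]
  (fun w => sample_value (planar_path W w) phi y n j k).
Proof.
apply: clip_measurable; apply: measurable_sum => l; apply: measurable_funM => //.
pose Y i w := W i (k%:R * dy n) w - W i (l%:R * dy n) w - y 0 i.
have d0 := dyadic_gt0 R n.
have kY i : known (fun ju : 'I_2 * R => W ju.1 ju.2 : T -> R)
    [set ju | 0 <= ju.2 <= k%:R * dy n] (Y i).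
  apply: measurable_funB => //; apply: measurable_funB.
    by apply: (@known_gen _ _ _ _ (fun ju : 'I_2 * R => W ju.1 ju.2 : T -> R) _ (i, _)); rewrite /= lexx mulr_ge0// ltW.
  apply: (@known_gen _ _ _ _ (fun ju : 'I_2 * R => W ju.1 ju.2 : T -> R) _ (i, _)).
  by rewrite /= mulr_ge0 ?(ltW d0)//= ler_pM2r// ler_nat -ltnS.
have := field_measurable (@cgrad j) (kY j1) (kY j2); apply: eq_measurable_fun => w _.
congr (partial j phi _); apply/rowP => i; rewrite !planeE.
by case: (ord2P i) => ->; rewrite !planeE /Y !mxE.
Qed.

Lemma sample_measurable n j k :
  measurable_fun setT (fun w => sample_value (planar_path W w) phi y n j k).
Proof. by apply: known_measurable (@sample_known n j k) => ju _. Qed.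

Lemma sampled_wf n : simple_wf W (sampled_process n).
Proof.
split=> /=.
- by rewrite mul0r.
- by move=> k; rewrite ler_wpM2r ?ler_nat// ltW// dyadic_gt0.
- by move=> j k B mB; exact: known_preimage (@sample_known n j k) mB.
- by move=> j k; exists n%:R => w; exact: clip_bound.
Qed.

Lemma integrand_modulus w j : good_path (planar_path W w) -> modulus_on (fun v => integrand j v w).
Proof. by move=> gw; exact: grad_modulus (good_modulus gw) (@cgrad) j. Qed.

Lemma martingale_part_modulus w : good_path (planar_path W w) ->
  modulus_on (fun t => martingale_part t w).
Proof.
move=> gw; have bm := good_modulus gw.
apply: modulusB; last exact: modulusZ (modulus_Lphi y bm phiC2).
apply: modulusB; first exact: modulus_lhs y bm phiC2.
under [X in modulus_on X]funext => t do rewrite mulrC.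
exact: modulusZ (@modulus_id R).
Qed.

Lemma sampled_integral_vanishes (K e : R) : 0 < e ->
  vanishes_in_prob P (fun n => [set w | exists t, 0 <= t <= K /\
    e < `|simple_integral W (sampled_process n) t w - martingale_part t w|]).
Proof.
move=> e0.
apply: (@uniform_vanishes _ _ _ _ (fun n t w => simple_integral W (sampled_process n) t w)) => //.
  move=> n t; apply: measurable_sum => j; apply: measurable_sum => k.
  apply: measurable_funM; first exact: sample_measurable.
  exact: measurable_funB.
apply: filterS (good_ae hW) => w gw; have Im := martingale_part_modulus gw.
split; last split.
- move=> e' e'0.
  have := sample_integral_cvg (good_modulus gw) Im (good_ito y gw phiC2) (@cgrad) K e'0.
  apply: filterS => n Hn t /Hn; congr (`|_ - _| <= _).
  by apply: eq_bigr => j _; apply: eq_bigr => k _; rewrite !mxE.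
- move=> n; rewrite /simple_integral big1 => [|j _].
    by rewrite /martingale_part !set_itv1 !Rintegral_set1 mul0r mulr0 !subr0.
  rewrite big1// => k _ /=.
  by rewrite !min_r ?subrr ?mulr0// mulr_ge0// ltW// dyadic_gt0.
- move=> n t; apply: modulus_left (fun t => _ - _) _ _ _; apply: modulusB => //.
  apply: modulus_sum => j; apply: modulus_sum => k; apply: modulusZ.
  have Wm : modulus_on (fun t => W j t w).
    have := good_coord gw j.
    by under [X in modulus_on X -> _]funext => u do rewrite mxE.
  have t0 i : 0 <= i%:R * dy n by rewrite mulr_ge0// ltW// dyadic_gt0.
  by apply: modulusB; [exact: modulus_stopped (t0 k.+1) Wm|exact: modulus_stopped (t0 k) Wm].
Qed.

(** Step processes are left-continuous: they are constant on ]k dt, (k+1) dt]. *)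
Lemma step_left (xi : nat -> R) (dt s t : R) (N k : nat) : 0 < dt ->
  k%:R * dt < s -> s <= t -> t <= k.+1%:R * dt ->
  \sum_(i < N) xi i * \1_(`]i%:R * dt, i.+1%:R * dt]%classic) s =
  \sum_(i < N) xi i * \1_(`]i%:R * dt, i.+1%:R * dt]%classic) t.
Proof.
move=> dt0 ks st tk; apply: eq_bigr => i _; congr (_ * _); rewrite !indicE; congr (_ %:R).
have lt_d (a b : nat) : (a%:R * dt < b%:R * dt) = (a < b)%N by rewrite ltr_pM2r// ltr_nat.
congr nat_of_bool; apply/idP/idP; rewrite !inE/= !in_itv/= => /andP[h1 h2].
  rewrite (lt_le_trans h1 st)/= (le_trans tk)// ler_pM2r// ler_nat ltnS.
  by rewrite -ltnS -lt_d (lt_le_trans ks h2).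
rewrite (le_trans st h2) andbT (le_lt_trans _ ks)// ler_pM2r// ler_nat.
by rewrite -ltnS -lt_d (lt_le_trans h1 tk).
Qed.

Lemma sampled_eval_vanishes (K e : R) (j : 'I_2) : 0 < e ->
  vanishes_in_prob P (fun n => [set w | exists t, 0 <= t <= K /\
    e < `|simple_eval (sampled_process n) j t w - integrand j t w|]).
Proof.
move=> e0.
apply: (@uniform_vanishes _ _ _ _ (fun n t w => simple_eval (sampled_process n) j t w)) => //.
  move=> n t; apply: measurable_sum => k.
  by apply: measurable_funM => //; exact: sample_measurable.
apply: filterS (good_ae hW) => w gw; have Hm := @integrand_modulus w j gw.
split; last split.
- move=> e' e'0.
  have := sample_eval_cvg y (good_modulus gw) (@cgrad) K e'0.
  by apply: filterS => n Hn t /(Hn j).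
- move=> n; rewrite /simple_eval big1 => [|k _].
    by rewrite /integrand !set_itv1 !Rintegral_set1.
  rewrite indicE memNset ?mulr0//= in_itv/= => /andP[+ _].
  by rewrite ltNge mulr_ge0// ltW// dyadic_gt0.
- move=> n t t0; have dn := dyadic_gt0 R n.
  have [k [k1 k2]] := ceil_index dn t0.
  set c := simple_eval _ _ _ _ => ec.
  have fm : modulus_on (fun s => c - integrand j s w) := modulusB (modulus_cst c) Hm.
  have [a [a0 at_ Ha]] := modulus_left fm t0 ec.
  exists (Num.max a (k%:R * dy n)); split; [by rewrite le_max a0|by rewrite gt_max at_ k1|].
  move=> s; rewrite gt_max => /andP[/andP[as_ ks] st].
  rewrite /simple_eval (step_left (fun i => sp_value (sampled_process n) j i w) _ dn ks (ltW st) k2).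
  by apply: Ha; rewrite as_ st.
Qed.

(** Uniform closeness of the integrands on [0, K] bounds the integral of the
square of their difference. *)
Lemma sampled_square_vanishes (K e : R) : 0 < K -> 0 < e -> vanishes_in_prob P (fun n =>
  [set w | (e%:E < \int[lebesgue_measure]_(v in `[0%R, K])
    (\sum_(j < 2) (simple_eval (sampled_process n) j v w - integrand j v w) ^+ 2)%R%:E)%E]).
Proof.
move=> K0 e0; pose c := Num.min 1 (e / (2 * K)).
have c0 : 0 < c by rewrite lt_min ltr01 divr_gt0// mulr_gt0.
(* two coordinates, each with an error of at most c *)
have cK : (2 * c ^+ 2) * K <= e.
  have c1 : c ^+ 2 <= e / (2 * K).
    rewrite expr2 (@le_trans _ _ c)//; last by rewrite ge_min lexx orbT.
    by rewrite ler_piMl ?(ltW c0)// ge_min lexx.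
  by rewrite mulrAC mulrC -ler_pdivlMr// mulr_gt0.
apply: vanishesS (vanishesU (sampled_eval_vanishes K j1 c0) (sampled_eval_vanishes K j2 c0)).
apply: filterS (good_ae hW) => w gw n /=; apply: contraPP => /not_orP[h1 h2].
apply/negP; rewrite -leNgt.
have bnd j v : 0 <= v <= K -> `|simple_eval (sampled_process n) j v w - integrand j v w| <= c.
  move=> vK; rewrite leNgt; apply/negP => hc.
  by case: (ord2P j) hc => -> hc; [apply: h1|apply: h2]; exists v.
have mH j : measurable_fun (`[0, K]%classic : set R) (fun v => integrand j v w).
  apply: measurable_funS (modulus_measurable (integrand_modulus j gw)) => //.
  by move=> x; rewrite /= !in_itv/= => /andP[->].
have mS j : measurable_fun (`[0, K]%classic : set R) (fun v => simple_eval (sampled_process n) j v w).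
  by apply: measurable_sum => k; apply: measurable_funM.
apply: (@le_trans _ _ (\int[lebesgue_measure]_(v in `[0%R, K]) (2 * c ^+ 2)%:E)%E).
  apply: ge0_le_integral => //.
  - by move=> v _; rewrite lee_fin sumr_ge0// => j _; exact: sqr_ge0.
  - apply/measurable_EFinP; apply: measurable_sum => j.
    exact: measurable_funX (measurable_funB (mS j) (mH j)).
  - move=> v; rewrite /= in_itv/= => vK; rewrite lee_fin.
    rewrite (@le_trans _ _ (\sum_(j < 2) c ^+ 2))//; last by rewrite sumr_const card_ord mulr_natl.
    apply: ler_sum => j _; rewrite -(real_normK (num_real (_ - _))).
    by rewrite lerXn2r ?nnegrE ?(ltW c0)// bnd.
by rewrite integral_cst//= lebesgue_measure_itv/= lte_fin K0 -EFinD subr0 -EFinM lee_fin.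
Qed.

Lemma martingale_part_ito : ito_integral W integrand martingale_part.
Proof.
split.
  move=> j; apply: filterS (good_ae hW) => w gw.
  exact: modulus_measurable (integrand_modulus j gw).
exists sampled_process; split.
- exact: sampled_wf.
- exact: sampled_square_vanishes.
- by move=> K e _; exact: sampled_integral_vanishes.
Qed.

End ItoIntegral.

Theorem theorem2 (R : realType) (d : measure_display) (T : measurableType d)
  (P : probability T R) (W : 'I_2 -> R -> {RV P >-> R})
  (phi : 'rV[R]_2 -> R) (y : 'rV[R]_2)
  (hW : planar_brownian W) (hphi : Ck 3 phi) :
  exists I : R -> T -> R,
    ito_integral W
      (fun j v w => let b := planar_path W w in
         \int[lebesgue_measure]_(u in `[0, v]) partial j phi (b v - b u - y)) I
    /\ \forall w \ae P,
    let b := planar_path W w in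
    let lhs t := \int[lebesgue_measure]_(u in `[0, t]) phi (b t - b u - y) in
    let common t := \int[lebesgue_measure]_(u in `[0, t]) phi (- b u - y) in
    let Lphi t := \int[lebesgue_measure]_(v in `[0, t])
      \int[lebesgue_measure]_(u in `[0, v]) laplacian phi (b v - b u - y) in
    [/\ (forall K : R, 0 < K ->
          [/\ {uniform `[0, K], along_imbedded b (trm_lhs phi y) @ \oo -->
                 (fun t => lhs t - common t)},
              {uniform `[0, K], along_imbedded b (trm_path phi y) @ \oo -->
                 (fun t => t * phi (- y) - common t)},
              {uniform `[0, K], along_imbedded b (trm_mart phi y) @ \oo -->
                 (fun t => I t w)},
              {uniform `[0, K], along_imbedded b (trm_lap phi y) @ \oo -->
                 (fun t => 2^-1 * Lphi t)}
            & {uniform `[0, K],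
                 along_imbedded b (fun h S n =>
                   trm_lhs phi y h S n -
                   (trm_path phi y h S n + trm_mart phi y h S n
                    + trm_lap phi y h S n)) @ \oo -->
                 (fun _ : R => 0 : R)}]),
        (forall t : R, 0 <= t ->
          lhs t = t * phi (- y) + I t w + 2^-1 * Lphi t)
      & (forall t : R, 0 <= t ->
          (fun m : nat =>
             \sum_(x \in grid (2 ^- m))
               self_local_time b m t x * laplacian phi (x - y) * 2 ^- (2 * m))
          @ \oo --> Lphi t)].
Proof.
have phiC2 : Ck 2 phi := CkS hphi.
exists (martingale_part W phi y); split; first exact: martingale_part_ito.
apply: filterS (good_ae hW) => w gw.
have [H1 H2] := good_limits y gw phiC2.
split=> // t _.
by rewrite /martingale_part -addrA subrK addrC subrK.
Qed.
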